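(* Let $0<\delta\le 1$. Let $g:\mathbb{R}\to\mathbb{R}$ be $1$-periodic with Fourier expansion $g(x)=\sum_{k\in\mathbb{Z}}C_k e^{2\pi i kx}$, differentiable with $g'$ Lipschitz continuous, and define $G_\delta(x)=\sum_{n=1}^{\infty}\frac{g(n^2x)}{n^{1+\delta}}$. If there exists a positive square-free integer $d_0$ such that $$\sum_{\substack{k=m^{2}d_0\\ m\in\mathbb{N}^+}}C_k\,k^{\delta/2}\neq0,$$ then $$\dim_{\mathrm{B}}\bigl(\mathrm{graph}(G_\delta)\bigr)=\frac74-\frac{\delta}{2}.$$ In particular, this dimension formula holds for any (real-valued) trigonometric polynomial $g(x)=\sum_{k=-N}^{N}C_k e^{2\pi i kx}$ which satisfies $\sum_{1\le m^{2}d_0\le N}C_{m^2d_0}(m^2d_0)^{\delta/2}\neq0$ (sum over positive integers $m$) for some positive square-free integer $d_0$.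
   Context: $\mathbb{N}^+$ denotes the positive integers. For a continuous function $f$ on $[0,1]$ (here the restriction of $G_\delta$ to $[0,1]$), $\mathrm{graph}(f)=\{(x,f(x)):x\in[0,1]\}$. For a positive integer $N$, $A_N(f)$ is the number of grid squares $[i/N,(i+1)/N]\times[j/N,(j+1)/N]$ ($i,j\in\mathbb{Z}$) of side length $1/N$ that intersect $\mathrm{graph}(f)$. The box dimension is $\dim_{\mathrm{B}}(\mathrm{graph}(f))=\lim_{N\to\infty}\frac{\log A_N(f)}{\log N}$; the assertion includes that this limit exists. *)

(* Defs.v *)
From Stdlib Require Export Reals ZArith List.
From Coquelicot Require Export Coquelicot.
Open Scope R_scope.

(* e(t) = exp(2 pi i t) *)
Definition e2pi (t : R) : C := (cos (2 * PI * t), sin (2 * PI * t)).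

Definition periodic1 (g : R -> R) : Prop := forall x : R, g (x + 1) = g x.

Definition lipschitz (h : R -> R) : Prop :=
  exists L : R, forall x y : R, Rabs (h x - h y) <= L * Rabs (x - y).

(* C is taken as a normed module over R, so that RInt is the Riemann integral
   of a complex-valued function of a real variable. *)
Definition fourier_coef (g : R -> R) (k : Z) : C :=
  RInt (V := C_R_CompleteNormedModule)
    (fun t : R => (RtoC (g t) * e2pi (- IZR k * t))%C) 0 1.

(* The term of index n is the one of index n + 1 in the mathematical sum. *)
Definition G (delta : R) (g : R -> R) (x : R) : R :=
  Series (fun n : nat =>
    g (INR (S n) ^ 2 * x) / Rpower (INR (S n)) (1 + delta)).

Definition square_free (d : nat) : Prop :=
  forall m : nat, Nat.divide (m * m) d -> m = 1%nat.

(* c_k k^(delta/2), for an index k > 0 *)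
Definition weighted (c : Z -> C) (delta : R) (k : nat) : C :=
  (c (Z.of_nat k) * RtoC (Rpower (INR k) (delta / 2)))%C.

Definition trig_poly (N : nat) (c : Z -> C) (x : R) : C :=
  sum_n (G := C_AbelianMonoid)
    (fun j : nat =>
       let k := (Z.of_nat j - Z.of_nat N)%Z in (c k * e2pi (IZR k * x))%C)
    (2 * N).

Definition graph01 (f : R -> R) (p : R * R) : Prop :=
  0 <= fst p <= 1 /\ snd p = f (fst p).

Definition grid_square (N : nat) (s : Z * Z) (p : R * R) : Prop :=
  IZR (fst s) / INR N <= fst p <= (IZR (fst s) + 1) / INR N /\
  IZR (snd s) / INR N <= snd p <= (IZR (snd s) + 1) / INR N.

Definition meets_graph (f : R -> R) (N : nat) (s : Z * Z) : Prop :=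
  exists p : R * R, grid_square N s p /\ graph01 f p.

(* The set of grid squares of side 1/N meeting the graph is finite, of
   cardinality n; this determines n. *)
Definition is_grid_count (f : R -> R) (N n : nat) : Prop :=
  exists l : list (Z * Z),
    NoDup l /\ (forall s : Z * Z, In s l <-> meets_graph f N s) /\
    length l = n.

Definition is_box_dim (f : R -> R) (D : R) : Prop :=
  exists A : nat -> nat,
    (forall N : nat, (0 < N)%nat -> is_grid_count f N (A N)) /\
    is_lim_seq (fun N : nat => ln (INR (A N)) / ln (INR N)) D.

(* Main.v *)
Require Import Defs.
From Stdlib Require Import Lra Lia Classical ClassicalEpsilon.
From Stdlib Require FinFun.

(** The number of squares of side [1/N] that meet the graph is, up to [O(N)],
    [N] times the sum over the [N] cells [[i/N, (i+1)/N]] of the oscillation of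
    [G], so it suffices that this sum be [N^(3/4 - delta/2)] up to powers of
    [log N]. The typical oscillation is therefore [N^(-1/4 - delta/2)]: it
    is produced by the terms of index [n] close to [sqrt N], which are of size
    [n^(-1-delta)] and add up like [sqrt n] independent contributions.

    Upper bound. Since [g'] is Lipschitz, the Fourier coefficients [C_k] of
    [g] satisfy [sum k |C_k| < oo] ([coef_weighted_bound]) and [g] is the sum
    of its Fourier series ([fourier_expansion]). The series for [G] is split
    into blocks [2^j <= n < 2^(j+1)]. The fourth moment of
    [sum_n a_n e(n^2 x)] over a block counts the solutions of
    [n^2 + q^2 = m^2 + p^2], of which there are at most a constant times
    [(j + 3) 4^j] ([energy]); in the fourth mean, the sum thus behaves as if its
    terms were independent. The absolute convergence of [sum k |C_k|]
    transfers this to the blocks of [G] and to their derivatives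
    ([blockf_moments]). Bounding the oscillation on a cell by the integral of
    the derivative for [4^j <= N], and by a Sobolev inequality for [4^j > N],
    gives [sum_i osc_i^4 <= N^(-2 delta)] up to logarithms for each block
    ([block_osc4]), hence for the logarithmically many blocks that matter
    ([osc_upper]). Hölder's inequality gives the bound of [sum_i osc_i].

    Lower bound. For [h = 1/N] and a frequency [l = q^2 d] with [d]
    square-free, the coefficient of [G] at [l] is
    [q^(-1-delta) sum_(m | q) m^(1+delta) C_(m^2 d)] ([resonance_sum]). The mean
    over [q] of the divisor sum tends to [sum_m m^delta C_(m^2 d)], which the
    hypothesis makes nonzero ([resonance_main]). Taking [q] of order [sqrt N],
    where the increment [G(x + h) - G(x)] does not attenuate the frequency
    [q^2 d], a duality argument shows that the mean square of this increment
    is at least a constant times [N^(-1/2 - delta)] ([increment_mean_square]).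
    A function with large second moment and small fourth moment has a large
    first moment, so [sum_i osc_i] has the required order ([osc_lower]). *)

(** * Finite sums over lists *)

(** Index sets are lists, because sums over pairs and quadruples of integers
    and over their images under maps occur. *)
Definition lsum {A : Type} (l : list A) (f : A -> R) : R :=
  fold_right (fun a s => f a + s) 0 l.

Lemma lsum_ext {A} (l : list A) f g :
  (forall a, In a l -> f a = g a) -> lsum l f = lsum l g.
Proof.
  induction l as [|a l IH]; intros H; simpl; [reflexivity|].
  rewrite H by (left; reflexivity).
  rewrite IH; [reflexivity | intros b Hb; apply H; right; exact Hb].
Qed.

Lemma lsum_le {A} (l : list A) f g :
  (forall a, In a l -> f a <= g a) -> lsum l f <= lsum l g.
Proof.
  induction l as [|a l IH]; intros H; simpl; [lra|].
  apply Rplus_le_compat; [apply H; left; reflexivity|].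
  apply IH; intros b Hb; apply H; right; exact Hb.
Qed.

Lemma lsum_plus {A} (l : list A) f g :
  lsum l (fun a => f a + g a) = lsum l f + lsum l g.
Proof. induction l as [|a l IH]; simpl; [ring | rewrite IH; ring]. Qed.

Lemma lsum_scal {A} (l : list A) c f : lsum l (fun a => c * f a) = c * lsum l f.
Proof. induction l as [|a l IH]; simpl; [ring | rewrite IH; ring]. Qed.

Lemma lsum_minus {A} (l : list A) f g :
  lsum l (fun a => f a - g a) = lsum l f - lsum l g.
Proof. induction l as [|a l IH]; simpl; [ring | rewrite IH; ring]. Qed.

Lemma lsum_const {A} (l : list A) c : lsum l (fun _ => c) = INR (length l) * c.
Proof.
  induction l as [|a l IH]; [simpl; ring|].
  change (lsum (a :: l) (fun _ => c)) with (c + lsum l (fun _ => c)).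
  change (length (a :: l)) with (S (length l)); rewrite S_INR, IH; ring.
Qed.

Lemma lsum_0 {A} (l : list A) f : (forall a, In a l -> f a = 0) -> lsum l f = 0.
Proof.
  intros H; rewrite (lsum_ext l f (fun _ => 0) H), lsum_const; ring.
Qed.

Lemma lsum_nonneg {A} (l : list A) f :
  (forall a, In a l -> 0 <= f a) -> 0 <= lsum l f.
Proof.
  intros H; rewrite <- (lsum_0 l (fun _ => 0)) by reflexivity; apply lsum_le; exact H.
Qed.

Lemma lsum_app {A} (l1 l2 : list A) f : lsum (l1 ++ l2) f = lsum l1 f + lsum l2 f.
Proof. induction l1 as [|a l IH]; simpl; [ring | rewrite IH; ring]. Qed.

Lemma lsum_map {A B} (h : A -> B) (l : list A) f :
  lsum (map h l) f = lsum l (fun a => f (h a)).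
Proof. induction l as [|a l IH]; simpl; [reflexivity | rewrite IH; reflexivity]. Qed.

Lemma lsum_swap {A B} (l : list A) (m : list B) (f : A -> B -> R) :
  lsum l (fun a => lsum m (fun b => f a b)) = lsum m (fun b => lsum l (fun a => f a b)).
Proof.
  induction l as [|a l IH]; simpl.
  - symmetry; apply lsum_0; reflexivity.
  - rewrite IH, <- lsum_plus; reflexivity.
Qed.

Lemma lsum_list_prod {A B} (l : list A) (m : list B) (f : A * B -> R) :
  lsum (list_prod l m) f = lsum l (fun a => lsum m (fun b => f (a, b))).
Proof.
  induction l as [|a l IH]; simpl; [reflexivity|].
  rewrite lsum_app, lsum_map, IH; reflexivity.
Qed.

Lemma lsum_mult {A B} (l : list A) (m : list B) f g :
  lsum l f * lsum m g = lsum (list_prod l m) (fun p => f (fst p) * g (snd p)).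
Proof.
  rewrite lsum_list_prod, Rmult_comm, <- lsum_scal; apply lsum_ext; intros a _.
  rewrite Rmult_comm, <- lsum_scal; reflexivity.
Qed.

Lemma lsum_Rabs {A} (l : list A) f : Rabs (lsum l f) <= lsum l (fun a => Rabs (f a)).
Proof.
  induction l as [|a l IH]; simpl; [rewrite Rabs_R0; lra|].
  eapply Rle_trans; [apply Rabs_triang | apply Rplus_le_compat_l; exact IH].
Qed.

Lemma lsum_seq_S s n f : lsum (seq s (S n)) f = lsum (seq s n) f + f (s + n)%nat.
Proof. rewrite seq_S, lsum_app; simpl; ring. Qed.

Lemma lsum_seq1_S n f : lsum (seq 1 (S n)) f = lsum (seq 1 n) f + f (S n).
Proof. apply (lsum_seq_S 1). Qed.

Lemma lsum_incl {A} (l m : list A) f :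
  NoDup l -> incl l m -> (forall a, In a m -> 0 <= f a) -> lsum l f <= lsum m f.
Proof.
  revert m; induction l as [|a l IH]; intros m Hnd Hi Hf; simpl.
  - apply lsum_nonneg; exact Hf.
  - destruct (in_split a m (Hi a (or_introl eq_refl))) as [m1 [m2 ->]].
    inversion Hnd; subst.
    rewrite lsum_app; simpl.
    assert (H := IH (m1 ++ m2)); rewrite lsum_app in H.
    enough (lsum l f <= lsum m1 f + lsum m2 f) by lra.
    apply H; [assumption| |].
    + intros b Hb; assert (Hbm : In b (m1 ++ a :: m2)) by (apply Hi; right; exact Hb).
      apply in_app_or in Hbm; apply in_or_app.
      destruct Hbm as [?|[Hba|?]]; [left; assumption| |right; assumption].
      subst; contradiction.
    + intros b Hb; apply Hf; apply in_app_or in Hb; apply in_or_app; simpl; tauto.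
Qed.

Lemma lsum_single {A} (l : list A) a0 f :
  NoDup l -> In a0 l -> (forall a, In a l -> a <> a0 -> f a = 0) -> lsum l f = f a0.
Proof.
  induction l as [|a l IH]; intros Hnd Hin H0; [contradiction|].
  inversion Hnd; subst; simpl.
  destruct Hin as [<-|Hin].
  - rewrite (lsum_0 l f); [ring|]. intros b Hb.
    apply H0; [right; exact Hb | intros ->; contradiction].
  - rewrite IH; [|assumption|assumption|intros b Hb; apply H0; right; exact Hb].
    rewrite (H0 a); [ring|left; reflexivity|intros ->; contradiction].
Qed.

Lemma lsum_filter {A} (P : A -> bool) (l : list A) :
  lsum l (fun a => if P a then 1 else 0) = INR (length (filter P l)).
Proof.
  induction l as [|a l IH]; [reflexivity|].
  simpl lsum; simpl filter; destruct (P a); rewrite IH; [|ring].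
  change (length (a :: filter P l)) with (S (length (filter P l))); rewrite S_INR; ring.
Qed.

Lemma NoDup_prod {A B} (l : list A) (m : list B) :
  NoDup l -> NoDup m -> NoDup (list_prod l m).
Proof.
  intros Hl Hm; induction Hl as [|a l Ha Hl IH]; simpl; [constructor|].
  apply NoDup_app.
  - apply FinFun.Injective_map_NoDup; [intros x y E; congruence | exact Hm].
  - exact IH.
  - intros [x y] Hx Hy. apply in_map_iff in Hx; destruct Hx as [b [E _]].
    apply in_prod_iff in Hy. inversion E; subst; tauto.
Qed.

Lemma pow4_nonneg z : 0 <= z ^ 4.
Proof. replace (z ^ 4) with ((z ^ 2) ^ 2) by ring; apply pow2_ge_0. Qed.

Lemma pow4_abs z : Rabs z ^ 4 = z ^ 4.
Proof. rewrite RPow_abs; apply Rabs_pos_eq, pow4_nonneg. Qed.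

Lemma pow4_add u v : (u + v) ^ 4 <= 8 * u ^ 4 + 8 * v ^ 4.
Proof.
  assert (E : (u + v) ^ 2 <= 2 * (u ^ 2 + v ^ 2)) by (generalize (pow2_ge_0 (u - v)); lra).
  assert (E2 : ((u + v) ^ 2) ^ 2 <= (2 * (u ^ 2 + v ^ 2)) ^ 2)
    by (apply pow_incr; split; [apply pow2_ge_0 | exact E]).
  generalize (pow2_ge_0 (u ^ 2 - v ^ 2)); lra.
Qed.

(** The tangent line to the fourth power; it turns every use of Hölder's
    inequality with exponent four into a pointwise inequality. *)
Lemma pow4_tangent u t : 4 * t ^ 3 * u <= u ^ 4 + 3 * t ^ 4.
Proof.
  replace (u ^ 4 + 3 * t ^ 4) with (4 * t ^ 3 * u + (u - t) ^ 2 * ((u + t) ^ 2 + 2 * t ^ 2))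
    by ring.
  assert (0 <= (u - t) ^ 2 * ((u + t) ^ 2 + 2 * t ^ 2)); [|lra].
  apply Rmult_le_pos; [apply pow2_ge_0|].
  generalize (pow2_ge_0 (u + t)) (pow2_ge_0 t); lra.
Qed.

(** Hölder's inequality with weights, obtained by summing the tangent
    inequality at the mean; an upper bound [W] of the total weight suffices. *)
Lemma pow4_mean {A} (l : list A) w u W :
  (forall a, In a l -> 0 <= w a) -> lsum l w <= W ->
  (lsum l (fun a => w a * u a)) ^ 4 <= W ^ 3 * lsum l (fun a => w a * u a ^ 4).
Proof.
  intros Hw HW.
  assert (H0 : 0 <= lsum l w) by (apply lsum_nonneg; exact Hw).
  set (X := lsum l (fun a => w a * u a)).
  destruct (Req_dec W 0) as [E|NE].
  - assert (HX : X = 0); [|rewrite HX, E; right; ring].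
    apply lsum_0; intros a Ha.
    assert (w a <= lsum l w).
    { rewrite <- (Rplus_0_r (w a)).
      apply (lsum_incl (a :: nil) l w); [repeat constructor; auto| |exact Hw].
      intros b [<-|[]]; exact Ha. }
    specialize (Hw a Ha). replace (w a) with 0 by lra; ring.
  - assert (WP : 0 < W) by lra.
    set (t := X / W).
    assert (H : lsum l (fun a => w a * (4 * t ^ 3 * u a - 3 * t ^ 4))
                <= lsum l (fun a => w a * u a ^ 4)).
    { apply lsum_le; intros a Ha; apply Rmult_le_compat_l; [apply Hw; exact Ha|].
      generalize (pow4_tangent (u a) t); lra. }
    rewrite (lsum_ext l _ (fun a => 4 * t ^ 3 * (w a * u a) - 3 * t ^ 4 * w a)) in H
      by (intros; ring).
    rewrite lsum_minus, !lsum_scal in H; fold X in H.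
    assert (E : X = t * W) by (unfold t; field; lra).
    assert (Ht4 := pow4_nonneg t).
    assert (H2 : t ^ 4 * lsum l w <= t ^ 4 * W) by (apply Rmult_le_compat_l; lra).
    assert (H3 : t ^ 4 * W <= lsum l (fun a => w a * u a ^ 4)).
    { rewrite E in H. lra. }
    rewrite E. replace ((t * W) ^ 4) with (W ^ 3 * (t ^ 4 * W)) by ring.
    apply Rmult_le_compat_l; [apply pow_le; lra | exact H3].
Qed.

(** * Integrals of continuous functions *)

(* An equation between integrals is stated in the carrier of a normed module;
   the decision procedures expect to see the type of real numbers. *)
Ltac inR := match goal with |- @eq _ ?a ?b => change (@eq R a b) end.
Ltac Rring := inR; ring.

Definition cont (f : R -> R) : Prop := forall x, continuous f x.

Lemma cont_const c : cont (fun _ => c).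
Proof. intros x; apply continuous_const. Qed.

Lemma cont_id : cont (fun x => x).
Proof. intros x; apply continuous_id. Qed.

Lemma cont_plus f g : cont f -> cont g -> cont (fun x => f x + g x).
Proof. intros Hf Hg x; apply (continuous_plus f g); auto. Qed.

Lemma cont_minus f g : cont f -> cont g -> cont (fun x => f x - g x).
Proof. intros Hf Hg x; apply (continuous_minus f g); auto. Qed.

Lemma cont_opp f : cont f -> cont (fun x => - f x).
Proof. intros Hf x; apply (continuous_opp f); auto. Qed.

Lemma cont_mult f g : cont f -> cont g -> cont (fun x => f x * g x).
Proof. intros Hf Hg x; apply (continuous_mult f g); auto. Qed.

Lemma cont_pow f n : cont f -> cont (fun x => f x ^ n).
Proof.
  intros Hf; induction n as [|n IH]; simpl; [apply cont_const | apply cont_mult; auto].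
Qed.

Lemma cont_comp f g : cont f -> cont g -> cont (fun x => f (g x)).
Proof. intros Hf Hg x; apply (continuous_comp g f); auto. Qed.

Lemma cont_cos : cont cos.
Proof. intros x; apply continuous_cos. Qed.

Lemma cont_sin : cont sin.
Proof. intros x; apply continuous_sin. Qed.

Lemma cont_lsum {A} (l : list A) (f : A -> R -> R) :
  (forall a, In a l -> cont (f a)) -> cont (fun x => lsum l (fun a => f a x)).
Proof.
  induction l as [|a l IH]; intros H; simpl; [apply cont_const|].
  apply cont_plus; [apply H; left; reflexivity|].
  apply IH; intros b Hb; apply H; right; exact Hb.
Qed.

Lemma cont_cos_comp f : cont f -> cont (fun x => cos (f x)).
Proof. intros Hf; apply (cont_comp cos f); [apply cont_cos | exact Hf]. Qed.

Lemma cont_sin_comp f : cont f -> cont (fun x => sin (f x)).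
Proof. intros Hf; apply (cont_comp sin f); [apply cont_sin | exact Hf]. Qed.

Create HintDb cont.
#[export] Hint Resolve cont_const cont_id cont_plus cont_minus cont_opp cont_mult
  cont_pow cont_cos_comp cont_sin_comp cont_cos cont_sin : cont.

Lemma ex_RInt_cont f a b : cont f -> ex_RInt f a b.
Proof. intros H; apply (ex_RInt_continuous (V := R_CompleteNormedModule)); intros; apply H. Qed.

Lemma int_plus (f g : R -> R) a b : cont f -> cont g ->
  RInt (fun x => f x + g x) a b = RInt f a b + RInt g a b.
Proof. intros; apply (RInt_plus (V := R_CompleteNormedModule)); apply ex_RInt_cont; auto. Qed.

Lemma int_minus (f g : R -> R) a b : cont f -> cont g ->
  RInt (fun x => f x - g x) a b = RInt f a b - RInt g a b.
Proof. intros; apply (RInt_minus (V := R_CompleteNormedModule)); apply ex_RInt_cont; auto. Qed.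

Lemma int_scal c (f : R -> R) a b : cont f -> RInt (fun x => c * f x) a b = c * RInt f a b.
Proof. intros; apply (RInt_scal (V := R_CompleteNormedModule)); apply ex_RInt_cont; auto. Qed.

Lemma int_ext (f g : R -> R) a b : (forall x, f x = g x) -> RInt f a b = RInt g a b.
Proof. intros; apply RInt_ext; auto. Qed.

Lemma int_const c a b : RInt (fun _ : R => c) a b = (b - a) * c.
Proof. rewrite RInt_const; reflexivity. Qed.

Lemma int_le (f g : R -> R) a b : a <= b -> cont f -> cont g ->
  (forall x, a <= x <= b -> f x <= g x) -> RInt f a b <= RInt g a b.
Proof.
  intros; apply RInt_le; try assumption; try (apply ex_RInt_cont; assumption).
  intros; apply H2; lra.
Qed.

Lemma int_nonneg (f : R -> R) a b : a <= b -> cont f ->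
  (forall x, a <= x <= b -> 0 <= f x) -> 0 <= RInt f a b.
Proof.
  intros Hab Hf H; rewrite <- (Rmult_0_r (b - a)), <- int_const.
  apply int_le; auto with cont.
Qed.

Lemma int_lsum {A} (l : list A) (f : A -> R -> R) a b :
  (forall i, In i l -> cont (f i)) ->
  RInt (fun x => lsum l (fun i => f i x)) a b = lsum l (fun i => RInt (f i) a b).
Proof.
  induction l as [|i l IH]; intros H; simpl.
  - rewrite int_const; apply Rmult_0_r.
  - assert (Hl : forall j, In j l -> cont (f j)) by (intros j Hj; apply H; right; exact Hj).
    rewrite int_plus, IH; auto.
    + apply H; left; reflexivity.
    + apply cont_lsum; auto.
Qed.

Lemma int_chasles (f : R -> R) a b c : cont f -> RInt f a b + RInt f b c = RInt f a c.
Proof.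
  intros; apply (RInt_Chasles (V := R_CompleteNormedModule)); apply ex_RInt_cont; auto.
Qed.

Lemma int_derive (f df : R -> R) a b :
  (forall x, is_derive f x (df x)) -> cont df -> RInt df a b = f b - f a.
Proof.
  intros H Hc; apply is_RInt_unique.
  apply (is_RInt_derive (V := R_CompleteNormedModule) f df); intros; [apply H | apply Hc].
Qed.

Lemma int_comp_lin (f : R -> R) u v a b : cont f ->
  u * RInt (fun y => f (u * y + v)) a b = RInt f (u * a + v) (u * b + v).
Proof.
  intros Hf.
  rewrite <- (RInt_comp_lin (V := R_CompleteNormedModule) f u v a b) by (apply ex_RInt_cont; auto).
  symmetry; apply (int_scal u (fun y => f (u * y + v))).
  apply (cont_comp f (fun y => u * y + v)); auto with cont.
Qed.

Lemma int_shift (f : R -> R) v a b : cont f ->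
  RInt (fun y => f (y + v)) a b = RInt f (a + v) (b + v).
Proof.
  intros Hf. generalize (int_comp_lin f 1 v a b Hf).
  rewrite !Rmult_1_l; intros <-; apply int_ext; intros; rewrite Rmult_1_l; reflexivity.
Qed.

Lemma periodic1_IZR f : periodic1 f -> forall (z : Z) x, f (x + IZR z) = f x.
Proof.
  intros H.
  assert (Hn : forall (n : nat) x, f (x + INR n) = f x).
  { induction n as [|n IH]; intros x; [simpl; rewrite Rplus_0_r; reflexivity|].
    rewrite S_INR, <- Rplus_assoc, H; apply IH. }
  intros z x; destruct (Z_le_gt_dec 0 z) as [Hz|Hz].
  - rewrite <- (Z2Nat.id z Hz), <- INR_IZR_INZ; apply Hn.
  - rewrite <- (Hn (Z.to_nat (- z)) (x + IZR z)), INR_IZR_INZ, Z2Nat.id, opp_IZR by lia.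
    f_equal; ring.
Qed.

Lemma int_periodic (f : R -> R) s : cont f -> periodic1 f -> RInt f s (s + 1) = RInt f 0 1.
Proof.
  intros Hf Hp.
  assert (E : RInt f 1 (s + 1) = RInt f 0 s).
  { replace 1 with (0 + 1) at 1 by ring. rewrite <- int_shift by exact Hf.
    apply int_ext; apply Hp. }
  rewrite <- (int_chasles f s 0 (s + 1)), <- (int_chasles f 0 1 (s + 1)), E by exact Hf.
  generalize (int_chasles f s 0 s Hf). rewrite RInt_point.
  change (zero : R) with 0. lra.
Qed.

(** * Trigonometric sums and Bessel's inequality *)

Definition cs (z : Z) (x : R) : R := cos (2 * PI * (IZR z * x)).
Definition sn (z : Z) (x : R) : R := sin (2 * PI * (IZR z * x)).
Definition kron (a b : Z) : R := if Z.eqb a b then 1 else 0.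

Lemma kron_diag a : kron a a = 1.
Proof. unfold kron; rewrite Z.eqb_refl; reflexivity. Qed.

Lemma kron_neq a b : a <> b -> kron a b = 0.
Proof. intros H; unfold kron; apply Z.eqb_neq in H; rewrite H; reflexivity. Qed.

Lemma kron_bounds a b : 0 <= kron a b <= 1.
Proof. unfold kron; destruct (Z.eqb a b); lra. Qed.

Lemma kron_subst a b (f : Z -> R) : kron a b * f a = kron a b * f b.
Proof. unfold kron; destruct (Z.eqb_spec a b); [subst|]; ring. Qed.

Lemma cont_cs z s : cont (fun x => cs z (x + s)).
Proof. unfold cs; auto 10 with cont. Qed.

Lemma cont_sn z s : cont (fun x => sn z (x + s)).
Proof. unfold sn; auto 10 with cont. Qed.

Lemma cont_cs0 z : cont (cs z).
Proof. unfold cs; auto 10 with cont. Qed.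

Lemma cont_sn0 z : cont (sn z).
Proof. unfold sn; auto 10 with cont. Qed.

#[export] Hint Resolve cont_cs cont_sn cont_cs0 cont_sn0 : cont.

Lemma cos_period_Z x z : cos (x + 2 * PI * IZR z) = cos x.
Proof.
  assert (H : periodic1 (fun t => cos (2 * PI * t))).
  { intros t. rewrite <- (cos_period (2 * PI * t) 1). f_equal; simpl; ring. }
  assert (HP := PI_RGT_0).
  generalize (periodic1_IZR _ H z (x / (2 * PI))); simpl.
  replace (2 * PI * (x / (2 * PI) + IZR z)) with (x + 2 * PI * IZR z) by (field; lra).
  replace (2 * PI * (x / (2 * PI))) with x by (field; lra); trivial.
Qed.

Lemma sin_period_Z x z : sin (x + 2 * PI * IZR z) = sin x.
Proof.
  rewrite !sin_cos, <- Rplus_assoc, cos_period_Z; reflexivity.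
Qed.

Lemma periodic_cs z s : periodic1 (fun x => cs z (x + s)).
Proof.
  intros x; unfold cs; rewrite <- (cos_period_Z (2 * PI * (IZR z * (x + s))) z).
  f_equal; ring.
Qed.

Lemma periodic_sn z s : periodic1 (fun x => sn z (x + s)).
Proof.
  intros x; unfold sn; rewrite <- (sin_period_Z (2 * PI * (IZR z * (x + s))) z).
  f_equal; ring.
Qed.

Lemma cs_plus z x y : cs z (x + y) = cs z x * cs z y - sn z x * sn z y.
Proof. unfold cs, sn; rewrite <- cos_plus; f_equal; ring. Qed.

Lemma sn_plus z x y : sn z (x + y) = sn z x * cs z y + cs z x * sn z y.
Proof. unfold cs, sn; rewrite <- sin_plus; f_equal; ring. Qed.

Lemma cs_opp z x : cs z (- x) = cs z x.
Proof. unfold cs; rewrite <- cos_neg; f_equal; ring. Qed.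

Lemma sn_opp z x : sn z (- x) = - sn z x.
Proof. unfold sn; rewrite <- sin_neg; f_equal; ring. Qed.

Lemma cs_scale z w x : cs z (IZR w * x) = cs (z * w) x.
Proof. unfold cs; rewrite mult_IZR; f_equal; ring. Qed.

Lemma sn_scale z w x : sn z (IZR w * x) = sn (z * w) x.
Proof. unfold sn; rewrite mult_IZR; f_equal; ring. Qed.

Lemma int_cs z s : RInt (fun x => cs z (x + s)) 0 1 = kron z 0.
Proof.
  destruct (Z.eq_dec z 0) as [->|Hz].
  - rewrite kron_diag; erewrite int_ext; [rewrite int_const; rewrite Rminus_0_r; apply Rmult_1_r|].
    intros x; simpl; unfold cs.
    transitivity (cos 0); [f_equal; ring | apply cos_0].
  - rewrite kron_neq by exact Hz.
    assert (Hz' : IZR z <> 0) by (apply not_0_IZR; exact Hz).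
    assert (HP := PI_RGT_0).
    rewrite (int_derive (fun x => sn z (x + s) / (2 * PI * IZR z))).
    + rewrite <- (Rplus_0_l 1), periodic_sn; Rring.
    + intros x; unfold sn, cs; auto_derive; [trivial|].
      field; split; [exact Hz' | lra].
    + auto with cont.
Qed.

Lemma int_sn z s : RInt (fun x => sn z (x + s)) 0 1 = 0.
Proof.
  destruct (Z.eq_dec z 0) as [->|Hz].
  - erewrite int_ext; [rewrite int_const; apply Rmult_0_r|].
    intros x; simpl; unfold sn.
    transitivity (sin 0); [f_equal; ring | apply sin_0].
  - assert (Hz' : IZR z <> 0) by (apply not_0_IZR; exact Hz).
    assert (HP := PI_RGT_0).
    rewrite (int_derive (fun x => - cs z (x + s) / (2 * PI * IZR z))).
    + rewrite <- (Rplus_0_l 1), periodic_cs; Rring.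
    + intros x; unfold sn, cs; auto_derive; [trivial|].
      field; split; [exact Hz' | lra].
    + auto with cont.
Qed.

Lemma cs_freq_add u v x : cs (u + v) x = cs u x * cs v x - sn u x * sn v x.
Proof. unfold cs, sn; rewrite plus_IZR, <- cos_plus; f_equal; ring. Qed.

Lemma cs_freq_sub u v x : cs (u - v) x = cs u x * cs v x + sn u x * sn v x.
Proof. unfold cs, sn; rewrite minus_IZR, <- cos_minus; f_equal; ring. Qed.

Lemma sn_freq_add u v x : sn (u + v) x = sn u x * cs v x + cs u x * sn v x.
Proof. unfold cs, sn; rewrite plus_IZR, <- sin_plus; f_equal; ring. Qed.

Lemma sn_freq_sub u v x : sn (u - v) x = sn u x * cs v x - cs u x * sn v x.
Proof. unfold cs, sn; rewrite minus_IZR, <- sin_minus; f_equal; ring. Qed.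

Lemma int_cs_cs a b s :
  RInt (fun x => cs a (x + s) * cs b (x + s)) 0 1 = / 2 * (kron (a - b) 0 + kron (a + b) 0).
Proof.
  rewrite (int_ext _ (fun x => / 2 * (cs (a - b) (x + s) + cs (a + b) (x + s))))
    by (intros; rewrite cs_freq_sub, cs_freq_add; field).
  rewrite int_scal, int_plus, !int_cs; auto with cont.
Qed.

Lemma int_sn_sn a b s :
  RInt (fun x => sn a (x + s) * sn b (x + s)) 0 1 = / 2 * (kron (a - b) 0 - kron (a + b) 0).
Proof.
  rewrite (int_ext _ (fun x => / 2 * (cs (a - b) (x + s) - cs (a + b) (x + s))))
    by (intros; rewrite cs_freq_sub, cs_freq_add; field).
  rewrite int_scal, int_minus, !int_cs; auto with cont.
Qed.

Lemma int_sn_cs a b s :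
  RInt (fun x => sn a (x + s) * cs b (x + s)) 0 1 = 0.
Proof.
  rewrite (int_ext _ (fun x => / 2 * (sn (a - b) (x + s) + sn (a + b) (x + s))))
    by (intros; rewrite sn_freq_sub, sn_freq_add; field).
  rewrite int_scal, int_plus, !int_sn; auto with cont; Rring.
Qed.

Lemma kron_minus a b : kron (a - b) 0 = kron a b.
Proof.
  unfold kron; destruct (Z.eqb_spec (a - b) 0), (Z.eqb_spec a b); try reflexivity; lia.
Qed.

Lemma kron_plus_pos a b : (0 < a)%Z -> (0 < b)%Z -> kron (a + b) 0 = 0.
Proof. intros; apply kron_neq; lia. Qed.

Definition trig {A} (l : list A) (fr : A -> Z) (p q : A -> R) (x : R) : R :=
  lsum l (fun i => p i * cs (fr i) x + q i * sn (fr i) x).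

Lemma cont_trig {A} (l : list A) fr p q s : cont (fun x => trig l fr p q (x + s)).
Proof. unfold trig; apply cont_lsum; auto with cont. Qed.

Lemma cont_trig0 {A} (l : list A) fr p q : cont (trig l fr p q).
Proof. unfold trig; apply cont_lsum; auto with cont. Qed.
#[export] Hint Resolve cont_trig cont_trig0 : cont.

(** Parseval's identity. The shift [s] will centre the increments of the
    function at the midpoint of their step. *)
Lemma int_trig_trig {A B} (l : list A) (m : list B) fr fr' p q p' q' s :
  (forall i, In i l -> (0 < fr i)%Z) -> (forall j, In j m -> (0 < fr' j)%Z) ->
  RInt (fun x => trig l fr p q (x + s) * trig m fr' p' q' (x + s)) 0 1 =
  / 2 * lsum l (fun i => lsum m (fun j => kron (fr i) (fr' j) * (p i * p' j + q i * q' j))).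
Proof.
  intros Hl Hm; unfold trig.
  rewrite (int_ext _ (fun x => lsum l (fun i => lsum m (fun j =>
    (p i * p' j) * (cs (fr i) (x + s) * cs (fr' j) (x + s)) +
    ((q i * q' j) * (sn (fr i) (x + s) * sn (fr' j) (x + s)) +
    ((q i * p' j) * (sn (fr i) (x + s) * cs (fr' j) (x + s)) +
     (p i * q' j) * (sn (fr' j) (x + s) * cs (fr i) (x + s)))))))).
  2:{ intros x; rewrite Rmult_comm, <- lsum_scal; apply lsum_ext; intros i _.
      rewrite Rmult_comm, <- lsum_scal; apply lsum_ext; intros j _; ring. }
  rewrite int_lsum by (intros; apply cont_lsum; auto 10 with cont).
  rewrite <- lsum_scal; apply lsum_ext; intros i Hi.
  rewrite int_lsum by auto 10 with cont.
  rewrite <- lsum_scal; apply lsum_ext; intros j Hj.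
  rewrite !int_plus, !int_scal, int_cs_cs, int_sn_sn, !int_sn_cs by auto 10 with cont.
  rewrite kron_minus, kron_plus_pos by auto; Rring.
Qed.

Lemma lsum_kron_diag (l : list nat) (f : nat -> nat -> R) :
  NoDup l ->
  lsum l (fun i => lsum l (fun j => kron (Z.of_nat i) (Z.of_nat j) * f i j)) =
  lsum l (fun i => f i i).
Proof.
  intros Hnd; apply lsum_ext; intros i Hi.
  rewrite (lsum_single l i) by
    (trivial; intros j _ Hj; rewrite kron_neq by lia; ring).
  rewrite kron_diag; ring.
Qed.

Lemma bessel f K s :
  cont f ->
  lsum (seq 1 K) (fun k => (RInt (fun x => f x * cs (Z.of_nat k) (x + s)) 0 1) ^ 2 +
                           (RInt (fun x => f x * sn (Z.of_nat k) (x + s)) 0 1) ^ 2)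
  <= / 2 * RInt (fun x => f x ^ 2) 0 1.
Proof.
  intros Hf.
  set (p := fun k => RInt (fun x => f x * cs (Z.of_nat k) (x + s)) 0 1).
  set (q := fun k => RInt (fun x => f x * sn (Z.of_nat k) (x + s)) 0 1).
  set (T := fun x => trig (seq 1 K) Z.of_nat (fun k => 2 * p k) (fun k => 2 * q k) (x + s)).
  assert (HT : cont T) by (unfold T; auto with cont).
  assert (H1 : RInt (fun x => f x * T x) 0 1 =
               2 * lsum (seq 1 K) (fun k => p k ^ 2 + q k ^ 2)).
  { rewrite (int_ext _ (fun x => lsum (seq 1 K) (fun k =>
      (2 * p k) * (f x * cs (Z.of_nat k) (x + s)) +
      (2 * q k) * (f x * sn (Z.of_nat k) (x + s))))).
    - rewrite int_lsum by auto 10 with cont. rewrite <- lsum_scal; apply lsum_ext; intros k _.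
      rewrite int_plus, !int_scal by auto 10 with cont. fold (p k) (q k); ring.
    - intros x; unfold T, trig; rewrite <- lsum_scal; apply lsum_ext; intros; ring. }
  assert (H2 : RInt (fun x => T x * T x) 0 1 =
               2 * lsum (seq 1 K) (fun k => p k ^ 2 + q k ^ 2)).
  { unfold T; rewrite int_trig_trig by (intros i Hi; apply in_seq in Hi; lia).
    rewrite lsum_kron_diag by apply seq_NoDup.
    rewrite <- !lsum_scal; apply lsum_ext; intros; field. }
  assert (H3 : 0 <= RInt (fun x => (f x - T x) ^ 2) 0 1).
  { apply int_nonneg; [lra | auto with cont | intros; apply pow2_ge_0]. }
  rewrite (int_ext _ (fun x => f x ^ 2 - 2 * (f x * T x) + T x * T x)) in H3
    by (intros; ring).
  rewrite int_plus, int_minus, int_scal, H1, H2 in H3 by auto with cont.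
  change (lsum (seq 1 K) (fun k => p k ^ 2 + q k ^ 2) <= / 2 * RInt (fun x => f x ^ 2) 0 1).
  clearbody p q T; revert H3.
  generalize (lsum (seq 1 K) (fun k => p k ^ 2 + q k ^ 2)) (RInt (fun x => f x ^ 2) 0 1).
  simpl; intros; lra.
Qed.

(** * Fourier series of a function with Lipschitz derivative *)

Definition coef_cos (g : R -> R) (k : nat) : R :=
  2 * RInt (fun t => g t * cs (Z.of_nat k) t) 0 1.
Definition coef_sin (g : R -> R) (k : nat) : R :=
  2 * RInt (fun t => g t * sn (Z.of_nat k) t) 0 1.

(** The partial Fourier sum without its constant term, which does not
    influence oscillations. *)
Definition psum (al be : nat -> R) (K : nat) (x : R) : R :=
  trig (seq 1 K) Z.of_nat al be x.

Lemma int_periodic_shift f s :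
  cont f -> periodic1 f -> RInt (fun y => f (y + s)) 0 1 = RInt f 0 1.
Proof.
  intros Hf Hp; rewrite int_shift, Rplus_0_l, (Rplus_comm 1) by exact Hf.
  apply int_periodic; assumption.
Qed.

(** The range contains [[0, PI/2]]. *)
Lemma sin_ge_half x : 0 <= x <= 8 / 5 -> x / 2 <= sin x.
Proof.
  intros [H0 H1]. assert (HP := PI2_3_2).
  destruct (sin_bound x 0 H0) as [H _]; [lra|].
  unfold sin_approx, sin_term in H; simpl in H.
  assert (0 <= x * (3 - x * x)) by (apply Rmult_le_pos; nra).
  lra.
Qed.

Lemma PI_bounds : 3 < PI < 32 / 10.
Proof.
  assert (H := PI2_3_2). split; [lra|].
  (* The fourth order Taylor bound shows that cosine is negative at [8/5]. *)
  destruct (Rlt_or_le PI (32 / 10)) as [Hl|Hl]; [exact Hl|exfalso].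
  assert (Hc : 0 <= cos (8 / 5)) by (apply cos_ge_0; lra).
  destruct (cos_bound (8 / 5) 0) as [_ H2]; [lra|lra|].
  unfold cos_approx, cos_term in H2; simpl in H2. lra.
Qed.

(** Fourier coefficients decay because the second difference of step [s]
    multiplies the k-th one by [-4 sin^2 (PI k s)]; Bessel's inequality with
    [s = 1/(2K)] then controls the first [K] of them at once. *)
Lemma coef_second_difference g L K :
  cont g -> periodic1 g ->
  (forall x s, 0 <= s -> Rabs (g (x + s) + g (x - s) - 2 * g x) <= L * s ^ 2) ->
  lsum (seq 1 K) (fun k => INR k ^ 4 * (coef_cos g k ^ 2 + coef_sin g k ^ 2)) <= L ^ 2 / 2.
Proof.
  intros Hg Hp HL.
  destruct K as [|K']; [simpl; nra|]; set (K := S K').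
  assert (HK : 0 < INR K) by (apply lt_0_INR; unfold K; lia).
  set (s := / (2 * INR K)).
  assert (Hs : 0 < s) by (apply Rinv_0_lt_compat; lra).
  set (u := fun x => g (x + s) + g (x - s) - 2 * g x).
  assert (Hu : cont u).
  { unfold u; apply cont_minus; [apply cont_plus|].
    - apply (cont_comp g (fun x => x + s)); auto with cont.
    - apply (cont_comp g (fun x => x - s)); auto with cont.
    - auto with cont. }
  assert (Hgs : forall v, cont (fun x => g (x + v)))
    by (intros v; apply (cont_comp g (fun x => x + v)); auto with cont).
  set (m := fun k => 2 * cs (Z.of_nat k) s - 2).
  assert (Hmode : forall (e : Z -> R -> R) k, (forall z, cont (e z)) ->
    (forall z v, cont (fun x => e z (x + v))) -> (forall z v, periodic1 (fun x => e z (x + v))) ->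
    (forall z x, e z (x + - s) + e z (x + s) = 2 * cs z s * e z x) ->
    RInt (fun x => u x * e (Z.of_nat k) (x + 0)) 0 1 =
    m k * RInt (fun x => g x * e (Z.of_nat k) x) 0 1).
  { intros e k He0 He Hpe Hadd.
    assert (Hshift : forall z v,
      RInt (fun x => g (x + v) * e z x) 0 1 = RInt (fun x => g x * e z (x + - v)) 0 1).
    { intros z v; rewrite <- (int_periodic_shift (fun x => g x * e z (x + - v)) v).
      - apply int_ext; intros x; f_equal; f_equal; ring.
      - auto with cont.
      - intros x; rewrite Hp; f_equal; apply Hpe. }
    transitivity (RInt (fun x => g (x + s) * e (Z.of_nat k) x +
      (g (x + - s) * e (Z.of_nat k) x - 2 * (g x * e (Z.of_nat k) x))) 0 1).
    { apply int_ext; intros x; rewrite Rplus_0_r; unfold u, Rminus; ring. }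
    rewrite int_plus, int_minus, int_scal, !Hshift by auto with cont.
    rewrite <- int_scal, <- int_scal, <- int_minus, <- int_plus by auto with cont.
    apply int_ext; intros x; rewrite Ropp_involutive; unfold m.
    transitivity (g x * (e (Z.of_nat k) (x + - s) + e (Z.of_nat k) (x + s)) -
      2 * (g x * e (Z.of_nat k) x)); [ring | rewrite Hadd; ring]. }
  assert (Hc : forall k, RInt (fun x => u x * cs (Z.of_nat k) (x + 0)) 0 1 = m k * (coef_cos g k / 2)).
  { intros k; rewrite Hmode by (auto using periodic_cs with cont;
      intros; rewrite !cs_plus, cs_opp, sn_opp; ring).
    unfold coef_cos; inR; field. }
  assert (Hn : forall k, RInt (fun x => u x * sn (Z.of_nat k) (x + 0)) 0 1 = m k * (coef_sin g k / 2)).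
  { intros k; rewrite Hmode by (auto using periodic_sn with cont;
      intros; rewrite !sn_plus, cs_opp, sn_opp; ring).
    unfold coef_sin; inR; field. }
  assert (HB := bessel u K 0 Hu).
  rewrite (lsum_ext _ _ (fun k => m k ^ 2 / 4 * (coef_cos g k ^ 2 + coef_sin g k ^ 2))) in HB
    by (intros k _; rewrite Hc, Hn; field).
  assert (HI : RInt (fun x => u x ^ 2) 0 1 <= (L * s ^ 2) ^ 2).
  { apply Rle_trans with (RInt (fun _ : R => (L * s ^ 2) ^ 2) 0 1).
    - apply int_le; [lra|auto with cont|auto with cont|].
      intros x _. rewrite <- (pow2_abs (u x)). apply pow_incr.
      split; [apply Rabs_pos | apply HL; lra].
    - rewrite int_const; right; Rring. }
  apply Rmult_le_reg_l with (/ (16 * INR K ^ 4)).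
  { apply Rinv_0_lt_compat, Rmult_lt_0_compat; [lra | apply pow_lt; exact HK]. }
  apply Rle_trans with (/ 2 * RInt (fun x => u x ^ 2) 0 1).
  2:{ apply Rle_trans with (/ 2 * (L * s ^ 2) ^ 2); [lra|].
      right; unfold s; field; lra. }
  eapply Rle_trans; [|exact HB].
  rewrite <- lsum_scal; apply lsum_le; intros k Hk; apply in_seq in Hk.
  rewrite <- Rmult_assoc; apply Rmult_le_compat_r; [nra|].
  assert (Hk0 : 0 <= INR k) by apply pos_INR.
  assert (HkK : INR k <= INR K) by (apply le_INR; lia).
  set (y := INR k * s).
  assert (Hy0 : 0 <= y) by (apply Rmult_le_pos; lra).
  assert (Hy1 : y <= / 2).
  { replace (/ 2) with (INR K * s) by (unfold s; field; lra).
    apply Rmult_le_compat_r; lra. }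
  assert (Hm : m k = - (4 * sin (PI * y) ^ 2)).
  { unfold m, cs; rewrite <- INR_IZR_INZ; fold y.
    replace (2 * PI * y) with (2 * (PI * y)) by ring.
    rewrite cos_2a_sin; ring. }
  assert (HP := PI_bounds).
  assert (Hsin : y <= sin (PI * y)).
  { apply Rle_trans with (PI * y / 2); [nra|apply sin_ge_half; nra]. }
  rewrite Hm.
  replace (/ (16 * INR K ^ 4) * INR k ^ 4) with (y ^ 4)
    by (unfold y, s; field; lra).
  apply Rle_trans with (sin (PI * y) ^ 4); [apply pow_incr; lra|].
  assert (0 <= sin (PI * y) ^ 4) by (apply pow_le; lra).
  nra.
Qed.

(** Two applications of the mean value theorem: this is where the Lipschitz
    continuity of the derivative enters. *)
Lemma second_difference g L :
  (forall x, ex_derive g x) ->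
  (forall x y, Rabs (Derive g x - Derive g y) <= L * Rabs (x - y)) ->
  forall x s, 0 <= s -> Rabs (g (x + s) + g (x - s) - 2 * g x) <= 2 * Rabs L * s ^ 2.
Proof.
  intros Hd HL x s Hs.
  assert (MV : forall a b, a <= b -> exists c, a <= c <= b /\ g b - g a = Derive g c * (b - a)).
  { intros a b Hab.
    destruct (MVT_gen g a b (Derive g)) as [c [Hc E]].
    - intros; apply Derive_correct, Hd.
    - intros; apply continuity_pt_filterlim, (ex_derive_continuous g), Hd.
    - exists c; rewrite Rmin_left, Rmax_right in Hc by exact Hab; auto. }
  destruct (MV x (x + s)) as [c1 [Hc1 E1]]; [lra|].
  destruct (MV (x - s) x) as [c2 [Hc2 E2]]; [lra|].
  replace (g (x + s) + g (x - s) - 2 * g x) with ((Derive g c1 - Derive g c2) * s) by nra.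
  rewrite Rabs_mult, (Rabs_pos_eq s) by exact Hs.
  assert (H := HL c1 c2).
  assert (Rabs (Derive g c1 - Derive g c2) <= Rabs L * (2 * s)); [|nra].
  eapply Rle_trans; [exact H|].
  eapply Rle_trans; [apply Rmult_le_compat_r; [apply Rabs_pos | apply Rle_abs]|].
  apply Rmult_le_compat_l; [apply Rabs_pos|].
  rewrite Rabs_pos_eq; lra.
Qed.

Lemma sum_inv_sq K : lsum (seq 1 K) (fun k => / INR k ^ 2) <= 2.
Proof.
  assert (H : lsum (seq 1 (S K)) (fun k => / INR k ^ 2) <= 2 - / INR (S K)).
  { induction K as [|K IH]; [simpl; lra|].
    rewrite lsum_seq1_S. revert IH.
    generalize (lsum (seq 1 (S K)) (fun k => / INR k ^ 2)); intros S0 IH.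
    rewrite (S_INR (S K)).
    assert (0 < INR (S K)) by (apply lt_0_INR; lia).
    set (a := INR (S K)) in *.
    assert (/ (a + 1) ^ 2 <= / a - / (a + 1)); [|lra].
    replace (/ a - / (a + 1)) with (/ (a * (a + 1))) by (field; lra).
    apply Rinv_le_contravar; nra. }
  rewrite lsum_seq1_S in H.
  assert (0 < INR (S K)) by (apply lt_0_INR; lia).
  assert (0 < / INR (S K)) by (apply Rinv_0_lt_compat; lra).
  assert (0 < / INR (S K) ^ 2) by (apply Rinv_0_lt_compat, pow_lt; lra).
  lra.
Qed.

(** The individual decay [k^(-2)] would only give a divergent harmonic sum;
    the convergence comes from the square sum, through
    [k |c| <= (k^2 c)^2 + (1/k)^2]. *)
Lemma coef_weighted_bound g L :
  cont g -> periodic1 g ->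
  (forall x s, 0 <= s -> Rabs (g (x + s) + g (x - s) - 2 * g x) <= L * s ^ 2) ->
  forall K, lsum (seq 1 K) (fun k => INR k * (Rabs (coef_cos g k) + Rabs (coef_sin g k)))
            <= L ^ 2 + 4.
Proof.
  intros Hg Hp HL K.
  assert (H1 := coef_second_difference g L K Hg Hp HL).
  assert (H2 := sum_inv_sq K).
  apply Rle_trans with (lsum (seq 1 K) (fun k =>
    INR k ^ 4 * (coef_cos g k ^ 2 + coef_sin g k ^ 2) + 2 * / INR k ^ 2)).
  2:{ rewrite lsum_plus, lsum_scal; nra. }
  apply lsum_le; intros k Hk; apply in_seq in Hk.
  assert (Hk0 : 0 < INR k) by (apply lt_0_INR; lia).
  assert (Hab : forall z, INR k * Rabs z <= INR k ^ 4 * z ^ 2 + / INR k ^ 2).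
  { intros z. rewrite <- (pow2_abs z).
    set (a := Rabs z). set (i := / INR k).
    assert (Ei : INR k * i = 1) by (unfold i; field; lra).
    replace (/ INR k ^ 2) with (i ^ 2) by (unfold i; field; lra).
    replace (INR k * a) with ((INR k ^ 2 * a) * i) by (transitivity (INR k * a * (INR k * i)); [ring | rewrite Ei; ring]).
    generalize (pow2_ge_0 (INR k ^ 2 * a - i)) (pow2_ge_0 (INR k ^ 2 * a)) (pow2_ge_0 i).
    nra. }
  generalize (Hab (coef_cos g k)) (Hab (coef_sin g k)); lra.
Qed.

(** The difference quotient at 0, completed by the derivative. *)
Definition slope (f : R -> R) (l t : R) : R :=
  if Req_EM_T t 0 then l else f t / t.

Lemma continuous_slope f l : is_derive f 0 l -> f 0 = 0 -> continuous (slope f l) 0.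
Proof.
  intros Hd H0; apply is_derive_Reals in Hd.
  apply filterlim_locally; intros eps.
  destruct (Hd eps (cond_pos eps)) as [del Hdel].
  exists del; intros t Ht.
  change (Rabs (t - 0) < del) in Ht. rewrite Rminus_0_r in Ht.
  change (Rabs (slope f l t - slope f l 0) < eps).
  unfold slope; destruct (Req_EM_T 0 0) as [_|]; [|contradiction].
  destruct (Req_EM_T t 0) as [|Hne].
  - rewrite Rminus_diag, Rabs_R0; apply cond_pos.
  - specialize (Hdel t Hne Ht); rewrite Rplus_0_l, H0, Rminus_0_r in Hdel; exact Hdel.
Qed.

(** The Dirichlet kernel, multiplied by [sin (PI t)] and split into two terms
    of frequency exactly [K], so that Bessel's inequality applies to each. *)
Lemma dirichlet_kernel K t :
  sin (PI * t) * (1 + 2 * lsum (seq 1 K) (fun k => cs (Z.of_nat k) t)) =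
  sn (Z.of_nat K) t * cos (PI * t) + cs (Z.of_nat K) t * sin (PI * t).
Proof.
  assert (H : forall k, sn (Z.of_nat k) t * cos (PI * t) + cs (Z.of_nat k) t * sin (PI * t)
              = sin (2 * PI * (INR k * t) + PI * t)).
  { intros k; unfold sn, cs; rewrite <- INR_IZR_INZ, sin_plus; reflexivity. }
  rewrite H.
  induction K as [|K IH].
  - simpl; rewrite Rmult_0_r, Rplus_0_r, Rmult_1_r; f_equal; ring.
  - rewrite lsum_seq1_S.
    set (X := lsum (seq 1 K) (fun k => cs (Z.of_nat k) t)) in *.
    replace (sin (PI * t) * (1 + 2 * (X + cs (Z.of_nat (S K)) t)))
      with (sin (PI * t) * (1 + 2 * X) + 2 * cs (Z.of_nat (S K)) t * sin (PI * t)) by ring.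
    rewrite IH; unfold cs; rewrite <- INR_IZR_INZ, S_INR.
    replace (2 * PI * (INR K * t) + PI * t) with (2 * PI * ((INR K + 1) * t) - PI * t) by ring.
    rewrite sin_minus, sin_plus; ring.
Qed.

Lemma sin_PI_eq_0 t : sin (PI * t) = 0 -> exists z, t = IZR z.
Proof.
  intros H; destruct (sin_eq_0_0 _ H) as [z Hz]; exists z.
  assert (HP := PI_RGT_0).
  apply (Rmult_eq_reg_l PI); [rewrite Hz; ring | lra].
Qed.

(** For [f] periodic and differentiable at its zero 0, the quotient below is
    continuous; hence [f] times the Dirichlet kernel is a combination of two
    oscillating continuous functions. *)
Definition cot_quotient (f : R -> R) (l t : R) : R :=
  if Req_EM_T (sin (PI * t)) 0 then l / PI else f t * cos (PI * t) / sin (PI * t).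

Lemma cont_cot_quotient f l :
  cont f -> periodic1 f -> is_derive f 0 l -> f 0 = 0 -> cont (cot_quotient f l).
Proof.
  intros Hf Hp Hd H0.
  assert (HP := PI_RGT_0).
  assert (C0 : continuous (cot_quotient f l) 0).
  { apply (continuous_ext_loc _ (fun t => slope f l t * cos (PI * t) *
             / slope (fun t => sin (PI * t)) PI t)).
    - exists (mkposreal 1 Rlt_0_1); intros t Ht.
      change (Rabs (t - 0) < 1) in Ht; rewrite Rminus_0_r in Ht; apply Rabs_def2 in Ht.
      unfold slope, cot_quotient.
      destruct (Req_EM_T t 0) as [->|Hne].
      + rewrite Rmult_0_r, sin_0, cos_0. destruct (Req_EM_T 0 0); [|contradiction]. unfold Rdiv; Rring.
      + assert (Hs : sin (PI * t) <> 0).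
        { intros E; destruct (sin_PI_eq_0 _ E) as [z ->].
          apply Hne; destruct Ht as [Ht1 Ht2].
          assert (z < 1)%Z by (apply lt_IZR; exact Ht1).
          assert (-1 < z)%Z by (apply lt_IZR; lra).
          f_equal; lia. }
        destruct (Req_EM_T (sin (PI * t)) 0); [contradiction|]. inR; field; auto.
    - apply (continuous_mult (fun t => slope f l t * cos (PI * t))).
      + apply (continuous_mult (slope f l)); [apply continuous_slope; assumption|].
        assert (Hc : cont (fun t => cos (PI * t))) by auto with cont; apply Hc.
      + apply continuous_Rinv_comp.
        * apply continuous_slope; [|rewrite Rmult_0_r; apply sin_0].
          auto_derive; [trivial|]; rewrite Rmult_0_r, cos_0; ring.
        * unfold slope; destruct (Req_EM_T 0 0); lra. }
  assert (Hper : forall z t, cot_quotient f l (t + IZR z) = cot_quotient f l t).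
  { assert (Hp1 : periodic1 (cot_quotient f l)); [|intros; apply periodic1_IZR; exact Hp1].
    intros t; unfold cot_quotient.
    replace (PI * (t + 1)) with (PI * t + PI) by ring.
    rewrite neg_sin, neg_cos, Hp.
    destruct (Req_EM_T (sin (PI * t)) 0), (Req_EM_T (- sin (PI * t)) 0); try lra.
    field; assumption. }
  intros t; destruct (Req_EM_T (sin (PI * t)) 0) as [E|NE].
  - destruct (sin_PI_eq_0 _ E) as [z ->].
    apply (continuous_ext (fun t => cot_quotient f l (t + - IZR z))).
    + intros t; rewrite <- (Hper z); f_equal; ring.
    + apply (continuous_comp (fun t => t + - IZR z)).
      * assert (Hc : cont (fun t => t + - IZR z)) by auto with cont; apply Hc.
      * rewrite Rplus_opp_r; exact C0.
  - apply (continuous_ext_loc _ (fun t => f t * cos (PI * t) * / sin (PI * t))).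
    + assert (Hs : continuous (fun t => sin (PI * t)) t).
      { assert (Hc : cont (fun t => sin (PI * t))) by auto with cont; apply Hc. }
      assert (Hl := Hs _ (open_neq 0 _ NE)).
      change (locally t (fun y => sin (PI * y) <> 0)) in Hl.
      revert Hl; apply filter_imp; intros y Hy.
      unfold cot_quotient; destruct (Req_EM_T (sin (PI * y)) 0); [contradiction|reflexivity].
    + apply (continuous_mult (fun t => f t * cos (PI * t))).
      * assert (Hc : cont (fun t => f t * cos (PI * t))) by auto with cont; apply Hc.
      * apply continuous_Rinv_comp; [|exact NE].
        assert (Hc : cont (fun t => sin (PI * t))) by auto with cont; apply Hc.
Qed.

Lemma psum_dirichlet g x K :
  cont g -> periodic1 g ->
  RInt g 0 1 + psum (coef_cos g) (coef_sin g) K x - g x =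
  RInt (fun t => (g (t + x) - g x) * (1 + 2 * lsum (seq 1 K) (fun k => cs (Z.of_nat k) t))) 0 1.
Proof.
  intros Hg Hp.
  set (D := fun t => 1 + 2 * lsum (seq 1 K) (fun k => cs (Z.of_nat k) t)).
  assert (HD : cont D).
  { unfold D; apply cont_plus; [auto with cont|]; apply cont_mult; [auto with cont|].
    apply (cont_lsum _ (fun k => cs (Z.of_nat k))); auto with cont. }
  assert (HgD : cont (fun y => g y * D (y + - x))).
  { apply cont_mult; [exact Hg|]. apply (cont_comp D (fun y => y + - x)); auto with cont. }
  assert (I1 : RInt (fun t => g (t + x) * D t) 0 1 =
               RInt g 0 1 + psum (coef_cos g) (coef_sin g) K x).
  { rewrite (int_ext _ (fun t => g (t + x) * D ((t + x) + - x)))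
      by (intros t; do 2 f_equal; ring).
    rewrite (int_periodic_shift (fun y => g y * D (y + - x))); [|exact HgD|].
    2:{ intros y; rewrite Hp; f_equal. unfold D; do 2 f_equal.
        apply lsum_ext; intros k _; apply periodic_cs. }
    unfold D.
    rewrite (int_ext _ (fun y => g y + lsum (seq 1 K) (fun k =>
       2 * cs (Z.of_nat k) x * (g y * cs (Z.of_nat k) y) +
       2 * sn (Z.of_nat k) x * (g y * sn (Z.of_nat k) y)))).
    2:{ intros y.
        rewrite Rmult_plus_distr_l, Rmult_1_r, <- Rmult_assoc, <- lsum_scal; f_equal.
        apply lsum_ext; intros k _; rewrite cs_plus, cs_opp, sn_opp; ring. }
    rewrite int_plus by (try apply cont_lsum; auto 10 with cont).
    f_equal. rewrite int_lsum by auto 10 with cont.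
    unfold psum, trig; apply lsum_ext; intros k _.
    rewrite int_plus, !int_scal by auto with cont.
    unfold coef_cos, coef_sin; Rring. }
  assert (I2 : RInt D 0 1 = 1).
  { unfold D. rewrite int_plus, int_scal, int_const, int_lsum.
    - rewrite lsum_0; [Rring|].
      intros k Hk; apply in_seq in Hk.
      rewrite (int_ext _ (fun y => cs (Z.of_nat k) (y + 0)))
        by (intros; f_equal; ring).
      rewrite int_cs; apply kron_neq; lia.
    - auto with cont.
    - apply (cont_lsum _ (fun k => cs (Z.of_nat k))); auto with cont.
    - auto with cont.
    - apply cont_mult; [auto with cont|].
      apply (cont_lsum _ (fun k => cs (Z.of_nat k))); auto with cont. }
  assert (Hgx : cont (fun t => g (t + x))) by (apply (cont_comp g (fun t => t + x)); auto with cont).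
  transitivity (RInt (fun t => g (t + x) * D t - g x * D t) 0 1).
  - rewrite int_minus, int_scal, I1, I2 by auto with cont; Rring.
  - apply int_ext; intros; unfold D; Rring.
Qed.

(** Riemann--Lebesgue, for arbitrarily large frequencies: a bounded sum of
    squares has small terms. *)
Lemma small_term (b : nat -> R) M :
  (forall K, lsum (seq 1 K) b <= M) -> (forall k, 0 <= b k) ->
  forall eps K0, 0 < eps -> exists K, (K0 <= K)%nat /\ b K < eps.
Proof.
  intros HM Hb eps K0 He.
  apply NNPP; intros Hno.
  assert (Hall : forall K, (K0 <= K)%nat -> eps <= b K).
  { intros K HK; destruct (Rlt_or_le (b K) eps); [|assumption].
    exfalso; apply Hno; exists K; auto. }
  destruct (INR_unbounded (M / eps)) as [n Hn].
  assert (H : lsum (seq (1 + K0) n) (fun _ => eps) <= lsum (seq 1 (K0 + n)) b).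
  { rewrite seq_app, lsum_app.
    assert (0 <= lsum (seq 1 K0) b) by (apply lsum_nonneg; auto).
    assert (lsum (seq (1 + K0) n) (fun _ => eps) <= lsum (seq (1 + K0) n) b); [|lra].
    apply lsum_le; intros k Hk; apply in_seq in Hk; apply Hall; lia. }
  rewrite lsum_const, length_seq in H.
  specialize (HM (K0 + n)%nat).
  apply Rmult_gt_compat_r with (r := eps) in Hn; [|exact He].
  unfold Rdiv in Hn; rewrite Rmult_assoc, Rinv_l, Rmult_1_r in Hn by lra. lra.
Qed.

Lemma psum_frequently_close (g : R -> R) x :
  (forall y, ex_derive g y) -> periodic1 g ->
  forall eps K0, 0 < eps -> exists K, (K0 <= K)%nat /\
    Rabs (RInt g 0 1 + psum (coef_cos g) (coef_sin g) K x - g x) < eps.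
Proof.
  intros Hd Hp eps K0 He.
  assert (Hg : cont g) by (intros y; apply (ex_derive_continuous g), Hd).
  set (f := fun t => g (t + x) - g x).
  assert (Hf : cont f).
  { unfold f; apply cont_minus; [apply (cont_comp g (fun t => t + x))|]; auto with cont. }
  assert (Hfp : periodic1 f).
  { intros t; unfold f; rewrite <- (Hp (t + x)); do 2 f_equal; ring. }
  assert (Hf0 : f 0 = 0) by (unfold f; rewrite Rplus_0_l; ring).
  set (l := Derive g x).
  assert (Hfd : is_derive f 0 l).
  { unfold f, l; auto_derive.
    - rewrite Rplus_0_l; auto.
    - rewrite Rplus_0_l; change (Derive (fun y => g y) x) with (Derive g x); ring. }
  set (psi := cot_quotient f l).
  assert (Hpsi : cont psi) by (apply cont_cot_quotient; assumption).
  set (u := fun k => RInt (fun t => psi t * sn (Z.of_nat k) (t + 0)) 0 1).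
  set (v := fun k => RInt (fun t => f t * cs (Z.of_nat k) (t + 0)) 0 1).
  destruct (small_term (fun k => u k ^ 2 + v k ^ 2)
    (/ 2 * RInt (fun t => psi t ^ 2) 0 1 + / 2 * RInt (fun t => f t ^ 2) 0 1))
    with (eps := eps ^ 2 / 4) (K0 := K0) as [K [HK Hb]].
  - intros K; rewrite lsum_plus; apply Rplus_le_compat.
    + eapply Rle_trans; [|apply (bessel psi K 0 Hpsi)].
      apply lsum_le; intros k _; fold (u k).
      generalize (pow2_ge_0 (RInt (fun x => psi x * cs (Z.of_nat k) (x + 0)) 0 1)); simpl; lra.
    + eapply Rle_trans; [|apply (bessel f K 0 Hf)].
      apply lsum_le; intros k _; fold (v k).
      generalize (pow2_ge_0 (RInt (fun x => f x * sn (Z.of_nat k) (x + 0)) 0 1)); simpl; lra.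
  - intros k; generalize (pow2_ge_0 (u k)) (pow2_ge_0 (v k)); lra.
  - nra.
  - exists K; split; [exact HK|].
    rewrite psum_dirichlet by assumption.
    assert (E : RInt (fun t => (g (t + x) - g x) *
                 (1 + 2 * lsum (seq 1 K) (fun k => cs (Z.of_nat k) t))) 0 1 = u K + v K).
    { unfold u, v; rewrite <- int_plus by auto with cont.
      apply int_ext; intros t; fold (f t); rewrite !Rplus_0_r.
      unfold psi, cot_quotient.
      assert (HD := dirichlet_kernel K t).
      destruct (Req_EM_T (sin (PI * t)) 0) as [E|NE].
      - destruct (sin_PI_eq_0 _ E) as [z ->].
        replace (f (IZR z)) with 0
          by (rewrite <- Hf0, <- (periodic1_IZR f Hfp z 0), Rplus_0_l; reflexivity).
        replace (sn (Z.of_nat K) (IZR z)) with 0; [ring|].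
        unfold sn; rewrite <- mult_IZR, <- sin_0.
        rewrite <- (sin_period_Z 0 (Z.of_nat K * z)), Rplus_0_l; reflexivity.
      - apply (Rmult_eq_reg_l (sin (PI * t))); [|exact NE].
        transitivity (f t * (sin (PI * t) *
          (1 + 2 * lsum (seq 1 K) (fun k => cs (Z.of_nat k) t)))); [ring|].
        rewrite HD; field; exact NE. }
    rewrite E.
    assert (B : forall z, z ^ 2 < eps ^ 2 / 4 -> Rabs z < eps / 2).
    { intros z Hz. destruct (Rlt_or_le (Rabs z) (eps / 2)) as [|Hle]; [assumption|].
      assert (Rabs z ^ 2 = z ^ 2) by apply pow2_abs. nra. }
    assert (H1 := pow2_ge_0 (u K)); assert (H2 := pow2_ge_0 (v K)).
    eapply Rle_lt_trans; [apply Rabs_triang|].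
    assert (Rabs (u K) < eps / 2) by (apply B; lra).
    assert (Rabs (v K) < eps / 2) by (apply B; lra).
    lra.
Qed.

Lemma cs_bound z x : Rabs (cs z x) <= 1.
Proof. apply Rabs_le, COS_bound. Qed.

Lemma sn_bound z x : Rabs (sn z x) <= 1.
Proof. apply Rabs_le, SIN_bound. Qed.

Lemma trig_term_bound z p q x : Rabs (p * cs z x + q * sn z x) <= Rabs p + Rabs q.
Proof.
  eapply Rle_trans; [apply Rabs_triang|]; rewrite !Rabs_mult.
  assert (H1 := cs_bound z x); assert (H2 := sn_bound z x).
  assert (H3 := Rabs_pos p); assert (H4 := Rabs_pos q).
  apply Rplus_le_compat;
    (rewrite <- Rmult_1_r; apply Rmult_le_compat_l; assumption).
Qed.

(** The absolute convergence of the Fourier series of the derivative. *)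
Definition modes_bounded (al be : nat -> R) (W : R) : Prop :=
  forall K, lsum (seq 1 K) (fun k => INR k * (Rabs (al k) + Rabs (be k))) <= W.

Lemma psum_tail al be W K n x :
  modes_bounded al be W ->
  Rabs (psum al be (K + n) x - psum al be K x) <= W / INR (S K).
Proof.
  intros HW; unfold psum, trig; rewrite seq_app, lsum_app.
  assert (HK : 0 < INR (S K)) by (apply lt_0_INR; lia).
  set (F := fun i => al i * cs (Z.of_nat i) x + be i * sn (Z.of_nat i) x).
  replace (_ - _) with (lsum (seq (1 + K) n) F) by ring.
  eapply Rle_trans; [apply lsum_Rabs|].
  apply (Rmult_le_reg_l (INR (S K))); [exact HK|].
  replace (INR (S K) * (W / INR (S K))) with W by (field; lra).
  eapply Rle_trans; [|apply (HW (K + n)%nat)].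
  rewrite seq_app, lsum_app, <- lsum_scal.
  assert (Hpos : forall k, 0 <= Rabs (al k) + Rabs (be k))
    by (intros k; generalize (Rabs_pos (al k)) (Rabs_pos (be k)); lra).
  assert (0 <= lsum (seq 1 K) (fun k => INR k * (Rabs (al k) + Rabs (be k)))).
  { apply lsum_nonneg; intros k _; apply Rmult_le_pos; [apply pos_INR | apply Hpos]. }
  enough (lsum (seq (1 + K) n) (fun a => INR (S K) * Rabs (F a)) <=
    lsum (seq (1 + K) n) (fun k => INR k * (Rabs (al k) + Rabs (be k)))) by lra.
  apply lsum_le; intros k Hk; apply in_seq in Hk.
  apply Rmult_le_compat; [lra|apply Rabs_pos|apply le_INR; lia|apply trig_term_bound].
Qed.

(** Absolute convergence upgrades the convergence along a subsequence to
    uniform convergence with a rate. *)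
Lemma fourier_expansion (g : R -> R) :
  (forall y, ex_derive g y) -> periodic1 g -> lipschitz (Derive g) ->
  exists W, 0 < W /\
    modes_bounded (coef_cos g) (coef_sin g) W /\
    (forall K x, Rabs (g x - (RInt g 0 1 + psum (coef_cos g) (coef_sin g) K x)) <= W / INR (S K)).
Proof.
  intros Hd Hp [L HL].
  assert (Hg : cont g) by (intros y; apply (ex_derive_continuous g), Hd).
  assert (HW := coef_weighted_bound g _ Hg Hp (second_difference g L Hd HL)).
  exists ((2 * Rabs L) ^ 2 + 4); split; [nra|split; [exact HW|]].
  intros K x; apply le_epsilon; intros eps He.
  destruct (psum_frequently_close g x Hd Hp eps K He) as [K' [HK Hc]].
  assert (HT := psum_tail _ _ _ K (K' - K) x HW).
  replace (K + (K' - K))%nat with K' in HT by lia.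
  rewrite <- Rabs_Ropp in Hc.
  replace (g x - _) with (- (RInt g 0 1 + psum (coef_cos g) (coef_sin g) K' x - g x) +
    (psum (coef_cos g) (coef_sin g) K' x - psum (coef_cos g) (coef_sin g) K x)) by (simpl; ring).
  eapply Rle_trans; [apply Rabs_triang|]. lra.
Qed.

(** * The additive energy of the squares in a dyadic block *)

Definition block (j : nat) : list nat := seq (2 ^ j) (2 ^ j).

Lemma in_block j n : In n (block j) <-> (2 ^ j <= n < 2 * 2 ^ j)%nat.
Proof. unfold block; rewrite in_seq; lia. Qed.

Lemma pow2_pos j : (0 < 2 ^ j)%nat.
Proof. generalize (Nat.pow_nonzero 2 j); lia. Qed.

Lemma gcd_split a b : (0 < a)%nat ->
  exists g a' b', (0 < g /\ a = a' * g /\ b = b' * g /\ Nat.gcd a' b' = 1)%nat.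
Proof.
  intros Ha; set (g := Nat.gcd a b).
  assert (Hg : g <> 0%nat) by (unfold g; intros H; apply Nat.gcd_eq_0 in H; lia).
  destruct (Nat.gcd_divide_l a b) as [a' Ha']; destruct (Nat.gcd_divide_r a b) as [b' Hb'].
  fold g in Ha', Hb'.
  exists g, a', b'; repeat split; try lia.
  replace a' with (a / g)%nat by (rewrite Ha'; apply Nat.div_mul; exact Hg).
  replace b' with (b / g)%nat by (rewrite Hb'; apply Nat.div_mul; exact Hg).
  apply Nat.gcd_div_gcd; [exact Hg | reflexivity].
Qed.

(** [u / v] is the reduced form of [x / z], which is also that of [w / y]. *)
Lemma equal_products x y z w :
  (0 < x)%nat -> (0 < y)%nat -> (0 < z)%nat -> (x * y = z * w)%nat ->
  exists u v k l, (0 < u /\ 0 < v /\ 0 < k /\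
    x = u * k /\ z = v * k /\ y = v * l /\ w = u * l)%nat.
Proof.
  intros Hx Hy Hz E.
  destruct (gcd_split x z Hx) as (k & u & v & Hk & Hu & Hv & Hg).
  assert (E2 : (u * y = v * w)%nat) by (apply (Nat.mul_cancel_r _ _ k); nia).
  assert (Hd : Nat.divide v y).
  { apply (Nat.gauss v u y); [exists w; lia | rewrite Nat.gcd_comm; exact Hg]. }
  destruct Hd as [l Hl].
  assert (0 < v)%nat by nia. assert (0 < u)%nat by nia.
  exists u, v, k, l; repeat split; try lia.
  apply (Nat.mul_cancel_l _ _ v); [lia|]. rewrite <- E2, Hl; ring.
Qed.

(** Parameters [((u, v), (k, l))] for which [u k], [v k], [u l], [v l] are all
    at most [Y]. The fraction [u / v] is allowed to be reducible: only an upper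
    bound of the number of solutions is sought. *)
Definition quads (Y : nat) : list ((nat * nat) * (nat * nat)) :=
  flat_map (fun uv => let b := (Y / Nat.max (fst uv) (snd uv))%nat in
                      map (fun kl => (uv, kl)) (list_prod (seq 1 b) (seq 1 b)))
           (list_prod (seq 1 Y) (seq 1 Y)).

Lemma in_quads Y u v k l :
  (0 < u)%nat -> (0 < v)%nat -> (0 < k)%nat -> (0 < l)%nat ->
  (u * k <= Y)%nat -> (v * k <= Y)%nat -> (u * l <= Y)%nat -> (v * l <= Y)%nat ->
  In ((u, v), (k, l)) (quads Y).
Proof.
  intros. unfold quads; apply in_flat_map; exists (u, v); split.
  - apply in_prod; apply in_seq; nia.
  - simpl. apply in_map.
    assert (Hm : Nat.max u v <> 0%nat) by lia.
    assert (Hc : forall t, (u * t <= Y)%nat -> (v * t <= Y)%nat -> (t <= Y / Nat.max u v)%nat).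
    { intros t; intros; apply Nat.div_le_lower_bound; [exact Hm|].
      destruct (Nat.max_spec u v) as [[_ ->]|[_ ->]]; assumption. }
    apply in_prod; apply in_seq; split; try lia; apply Nat.lt_succ_r, Hc; assumption.
Qed.

Lemma length_flat_map_lsum {A B} (f : A -> list B) l :
  INR (length (flat_map f l)) = lsum l (fun a => INR (length (f a))).
Proof.
  induction l as [|a l IH]; [reflexivity|].
  simpl flat_map; rewrite length_app, plus_INR, IH; reflexivity.
Qed.

Lemma harmonic_dyadic r : lsum (seq 1 (2 ^ r)) (fun u => / INR u) <= INR r + 1.
Proof.
  induction r as [|r IH]; [simpl; lra|].
  replace (2 ^ S r)%nat with (2 ^ r + 2 ^ r)%nat by (simpl; lia).
  rewrite seq_app, lsum_app, S_INR.
  assert (H2 : 0 < INR (2 ^ r)) by (apply lt_0_INR, pow2_pos).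
  enough (lsum (seq (1 + 2 ^ r) (2 ^ r)) (fun u => / INR u) <= 1) by lra.
  apply Rle_trans with (lsum (seq (1 + 2 ^ r) (2 ^ r)) (fun _ => / INR (2 ^ r))).
  - apply lsum_le; intros u Hu; apply in_seq in Hu.
    apply Rinv_le_contravar; [exact H2 | apply le_INR; lia].
  - rewrite lsum_const, length_seq; right; field; lra.
Qed.

(** There are [(Y / max u v)^2] pairs [(k, l)] for given [u] and [v]; summing
    first over the smaller of the two leaves a harmonic sum. *)
Lemma quads_length r :
  INR (length (quads (2 ^ r))) <= 2 * INR (2 ^ r) ^ 2 * (INR r + 1).
Proof.
  set (Y := (2 ^ r)%nat).
  unfold quads; rewrite length_flat_map_lsum, lsum_list_prod.
  assert (HY : 0 < INR Y) by (apply lt_0_INR, pow2_pos).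
  set (T := fun u v : nat => if (v <=? u)%nat then / INR u ^ 2 else 0).
  assert (HT : forall u v, 0 <= T u v).
  { intros u v; unfold T; destruct (v <=? u)%nat eqn:E; [|lra].
    destruct u as [|u].
    - simpl; rewrite Rmult_0_l, Rinv_0; lra.
    - left; apply Rinv_0_lt_compat, pow_lt, lt_0_INR; lia. }
  apply Rle_trans with (lsum (seq 1 Y) (fun u => lsum (seq 1 Y) (fun v =>
    INR Y ^ 2 * (T u v + T v u)))).
  { apply lsum_le; intros u Hu; apply lsum_le; intros v Hv.
    apply in_seq in Hu; apply in_seq in Hv.
    rewrite length_map, length_prod, length_seq, mult_INR; cbn [fst snd].
    set (m := Nat.max u v).
    assert (Hm : 0 < INR m) by (apply lt_0_INR; unfold m; lia).
    assert (Hd : INR (Y / m) <= INR Y * / INR m).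
    { apply (Rmult_le_reg_l (INR m)); [exact Hm|].
      replace (INR m * (INR Y * / INR m)) with (INR Y) by (field; lra).
      rewrite <- mult_INR; apply le_INR, Nat.Div0.mul_div_le. }
    apply Rle_trans with (INR Y ^ 2 * / INR m ^ 2).
    - replace (INR Y ^ 2 * / INR m ^ 2) with ((INR Y * / INR m) * (INR Y * / INR m)) by (field; lra).
      assert (0 <= INR (Y / m)) by apply pos_INR.
      apply Rmult_le_compat; assumption.
    - apply Rmult_le_compat_l; [apply pow2_ge_0|].
      assert (H1 := HT u v); assert (H2 := HT v u).
      unfold m; destruct (Nat.max_spec u v) as [[Hlt ->]|[Hle ->]].
      + assert (E : T v u = / INR v ^ 2) by (unfold T; replace (u <=? v)%nat with true by (symmetry; apply Nat.leb_le; lia); reflexivity).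
        lra.
      + assert (E : T u v = / INR u ^ 2) by (unfold T; replace (v <=? u)%nat with true by (symmetry; apply Nat.leb_le; lia); reflexivity).
        lra. }
  assert (HS : lsum (seq 1 Y) (fun u => lsum (seq 1 Y) (fun v => T u v)) <= INR r + 1).
  { eapply Rle_trans; [|apply harmonic_dyadic]; fold Y.
    apply lsum_le; intros u Hu; apply in_seq in Hu.
    replace Y with (u + (Y - u))%nat by lia.
    assert (Hu0 : 0 < INR u) by (apply lt_0_INR; lia).
    rewrite seq_app, lsum_app, (lsum_0 (seq (1 + u) _)).
    - rewrite (lsum_ext _ _ (fun _ => / INR u ^ 2)).
      + rewrite lsum_const, length_seq; right; field; lra.
      + intros v Hv; apply in_seq in Hv; unfold T.
        replace (v <=? u)%nat with true by (symmetry; apply Nat.leb_le; lia); reflexivity.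
    - intros v Hv; apply in_seq in Hv; unfold T.
      replace (v <=? u)%nat with false by (symmetry; apply Nat.leb_gt; lia); reflexivity. }
  assert (HS2 := HS); rewrite lsum_swap in HS2.
  rewrite (lsum_ext _ _ (fun u => INR Y ^ 2 *
    (lsum (seq 1 Y) (fun v => T u v) + lsum (seq 1 Y) (fun v => T v u)))).
  2:{ intros u _; rewrite lsum_scal, lsum_plus; reflexivity. }
  rewrite lsum_scal, lsum_plus.
  assert (0 <= INR Y ^ 2) by apply pow2_ge_0.
  apply Rle_trans with (INR Y ^ 2 * ((INR r + 1) + (INR r + 1))); [|right; ring].
  apply Rmult_le_compat_l; [assumption|]. apply Rplus_le_compat; assumption.
Qed.

Definition pairs (j : nat) : list (nat * nat) := list_prod (block j) (block j).

Definition sqdiff (a : nat * nat) : Z :=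
  (Z.of_nat (fst a) * Z.of_nat (fst a) - Z.of_nat (snd a) * Z.of_nat (snd a))%Z.

(** Recovers [((n, m), (p, q))] from [n - m = u k], [n + m = v l],
    [p - q = v k] and [p + q = u l]. *)
Definition of_quad (t : (nat * nat) * (nat * nat)) : (nat * nat) * (nat * nat) :=
  let u := fst (fst t) in let v := snd (fst t) in
  let k := fst (snd t) in let l := snd (snd t) in
  (((u * k + v * l) / 2, (v * l - u * k) / 2), ((v * k + u * l) / 2, (u * l - v * k) / 2))%nat.

Definition swap {A} (a : A * A) : A * A := (snd a, fst a).

Lemma of_quad_spec Y n m p q :
  (0 < m)%nat -> (0 < q)%nat -> (m < n)%nat -> (n + m <= Y)%nat -> (p + q <= Y)%nat ->
  sqdiff (n, m) = sqdiff (p, q) ->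
  exists t, In t (quads Y) /\ of_quad t = ((n, m), (p, q)).
Proof.
  intros Hm Hq Hnm HY1 HY2 E; unfold sqdiff in E; simpl in E.
  assert (Hpq : (q < p)%nat) by nia.
  destruct (equal_products (n - m) (n + m) (p - q) (p + q)) as (u & v & k & l & Hu & Hv & Hk & E1 & E2 & E3 & E4);
    [lia|lia|lia|nia|].
  assert (Hl : (0 < l)%nat) by nia.
  exists ((u, v), (k, l)); split; [apply in_quads; lia|].
  unfold of_quad; cbn [fst snd]; rewrite <- E1, <- E2, <- E3, <- E4.
  replace (n - m + (n + m))%nat with (n * 2)%nat by lia.
  replace (n + m - (n - m))%nat with (m * 2)%nat by lia.
  replace (p - q + (p + q))%nat with (p * 2)%nat by lia.
  replace (p + q - (p - q))%nat with (q * 2)%nat by lia.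
  rewrite !Nat.div_mul by lia; reflexivity.
Qed.

(** Factoring both sides of [n^2 - m^2 = p^2 - q^2] reduces the count to that
    of equal products, all of whose solutions come from [quads]. *)
Lemma energy j :
  lsum (list_prod (pairs j) (pairs j)) (fun t => kron (sqdiff (fst t)) (sqdiff (snd t)))
  <= 65 * INR (2 ^ j) ^ 2 * (INR j + 3).
Proof.
  unfold kron; rewrite (lsum_filter (fun t => Z.eqb (sqdiff (fst t)) (sqdiff (snd t)))).
  set (M := (2 ^ j)%nat).
  assert (HM : (0 < M)%nat) by apply pow2_pos.
  set (Q := quads (2 ^ (j + 2))).
  (* The three parts are the solutions with [n = m], [n > m] and [n < m]. *)
  set (big := map (fun a => ((fst a, fst a), (snd a, snd a))) (pairs j) ++
              map of_quad Q ++ map (fun t => (swap (fst (of_quad t)), swap (snd (of_quad t)))) Q).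
  assert (H4 : (2 ^ (j + 2) = 4 * M)%nat) by (unfold M; rewrite Nat.pow_add_r; simpl; lia).
  assert (Hlen : (length (filter (fun t => Z.eqb (sqdiff (fst t)) (sqdiff (snd t)))
                    (list_prod (pairs j) (pairs j))) <= length big)%nat).
  { apply NoDup_incl_length.
    - apply NoDup_filter; repeat apply NoDup_prod; apply seq_NoDup.
    - intros [[n m] [p q]] H; apply filter_In in H; destruct H as [Hin Heq].
      apply Z.eqb_eq in Heq; cbn [fst snd] in Heq.
      unfold pairs in Hin; rewrite !in_prod_iff, !in_block in Hin; fold M in Hin.
      unfold big; rewrite !in_app_iff.
      destruct (Nat.lt_trichotomy n m) as [Hlt|[->|Hgt]].
      + right; right.
        destruct (of_quad_spec (2 ^ (j + 2)) m n q p) as [t [Ht Et]]; try lia.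
        { revert Heq; unfold sqdiff; simpl; lia. }
        apply in_map_iff; exists t; split; [rewrite Et; reflexivity | exact Ht].
      + left. assert (p = q) by (unfold sqdiff in Heq; simpl in Heq; nia); subst.
        apply in_map_iff; exists (m, q); split; [reflexivity|].
        unfold pairs; rewrite in_prod_iff, !in_block; fold M; lia.
      + right; left.
        destruct (of_quad_spec (2 ^ (j + 2)) n m p q) as [t [Ht Et]]; try lia.
        apply in_map_iff; exists t; auto. }
  apply le_INR in Hlen; eapply Rle_trans; [exact Hlen|].
  unfold big; rewrite !length_app, !length_map, !plus_INR.
  assert (HQ := quads_length (j + 2)); fold Q in HQ; rewrite H4, mult_INR, plus_INR in HQ.
  unfold pairs, block; rewrite length_prod, !length_seq, mult_INR; fold M.
  assert (0 <= INR j) by apply pos_INR.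
  assert (0 <= INR M * INR M) by (apply Rmult_le_pos; apply pos_INR).
  simpl (INR 4) in HQ; simpl (INR 2) in HQ.
  set (A := INR M * INR M) in *.
  replace (INR M ^ 2) with A by (unfold A; ring).
  replace (2 * ((1 + 1 + 1 + 1) * INR M) ^ 2 * (INR j + (1 + 1) + 1))
    with (32 * (A * (INR j + 3))) in HQ by (unfold A; ring).
  assert (0 <= A * INR j) by (apply Rmult_le_pos; assumption).
  lra.
Qed.

(** The solutions of [n^2 - m^2 = q^2 - p^2], by exchanging [p] and [q]. *)
Lemma energy_swap j :
  lsum (list_prod (pairs j) (pairs j)) (fun t => kron (sqdiff (fst t) + sqdiff (snd t)) 0)
  <= 65 * INR (2 ^ j) ^ 2 * (INR j + 3).
Proof.
  eapply Rle_trans; [|apply energy].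
  rewrite !lsum_list_prod; apply lsum_le; intros a _.
  unfold pairs; rewrite !lsum_list_prod, lsum_swap; right.
  apply lsum_ext; intros n _; apply lsum_ext; intros m _; cbn [fst snd].
  rewrite <- (kron_minus (sqdiff a)); f_equal; unfold sqdiff; simpl; ring.
Qed.

(** * Fourth moments of the dyadic blocks *)

Definition sqZ (n : nat) : Z := (Z.of_nat n * Z.of_nat n)%Z.

(** The two families below are the real and imaginary parts of
   [sum_n a n e(k n^2 x)], the sum being over a dyadic block. *)
Definition bcos (a : nat -> R) (j k : nat) (x : R) : R :=
  lsum (block j) (fun n => a n * cs (Z.of_nat k * sqZ n) x).
Definition bsin (a : nat -> R) (j k : nat) (x : R) : R :=
  lsum (block j) (fun n => a n * sn (Z.of_nat k * sqZ n) x).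

Lemma cont_bcos a j k : cont (bcos a j k).
Proof. unfold bcos; apply cont_lsum; auto with cont. Qed.

Lemma cont_bsin a j k : cont (bsin a j k).
Proof. unfold bsin; apply cont_lsum; auto with cont. Qed.
#[export] Hint Resolve cont_bcos cont_bsin : cont.

(** The squared modulus of the exponential sum is a real trigonometric sum over
    pairs, whose frequencies are differences of squares. *)
Lemma block_modulus a j k x :
  bcos a j k x ^ 2 + bsin a j k x ^ 2 =
  lsum (pairs j) (fun p => a (fst p) * a (snd p) * cs (Z.of_nat k * sqdiff p) x).
Proof.
  simpl; rewrite !Rmult_1_r; unfold bcos, bsin.
  rewrite !lsum_mult, <- lsum_plus; apply lsum_ext; intros [n m] _; cbn [fst snd].
  transitivity (a n * a m * (cs (Z.of_nat k * sqZ n) x * cs (Z.of_nat k * sqZ m) x +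
    sn (Z.of_nat k * sqZ n) x * sn (Z.of_nat k * sqZ m) x)); [ring|].
  rewrite <- cs_freq_sub; do 2 f_equal; unfold sqdiff, sqZ; simpl; ring.
Qed.

Lemma kron_scale k z : k <> 0%nat -> kron (Z.of_nat k * z) 0 = kron z 0.
Proof.
  intros Hk; unfold kron; destruct (Z.eqb_spec (Z.of_nat k * z) 0), (Z.eqb_spec z 0);
    try reflexivity; nia.
Qed.

(** By orthogonality the fourth moment is a weighted count of coincidences
    between differences of squares, whatever the dilation [k]. *)
Lemma block_fourth_moment a A j k :
  k <> 0%nat -> (forall n, In n (block j) -> 0 <= a n <= A) ->
  RInt (fun x => (bcos a j k x ^ 2 + bsin a j k x ^ 2) ^ 2) 0 1
  <= A ^ 4 * (65 * INR (2 ^ j) ^ 2 * (INR j + 3)).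
Proof.
  intros Hk Ha.
  assert (HA : 0 <= A).
  { destruct (Ha (2 ^ j)%nat); [|lra]. apply in_block; generalize (pow2_pos j); lia. }
  set (F := fun p : nat * nat => a (fst p) * a (snd p)).
  rewrite (int_ext _ (fun x => lsum (list_prod (pairs j) (pairs j)) (fun t =>
    F (fst t) * F (snd t) *
      (cs (Z.of_nat k * sqdiff (fst t)) (x + 0) * cs (Z.of_nat k * sqdiff (snd t)) (x + 0))))).
  2:{ intros x; rewrite block_modulus; simpl; rewrite Rmult_1_r, lsum_mult, Rplus_0_r.
      apply lsum_ext; intros; unfold F; ring. }
  rewrite int_lsum by auto 10 with cont.
  apply Rle_trans with (lsum (list_prod (pairs j) (pairs j)) (fun t =>
    A ^ 4 / 2 * (kron (sqdiff (fst t)) (sqdiff (snd t)) + kron (sqdiff (fst t) + sqdiff (snd t)) 0))).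
  - apply lsum_le; intros [[n m] [p q]] Ht; cbn [fst snd].
    unfold pairs in Ht; rewrite !in_prod_iff in Ht.
    rewrite int_scal, int_cs_cs by auto with cont.
    rewrite <- Z.mul_sub_distr_l, <- Z.mul_add_distr_l, !kron_scale, kron_minus by exact Hk.
    set (s := kron _ _ + _).
    assert (Hs : 0 <= s) by (apply Rplus_le_le_0_compat; apply kron_bounds).
    unfold F; cbn [fst snd].
    destruct (Ha n) as [Hn0 Hn]; [tauto|]; destruct (Ha m) as [Hm0 Hm]; [tauto|].
    destruct (Ha p) as [Hp0 Hp]; [tauto|]; destruct (Ha q) as [Hq0 Hq]; [tauto|].
    assert (a n * a m * (a p * a q) <= A * A * (A * A)).
    { repeat apply Rmult_le_compat; try assumption; apply Rmult_le_pos; assumption. }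
    replace (A ^ 4 / 2 * s) with (A * A * (A * A) * (/ 2 * s)) by field.
    apply Rmult_le_compat_r; lra.
  - rewrite lsum_scal, lsum_plus.
    assert (H1 := energy j); assert (H2 := energy_swap j).
    assert (0 <= A ^ 4) by (apply pow_le; exact HA).
    apply Rle_trans with (A ^ 4 / 2 * (2 * (65 * INR (2 ^ j) ^ 2 * (INR j + 3)))); [|right; field].
    apply Rmult_le_compat_l; lra.
Qed.

(** Summation over the Fourier modes of the profile costs only the absolute
    sum of its coefficients, because every dilate has the same fourth moment. *)
Lemma modes_fourth_moment a A j p q K W :
  (forall n, In n (block j) -> 0 <= a n <= A) ->
  lsum (seq 1 K) (fun k => Rabs (p k) + Rabs (q k)) <= W ->
  RInt (fun x => (lsum (seq 1 K) (fun k => p k * bcos a j k x + q k * bsin a j k x)) ^ 4) 0 1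
  <= W ^ 4 * (A ^ 4 * (65 * INR (2 ^ j) ^ 2 * (INR j + 3))).
Proof.
  intros Ha HW.
  set (w := fun k => Rabs (p k) + Rabs (q k)).
  assert (Hw : forall k, 0 <= w k)
    by (intros k; unfold w; generalize (Rabs_pos (p k)) (Rabs_pos (q k)); lra).
  assert (HW0 : 0 <= W).
  { eapply Rle_trans; [|exact HW]; apply lsum_nonneg; intros; apply Hw. }
  set (m := fun k x => bcos a j k x ^ 2 + bsin a j k x ^ 2).
  assert (Hm : forall k x, 0 <= m k x)
    by (intros k x; unfold m; generalize (pow2_ge_0 (bcos a j k x)) (pow2_ge_0 (bsin a j k x)); lra).
  set (E := A ^ 4 * (65 * INR (2 ^ j) ^ 2 * (INR j + 3))).
  assert (HE : 0 <= E).
  { eapply Rle_trans; [|apply (block_fourth_moment a A j 1); [discriminate|exact Ha]].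
    apply int_nonneg; [lra|auto 10 with cont|intros; apply pow2_ge_0]. }
  apply Rle_trans with (RInt (fun x => W ^ 3 * lsum (seq 1 K) (fun k => w k * m k x ^ 2)) 0 1).
  - apply int_le; [lra| | |].
    + apply cont_pow, cont_lsum; auto with cont.
    + apply cont_mult; [auto with cont|]; apply cont_lsum; unfold m; auto 10 with cont.
    + intros x _.
      assert (H := pow4_mean (seq 1 K) w (fun k => sqrt (m k x)) W (fun k _ => Hw k) HW).
      eapply Rle_trans; [|eapply Rle_trans; [exact H|right]].
      * set (T := lsum _ _). rewrite <- (pow4_abs T).
        apply pow_incr; split; [apply Rabs_pos|].
        unfold T; eapply Rle_trans; [apply lsum_Rabs|]; apply lsum_le; intros k _.
        assert (Hc : Rabs (bcos a j k x) <= sqrt (m k x)).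
        { rewrite <- sqrt_Rsqr_abs; apply sqrt_le_1_alt; unfold Rsqr, m.
          generalize (pow2_ge_0 (bsin a j k x)); simpl; lra. }
        assert (Hs : Rabs (bsin a j k x) <= sqrt (m k x)).
        { rewrite <- sqrt_Rsqr_abs; apply sqrt_le_1_alt; unfold Rsqr, m.
          generalize (pow2_ge_0 (bcos a j k x)); simpl; lra. }
        eapply Rle_trans; [apply Rabs_triang|]; rewrite !Rabs_mult.
        unfold w; rewrite Rmult_plus_distr_r.
        apply Rplus_le_compat; apply Rmult_le_compat_l; auto using Rabs_pos.
      * f_equal; apply lsum_ext; intros k _; f_equal.
        replace (sqrt (m k x) ^ 4) with ((sqrt (m k x) * sqrt (m k x)) ^ 2) by ring.
        rewrite sqrt_sqrt by apply Hm; reflexivity.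
  - rewrite int_scal by (apply cont_lsum; unfold m; auto 10 with cont).
    rewrite int_lsum by (unfold m; auto 10 with cont).
    apply Rle_trans with (W ^ 3 * lsum (seq 1 K) (fun k => E * w k)).
    + apply Rmult_le_compat_l; [apply pow_le; exact HW0|].
      apply lsum_le; intros k Hk; apply in_seq in Hk.
      rewrite int_scal, Rmult_comm by (unfold m; auto 10 with cont).
      apply Rmult_le_compat_r; [apply Hw|].
      apply block_fourth_moment; [lia|exact Ha].
    + rewrite lsum_scal.
      replace (W ^ 4 * E) with (W ^ 3 * (E * W)) by ring.
      apply Rmult_le_compat_l; [apply pow_le; exact HW0|].
      apply Rmult_le_compat_l; assumption.
Qed.

Lemma is_derive_lsum {A} (l : list A) (f df : A -> R -> R) x :
  (forall i, In i l -> is_derive (f i) x (df i x)) ->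
  is_derive (fun x => lsum l (fun i => f i x)) x (lsum l (fun i => df i x)).
Proof.
  induction l as [|i l IH]; intros H; simpl.
  - apply (is_derive_const (K := R_AbsRing) (V := R_NormedModule) 0).
  - apply (is_derive_plus (f i)); [apply H; left; reflexivity|].
    apply IH; intros; apply H; right; assumption.
Qed.

Definition blockf (a al be : nat -> R) (j K : nat) (x : R) : R :=
  lsum (block j) (fun n => a n * psum al be K (INR n ^ 2 * x)).

Lemma blockf_modes a al be j K x :
  blockf a al be j K x =
  lsum (seq 1 K) (fun k => al k * bcos a j k x + be k * bsin a j k x).
Proof.
  unfold blockf, psum, trig, bcos, bsin.
  rewrite (lsum_ext (seq 1 K) _ (fun k => lsum (block j) (fun n =>
     a n * (al k * cs (Z.of_nat k * sqZ n) x + be k * sn (Z.of_nat k * sqZ n) x)))).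
  - rewrite lsum_swap; apply lsum_ext; intros n _.
    rewrite <- lsum_scal; apply lsum_ext; intros k _.
    unfold sqZ; rewrite <- cs_scale, <- sn_scale, mult_IZR, <- INR_IZR_INZ.
    replace (INR n * INR n) with (INR n ^ 2) by ring; reflexivity.
  - intros k _; rewrite <- !lsum_scal, <- lsum_plus; apply lsum_ext; intros; ring.
Qed.

(** The derivative of [blockf], in the form of [blockf_modes]: the coefficients
    of the modes acquire a factor [2 PI k], those of the block a factor [n^2]. *)
Definition blockf' (a al be : nat -> R) (j K : nat) (x : R) : R :=
  lsum (seq 1 K) (fun k =>
    (2 * PI * (INR k * be k)) * bcos (fun n => INR n ^ 2 * a n) j k x +
    (- (2 * PI * (INR k * al k))) * bsin (fun n => INR n ^ 2 * a n) j k x).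

Lemma is_derive_blockf a al be j K x :
  is_derive (blockf a al be j K) x (blockf' a al be j K x).
Proof.
  apply (is_derive_ext (fun x => lsum (seq 1 K) (fun k => lsum (block j) (fun n =>
     a n * (al k * cs (Z.of_nat k * sqZ n) x + be k * sn (Z.of_nat k * sqZ n) x))))).
  - intros y; rewrite blockf_modes; apply lsum_ext; intros k _.
    unfold bcos, bsin; rewrite <- !lsum_scal, <- lsum_plus; apply lsum_ext; intros; ring.
  - unfold blockf'. apply is_derive_lsum with (df := fun k x =>
    (2 * PI * (INR k * be k)) * bcos (fun n => INR n ^ 2 * a n) j k x +
    (- (2 * PI * (INR k * al k))) * bsin (fun n => INR n ^ 2 * a n) j k x).
    intros k _.
    unfold bcos, bsin; rewrite <- !lsum_scal, <- lsum_plus.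
    apply is_derive_lsum with (df := fun n x =>
      2 * PI * (INR k * be k) * (INR n ^ 2 * a n * cs (Z.of_nat k * sqZ n) x) +
      - (2 * PI * (INR k * al k)) * (INR n ^ 2 * a n * sn (Z.of_nat k * sqZ n) x)).
    intros n _; unfold cs, sn; auto_derive; [trivial|].
    unfold sqZ; rewrite !mult_IZR, <- !INR_IZR_INZ; ring.
Qed.

Lemma cont_blockf' a al be j K : cont (blockf' a al be j K).
Proof. unfold blockf'; apply cont_lsum; auto 10 with cont. Qed.

Lemma cont_blockf a al be j K : cont (blockf a al be j K).
Proof.
  intros x; apply (ex_derive_continuous (blockf a al be j K)); eexists; apply is_derive_blockf.
Qed.
#[export] Hint Resolve cont_blockf cont_blockf' : cont.

Definition moment_bound (W A : R) (j : nat) : R :=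
  W ^ 4 * (A ^ 4 * (65 * INR (2 ^ j) ^ 2 * (INR j + 3))).

Lemma abs_coef_bound al be W :
  modes_bounded al be W ->
  forall K, lsum (seq 1 K) (fun k => Rabs (al k) + Rabs (be k)) <= W.
Proof.
  intros HW K; eapply Rle_trans; [|apply (HW K)].
  apply lsum_le; intros k Hk; apply in_seq in Hk.
  assert (1 <= INR k) by (apply (le_INR 1); lia).
  generalize (Rabs_pos (al k)) (Rabs_pos (be k)); nra.
Qed.

(** For the derivative, [7] bounds [2 PI] and [4 M^2], where [M = 2^j], bounds
    the factor [n^2]. *)
Lemma blockf_moments a al be j K A W :
  (forall n, In n (block j) -> 0 <= a n <= A) ->
  modes_bounded al be W ->
  RInt (fun x => blockf a al be j K x ^ 4) 0 1 <= moment_bound W A j /\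
  RInt (fun x => blockf' a al be j K x ^ 4) 0 1
    <= 7 ^ 4 * 4 ^ 4 * INR (2 ^ j) ^ 8 * moment_bound W A j.
Proof.
  intros Ha HW; split.
  - rewrite (int_ext _ (fun x => (lsum (seq 1 K) (fun k => al k * bcos a j k x + be k * bsin a j k x)) ^ 4))
      by (intros; rewrite blockf_modes; reflexivity).
    apply modes_fourth_moment; [exact Ha | apply abs_coef_bound; exact HW].
  - set (M := INR (2 ^ j)).
    apply Rle_trans with ((7 * W) ^ 4 * ((4 * M ^ 2 * A) ^ 4 * (65 * M ^ 2 * (INR j + 3)))).
    + unfold blockf'; apply modes_fourth_moment.
      * intros n Hn; assert (Hb := Ha n Hn); apply in_block in Hn.
        assert (INR n <= 2 * M).
        { unfold M; rewrite <- (mult_INR 2); apply le_INR; lia. }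
        assert (0 <= INR n) by apply pos_INR.
        split; [apply Rmult_le_pos; [apply pow2_ge_0 | lra]|].
        apply Rmult_le_compat; [apply pow2_ge_0|lra| |lra].
        replace (4 * M ^ 2) with ((2 * M) ^ 2) by ring; apply pow_incr; lra.
      * assert (HP := PI_bounds).
        rewrite (lsum_ext _ _ (fun k => 2 * PI * (INR k * (Rabs (al k) + Rabs (be k))))).
        -- rewrite lsum_scal; specialize (HW K).
           assert (0 <= lsum (seq 1 K) (fun k => INR k * (Rabs (al k) + Rabs (be k)))).
           { apply lsum_nonneg; intros k _; apply Rmult_le_pos; [apply pos_INR|].
             generalize (Rabs_pos (al k)) (Rabs_pos (be k)); lra. }
           apply Rmult_le_compat; lra.
        -- intros k _; rewrite Rabs_Ropp, !Rabs_mult, (Rabs_pos_eq 2), (Rabs_pos_eq PI), (Rabs_pos_eq (INR k))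
             by (apply pos_INR || lra).
           ring.
    + right; unfold moment_bound; fold M; ring.
Qed.

(** * Oscillation over the cells of a grid *)

Definition in_cell (N i : nat) (x : R) : Prop := INR i / INR N <= x <= (INR i + 1) / INR N.

Definition cell_points (N : nat) (x : nat -> R) : Prop :=
  forall i, (i < N)%nat -> in_cell N i (x i).

Lemma int_subinterval (f : R -> R) a b x y :
  cont f -> (forall z, 0 <= f z) -> a <= x -> x <= y -> y <= b -> RInt f x y <= RInt f a b.
Proof.
  intros Hf H0 Hax Hxy Hyb.
  rewrite <- (int_chasles f a x b), <- (int_chasles f x y b) by exact Hf.
  assert (0 <= RInt f a x) by (apply int_nonneg; auto).
  assert (0 <= RInt f y b) by (apply int_nonneg; auto).
  lra.
Qed.

(** The variation of [f] on a cell is at most the integral of [|f'|], hence at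
    most its fourth mean: efficient for slowly varying [f]. *)
Lemma osc4_derivative (f f' : R -> R) a b x y :
  (forall x, is_derive f x (f' x)) -> cont f' -> a < b -> a <= x <= b -> a <= y <= b ->
  (f x - f y) ^ 4 <= (b - a) ^ 3 * RInt (fun z => f' z ^ 4) a b.
Proof.
  intros Hd Hc Hab Hx Hy.
  assert (Hmain : forall x y, a <= x -> x <= y -> y <= b ->
    (f y - f x) ^ 4 <= (b - a) ^ 3 * RInt (fun z => f' z ^ 4) a b).
  { clear x y Hx Hy; intros x y Hx Hxy Hy.
    set (X := f y - f x). set (l := b - a). set (t := X / l).
    assert (Hl : 0 < l) by (unfold l; lra).
    assert (H1 : RInt (fun z => 4 * t ^ 3 * f' z) x y <= RInt (fun z => f' z ^ 4 + 3 * t ^ 4) x y).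
    { apply int_le; auto with cont. intros; apply pow4_tangent. }
    rewrite int_scal, (int_derive f f') in H1 by auto.
    assert (Ht := pow4_nonneg t).
    assert (H2 : RInt (fun z => f' z ^ 4 + 3 * t ^ 4) x y <= RInt (fun z => f' z ^ 4 + 3 * t ^ 4) a b).
    { apply int_subinterval; auto with cont. intros z.
      generalize (pow4_nonneg (f' z)); lra. }
    fold X in H1.
    set (I := RInt (fun z => f' z ^ 4) a b : R).
    assert (H3 : 4 * t ^ 3 * X <= I + l * (3 * t ^ 4)).
    { eapply Rle_trans; [exact H1|]; eapply Rle_trans; [exact H2|].
      rewrite int_plus, int_const by auto with cont; right; reflexivity. }
    assert (EX : X = t * l) by (unfold t; field; lra).
    rewrite EX in H3 |- *.
    assert (t ^ 4 * l <= I) by lra.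
    replace ((t * l) ^ 4) with (l ^ 3 * (t ^ 4 * l)) by ring.
    apply Rmult_le_compat_l; [apply pow_le; lra | assumption]. }
  destruct (Rle_or_lt x y) as [Hxy|Hxy].
  - replace ((f x - f y) ^ 4) with ((f y - f x) ^ 4) by ring. apply Hmain; lra.
  - apply Hmain; lra.
Qed.

Lemma young4 u v lam : 0 < lam ->
  4 * u ^ 3 * v <= 3 * lam * u ^ 4 + / lam ^ 3 * v ^ 4.
Proof.
  intros Hl. assert (H := pow4_tangent v (lam * u)).
  assert (H3 : 0 < lam ^ 3) by (apply pow_lt; exact Hl).
  apply (Rmult_le_reg_l (lam ^ 3)); [exact H3|].
  replace (lam ^ 3 * (3 * lam * u ^ 4 + / lam ^ 3 * v ^ 4)) with (3 * lam ^ 4 * u ^ 4 + v ^ 4)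
    by (field; lra).
  replace (3 * (lam * u) ^ 4) with (3 * lam ^ 4 * u ^ 4) in H by ring.
  replace (4 * (lam * u) ^ 3 * v) with (lam ^ 3 * (4 * u ^ 3 * v)) in H by ring.
  lra.
Qed.

(** A Sobolev-type bound of the maximum on a cell by integrals over the same
    cell: efficient for a function oscillating at frequency [lam]. *)
Lemma sup4_sobolev (f f' : R -> R) a b x lam :
  (forall x, is_derive f x (f' x)) -> cont f' -> 0 < lam -> a < b -> a <= x <= b ->
  (b - a) * f x ^ 4 <= RInt (fun z => f z ^ 4) a b +
    (b - a) * RInt (fun z => 3 * lam * f z ^ 4 + / lam ^ 3 * f' z ^ 4) a b.
Proof.
  intros Hd Hc Hlam Hab Hx.
  assert (Hf : cont f) by (intros z; apply (ex_derive_continuous f); eexists; apply Hd).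
  set (r := fun z => 3 * lam * f z ^ 4 + / lam ^ 3 * f' z ^ 4).
  assert (Hr : cont r) by (unfold r; auto with cont).
  assert (Hl3 : 0 < / lam ^ 3) by (apply Rinv_0_lt_compat, pow_lt, Hlam).
  assert (Hr0 : forall z, 0 <= r z).
  { intros z; unfold r; apply Rplus_le_le_0_compat; apply Rmult_le_pos; auto using pow4_nonneg; lra. }
  assert (D4 : forall z, is_derive (fun z => f z ^ 4) z (4 * f z ^ 3 * f' z)).
  { intros z. evar_last; [apply (is_derive_pow f 4 z (f' z)); apply Hd|]. simpl; ring. }
  assert (Hvar : forall y, a <= y <= b -> f x ^ 4 - f y ^ 4 <= RInt r a b).
  { intros y Hy; destruct (Rle_or_lt y x) as [Hyx|Hxy].
    - rewrite <- (int_derive (fun z => f z ^ 4) (fun z => 4 * f z ^ 3 * f' z)) by auto with cont.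
      apply Rle_trans with (RInt r y x); [|apply int_subinterval; auto; lra].
      apply int_le; auto with cont. intros z _; apply young4; exact Hlam.
    - replace (f x ^ 4 - f y ^ 4) with (-1 * (f y ^ 4 - f x ^ 4)) by ring.
      rewrite <- (int_derive (fun z => f z ^ 4) (fun z => 4 * f z ^ 3 * f' z)) by auto with cont.
      rewrite <- int_scal by auto with cont.
      apply Rle_trans with (RInt r x y); [|apply int_subinterval; auto; lra].
      apply int_le; [lra|auto with cont|exact Hr|]. intros z _.
      unfold r; generalize (young4 (f z) (- f' z) lam Hlam).
      replace ((- f' z) ^ 4) with (f' z ^ 4) by ring; lra. }
  apply Rle_trans with (RInt (fun y => f y ^ 4 + RInt r a b) a b).
  - change ((b - a) * f x ^ 4) with ((b - a) * (f x ^ 4)).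
    rewrite <- (int_const (f x ^ 4)). apply int_le; [lra|auto with cont|auto with cont|].
    intros y Hy; specialize (Hvar y Hy); lra.
  - rewrite int_plus, int_const by auto with cont; right; reflexivity.
Qed.

Lemma int_cells (f : R -> R) N : cont f -> (0 < N)%nat ->
  lsum (seq 0 N) (fun i => RInt f (INR i / INR N) ((INR i + 1) / INR N)) = RInt f 0 1.
Proof.
  intros Hf HN.
  assert (HN' : 0 < INR N) by (apply lt_0_INR; exact HN).
  assert (H : forall n, lsum (seq 0 n) (fun i => RInt f (INR i / INR N) ((INR i + 1) / INR N))
    = RInt f 0 (INR n / INR N)).
  { induction n as [|n IH].
    - simpl; unfold Rdiv; rewrite Rmult_0_l, RInt_point; reflexivity.
    - rewrite lsum_seq_S, IH; simpl plus.
      rewrite int_chasles, S_INR by exact Hf; reflexivity. }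
  rewrite H; f_equal; field; lra.
Qed.

(** [65] is the constant of [energy] and [7^4 4^4] that of [blockf_moments];
    [4] comes from [N + 3 lam <= 4 lam], and [16] is the price of bounding an
    oscillation by two values. *)
Definition cell_const : R := 16 * (4 + 7 ^ 4 * 4 ^ 4) * 65.

Definition decay (delta : R) (n : nat) : R := Rpower (INR n) (- (1 + delta)).

Lemma Rpower_nonneg x y : 0 <= Rpower x y.
Proof. left; apply exp_pos. Qed.

Lemma Rpower_neg_anti x y z : 0 < x -> x <= y -> 0 <= z -> Rpower y (- z) <= Rpower x (- z).
Proof.
  intros Hx Hxy Hz; rewrite !Rpower_Ropp.
  apply Rinv_le_contravar; [apply exp_pos | apply Rle_Rpower_l; lra].
Qed.

Lemma decay_block delta j n : 0 < delta -> In n (block j) ->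
  0 <= decay delta n <= decay delta (2 ^ j).
Proof.
  intros Hd Hn; apply in_block in Hn; split; [apply Rpower_nonneg|].
  apply Rpower_neg_anti; [apply lt_0_INR, pow2_pos | apply le_INR; lia | lra].
Qed.

Lemma decay_pow4 delta m : (0 < m)%nat ->
  decay delta m ^ 4 * INR m ^ 4 = Rpower (INR m ^ 2) (- (2 * delta)).
Proof.
  intros Hm; assert (H0 : 0 < INR m) by (apply lt_0_INR; exact Hm).
  unfold decay. rewrite <- !Rpower_pow by (try apply exp_pos; exact H0).
  rewrite !Rpower_mult, <- Rpower_plus; f_equal; simpl; ring.
Qed.

(** Each block oscillates over the cells of side [1/N] no more than the block of
    frequency [N] does, up to the logarithmic loss in the energy. *)
Lemma block_osc4 al be delta W j K N (x y : nat -> R) :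
  0 < delta <= 1 -> (0 < N)%nat ->
  modes_bounded al be W ->
  cell_points N x -> cell_points N y ->
  lsum (seq 0 N) (fun i =>
    (blockf (decay delta) al be j K (x i) - blockf (decay delta) al be j K (y i)) ^ 4)
  <= cell_const * W ^ 4 * (INR j + 3) * Rpower (INR N) (- (2 * delta)).
Proof.
  intros Hdel HN HW Hx Hy.
  set (f := blockf (decay delta) al be j K). set (f' := blockf' (decay delta) al be j K).
  assert (Hd : forall x, is_derive f x (f' x)) by (intros; apply is_derive_blockf).
  assert (Hf : cont f) by (unfold f; auto with cont).
  assert (Hf' : cont f') by (unfold f'; auto with cont).
  set (M := INR (2 ^ j)). set (A := decay delta (2 ^ j)).
  destruct (blockf_moments (decay delta) al be j K A W) as [HI HI'];
    [intros n Hn; apply decay_block; [lra|exact Hn] | exact HW |].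
  fold f in HI; fold f' in HI'; fold M in HI'.
  assert (HM : 0 < M) by (apply lt_0_INR, pow2_pos).
  assert (HN' : 0 < INR N) by (apply lt_0_INR; exact HN).
  assert (HAM : A ^ 4 * M ^ 4 = Rpower (M ^ 2) (- (2 * delta))) by (apply decay_pow4, pow2_pos).
  set (P := Rpower (M ^ 2) (- (2 * delta))) in *.
  set (PN := Rpower (INR N) (- (2 * delta))).
  set (V := W ^ 4 * (INR j + 3)).
  assert (HW0 : 0 <= W) by (apply (HW 0%nat)).
  assert (HV : 0 <= V).
  { unfold V; apply Rmult_le_pos; [apply pow_le; exact HW0|]. generalize (pos_INR j); lra. }
  assert (HP : 0 <= P) by apply Rpower_nonneg.
  assert (HPN : 0 <= PN) by apply Rpower_nonneg.
  assert (Hmom : M ^ 2 * moment_bound W A j = 65 * (V * P)).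
  { unfold moment_bound, V; fold M; rewrite <- HAM; ring. }
  assert (Hcell : forall i, (INR i + 1) / INR N - INR i / INR N = / INR N) by (intros; field; lra).
  assert (HiN : 0 < / INR N) by (apply Rinv_0_lt_compat; exact HN').
  replace (cell_const * W ^ 4 * (INR j + 3) * PN) with (cell_const * (V * PN)) by (unfold V; ring).
  destruct (Rle_or_lt (M ^ 2) (INR N)) as [Hlow|Hhigh].
  - (* The block varies by little on a cell: its derivative is efficient. *)
    assert (HPM : (M ^ 2) ^ 3 * P <= INR N ^ 3 * PN).
    { assert (HM2 : 0 < M ^ 2) by (apply pow_lt; exact HM).
      unfold P, PN; rewrite <- !Rpower_pow by assumption.
      rewrite <- !Rpower_plus. apply Rle_Rpower_l; [simpl; lra|].
      rewrite Rpower_pow by exact HM; split; assumption. }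
    apply Rle_trans with (lsum (seq 0 N) (fun i => (/ INR N) ^ 3 *
      RInt (fun z => f' z ^ 4) (INR i / INR N) ((INR i + 1) / INR N))).
    { apply lsum_le; intros i Hi; apply in_seq in Hi. rewrite <- (Hcell i).
      apply osc4_derivative; auto; [specialize (Hcell i); lra|apply Hx; lia|apply Hy; lia]. }
    rewrite lsum_scal, int_cells by auto with cont.
    apply Rle_trans with ((/ INR N) ^ 3 * (7 ^ 4 * 4 ^ 4 * M ^ 8 * moment_bound W A j)).
    { apply Rmult_le_compat_l; [apply pow_le; lra | exact HI']. }
    replace ((/ INR N) ^ 3 * (7 ^ 4 * 4 ^ 4 * M ^ 8 * moment_bound W A j))
      with ((/ INR N) ^ 3 * (7 ^ 4 * 4 ^ 4 * M ^ 6 * (M ^ 2 * moment_bound W A j))) by ring.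
    rewrite Hmom.
    replace ((/ INR N) ^ 3 * (7 ^ 4 * 4 ^ 4 * M ^ 6 * (65 * (V * P))))
      with (7 ^ 4 * 4 ^ 4 * 65 * (V * ((/ INR N) ^ 3 * ((M ^ 2) ^ 3 * P)))) by ring.
    assert (Hk : (/ INR N) ^ 3 * ((M ^ 2) ^ 3 * P) <= PN).
    { apply (Rmult_le_reg_l (INR N ^ 3)); [apply pow_lt; exact HN'|].
      replace (INR N ^ 3 * ((/ INR N) ^ 3 * ((M ^ 2) ^ 3 * P))) with ((M ^ 2) ^ 3 * P)
        by (field; lra).
      exact HPM. }
    assert (Hk2 : V * ((/ INR N) ^ 3 * ((M ^ 2) ^ 3 * P)) <= V * PN) by (apply Rmult_le_compat_l; assumption).
    assert (0 <= V * PN) by (apply Rmult_le_pos; assumption).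
    unfold cell_const; lra.
  - (* The block oscillates many times in a cell: only its size matters. *)
    assert (HPM : P <= PN) by (apply Rpower_neg_anti; lra).
    set (lam := M ^ 2).
    assert (Hlam : 0 < lam) by (unfold lam; lra).
    set (r := fun z => 3 * lam * f z ^ 4 + / lam ^ 3 * f' z ^ 4).
    assert (Hr : cont r) by (unfold r; auto with cont).
    assert (Hsup : forall z : nat -> R, cell_points N z ->
      lsum (seq 0 N) (fun i => f (z i) ^ 4) <= (4 + 7 ^ 4 * 4 ^ 4) * 65 * (V * PN)).
    { intros z Hz.
      apply Rle_trans with (lsum (seq 0 N) (fun i =>
        INR N * RInt (fun z => f z ^ 4) (INR i / INR N) ((INR i + 1) / INR N) +
        RInt r (INR i / INR N) ((INR i + 1) / INR N))).
      { apply lsum_le; intros i Hi; apply in_seq in Hi.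
        assert (H := sup4_sobolev f f' (INR i / INR N) ((INR i + 1) / INR N) (z i) lam Hd Hf' Hlam).
        fold r in H; rewrite Hcell in H.
        apply (Rmult_le_reg_l (/ INR N)); [exact HiN|].
        eapply Rle_trans; [apply H|].
        - specialize (Hcell i); lra.
        - apply Hz; lia.
        - right; field; lra. }
      rewrite lsum_plus, lsum_scal, !int_cells by auto with cont.
      unfold r; rewrite int_plus, !int_scal by auto with cont.
      set (I := RInt (fun z => f z ^ 4) 0 1) in *. set (I' := RInt (fun z => f' z ^ 4) 0 1) in *.
      assert (HI0 : 0 <= I).
      { apply int_nonneg; [lra|auto with cont|]. intros; apply pow4_nonneg. }
      assert (E1 : INR N * I + 3 * lam * I <= 4 * (M ^ 2 * moment_bound W A j)).
      { apply Rle_trans with (4 * lam * I).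
        - assert (INR N * I <= lam * I) by (apply Rmult_le_compat_r; unfold lam; lra). lra.
        - rewrite <- Rmult_assoc; apply Rmult_le_compat_l; [lra|exact HI]. }
      assert (E2 : / lam ^ 3 * I' <= 7 ^ 4 * 4 ^ 4 * (M ^ 2 * moment_bound W A j)).
      { apply (Rmult_le_reg_l (lam ^ 3)); [apply pow_lt; exact Hlam|].
        rewrite <- Rmult_assoc, Rinv_r, Rmult_1_l by (apply pow_nonzero; lra).
        eapply Rle_trans; [exact HI'|]; right; unfold lam; ring. }
      rewrite Hmom in E1, E2.
      assert (V * P <= V * PN) by (apply Rmult_le_compat_l; assumption).
      lra. }
    apply Rle_trans with (lsum (seq 0 N) (fun i => 8 * f (x i) ^ 4 + 8 * f (y i) ^ 4)).
    { apply lsum_le; intros i _; unfold Rminus.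
      replace (f (y i) ^ 4) with ((- f (y i)) ^ 4) by ring. apply pow4_add. }
    rewrite lsum_plus, !lsum_scal.
    assert (H1 := Hsup x Hx); assert (H2 := Hsup y Hy).
    assert (0 <= V * PN) by (apply Rmult_le_pos; assumption).
    unfold cell_const; lra.
Qed.

(** * The truncated series *)

Definition truncated (delta : R) (al be : nat -> R) (J K : nat) (x : R) : R :=
  lsum (seq 1 (2 ^ J - 1)) (fun n => decay delta n * psum al be K (INR n ^ 2 * x)).

Lemma lsum_blocks J (f : nat -> R) :
  lsum (seq 1 (2 ^ J - 1)) f = lsum (seq 0 J) (fun j => lsum (block j) f).
Proof.
  induction J as [|J IH]; [reflexivity|].
  rewrite lsum_seq_S, <- IH; simpl plus; unfold block.
  assert (H := pow2_pos J).
  replace (2 ^ S J - 1)%nat with ((2 ^ J - 1) + 2 ^ J)%nat by (simpl; lia).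
  rewrite seq_app, lsum_app; replace (1 + (2 ^ J - 1))%nat with (2 ^ J)%nat by lia; reflexivity.
Qed.

Lemma truncated_blocks delta al be J K x :
  truncated delta al be J K x = lsum (seq 0 J) (fun j => blockf (decay delta) al be j K x).
Proof. unfold truncated; rewrite lsum_blocks; reflexivity. Qed.

(** Hölder's inequality over the blocks loses a power of their number; this
    number is logarithmic, so the uniform bound of each block is enough. *)
Lemma truncated_osc4 al be delta W J K N (x y : nat -> R) :
  0 < delta <= 1 -> (0 < N)%nat ->
  modes_bounded al be W ->
  cell_points N x -> cell_points N y ->
  lsum (seq 0 N) (fun i => (truncated delta al be J K (x i) - truncated delta al be J K (y i)) ^ 4)
  <= cell_const * W ^ 4 * (INR J + 3) ^ 5 * Rpower (INR N) (- (2 * delta)).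
Proof.
  intros Hdel HN HW Hx Hy.
  set (B := blockf (decay delta) al be).
  assert (HJ : 0 <= INR J) by apply pos_INR.
  assert (HW0 : 0 <= W) by (apply (HW 0%nat)).
  set (PN := Rpower (INR N) (- (2 * delta))).
  assert (HPN : 0 <= PN) by apply Rpower_nonneg.
  apply Rle_trans with (lsum (seq 0 N) (fun i => INR J ^ 3 * lsum (seq 0 J) (fun j =>
    (B j K (x i) - B j K (y i)) ^ 4))).
  - apply lsum_le; intros i _.
    rewrite !truncated_blocks, <- lsum_minus.
    rewrite (lsum_ext _ _ (fun j => 1 * (B j K (x i) - B j K (y i)))) by (intros; unfold B; ring).
    rewrite (lsum_ext (seq 0 J) (fun j => (B j K (x i) - B j K (y i)) ^ 4)
      (fun j => 1 * (B j K (x i) - B j K (y i)) ^ 4)) by (intros; ring).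
    apply pow4_mean; [intros; lra|].
    rewrite lsum_const, length_seq; lra.
  - rewrite lsum_scal, lsum_swap.
    set (Q := cell_const * W ^ 4 * PN).
    assert (HQ : 0 <= Q).
    { unfold Q, cell_const; repeat apply Rmult_le_pos; try lra. }
    apply Rle_trans with (INR J ^ 3 * (INR J * ((INR J + 3) * Q))).
    + apply Rmult_le_compat_l; [apply pow_le; exact HJ|].
      rewrite <- (length_seq J 0) at 2; rewrite <- lsum_const.
      apply lsum_le; intros j Hj; apply in_seq in Hj.
      apply Rle_trans with (cell_const * W ^ 4 * (INR j + 3) * PN).
      * apply block_osc4; assumption.
      * assert (INR j <= INR J) by (apply le_INR; lia).
        apply Rle_trans with ((INR j + 3) * Q); [right; unfold Q; ring|].
        apply Rmult_le_compat_r; lra.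
    + replace (cell_const * W ^ 4 * (INR J + 3) ^ 5 * PN) with ((INR J + 3) ^ 4 * ((INR J + 3) * Q))
        by (unfold Q; ring).
      rewrite <- Rmult_assoc; apply Rmult_le_compat_r; [apply Rmult_le_pos; lra|].
      replace (INR J ^ 3 * INR J) with (INR J ^ 4) by ring. apply pow_incr; lra.
Qed.

(** * A lower bound for the mean square of the increments *)

(** After division by the greatest common divisor, the remaining square divides [d]. *)
Lemma square_free_dvd d n q :
  square_free d -> (0 < n)%nat -> Nat.divide (n * n) (d * (q * q)) -> Nat.divide n q.
Proof.
  intros Hsf Hn Hd.
  destruct (gcd_split n q Hn) as (g & n' & q' & Hg & Hn' & Hq' & Hc).
  assert (Hd' : Nat.divide (n' * n') (q' * (q' * d))).
  { destruct Hd as [e He]; exists e.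
    apply (Nat.mul_cancel_r _ _ (g * g)); [nia|].
    transitivity (d * (q * q))%nat; [rewrite Hq'; ring|]. rewrite He, Hn'; ring. }
  assert (Hc2 : Nat.gcd (n' * n') q' = 1%nat).
  { assert (H : Nat.divide (Nat.gcd (n' * n') q') n').
    { apply (Nat.gauss _ n').
      - apply Nat.gcd_divide_l.
      - apply Nat.divide_1_r. rewrite <- Hc. apply Nat.gcd_greatest.
        + apply Nat.gcd_divide_r.
        + eapply Nat.divide_trans; [apply Nat.gcd_divide_l | apply Nat.gcd_divide_r]. }
    apply Nat.divide_1_r. rewrite <- Hc; apply Nat.gcd_greatest; [exact H | apply Nat.gcd_divide_r]. }
  apply Nat.gauss in Hd'; [|exact Hc2]. apply Nat.gauss in Hd'; [|exact Hc2].
  apply Hsf in Hd'; subst n'. exists q'. lia.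
Qed.

(** The frequency [d q^2] arises from the mode [k] of the term of index [n]
    exactly when [q = n m] and [k = m^2 d]: this is where [d] is square-free. *)
Lemma resonance d n q K L (F : nat -> R) :
  square_free d -> (0 < d)%nat -> (0 < n)%nat -> (0 < q)%nat -> (q <= L)%nat -> (q * q * d <= K)%nat ->
  lsum (seq 1 K) (fun k => kron (Z.of_nat k * sqZ n) (Z.of_nat (d * (q * q))) * F k) =
  lsum (seq 1 L) (fun m => kron (Z.of_nat (n * m)) (Z.of_nat q) * F (m * m * d)%nat).
Proof.
  intros Hsf Hd Hn Hq HL HK.
  destruct (classic (Nat.divide n q)) as [[m Hm]|Hnd].
  - assert (Hm0 : (0 < m)%nat) by nia.
    rewrite (lsum_single (seq 1 K) (m * m * d)%nat).
    + rewrite (lsum_single (seq 1 L) m).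
      * replace (Z.of_nat (m * m * d) * sqZ n)%Z with (Z.of_nat (d * (q * q)))
          by (unfold sqZ; rewrite Hm; lia).
        replace (n * m)%nat with q by lia. rewrite !kron_diag; reflexivity.
      * apply seq_NoDup.
      * apply in_seq; nia.
      * intros m' _ Hne; rewrite kron_neq; [ring|]. intros E; apply Hne.
        apply (Nat.mul_cancel_l _ _ n); lia.
    + apply seq_NoDup.
    + apply in_seq; split; [nia|].
      apply Nat.lt_succ_r. eapply Nat.le_trans; [|exact HK].
      apply Nat.mul_le_mono_r, Nat.mul_le_mono; nia.
    + intros k _ Hne; rewrite kron_neq; [ring|]. intros E; apply Hne.
      unfold sqZ in E; rewrite Hm in E.
      apply (Nat.mul_cancel_r _ _ (n * n)); [nia|].
      apply Nat2Z.inj. rewrite !Nat2Z.inj_mul in *. lia.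
  - rewrite !lsum_0; [reflexivity| |].
    + intros m _; rewrite kron_neq; [ring|]. intros E; apply Hnd; exists m; lia.
    + intros k _; rewrite kron_neq; [ring|]. intros E; apply Hnd.
      apply (square_free_dvd d); [exact Hsf|exact Hn|].
      exists k; unfold sqZ in E; apply Nat2Z.inj; rewrite !Nat2Z.inj_mul in *; lia.
Qed.

Definition dvd_ind (m q : nat) : R := if (q mod m =? 0)%nat then 1 else 0.

Lemma count_multiples m n : (0 < m)%nat -> lsum (seq 1 n) (dvd_ind m) = INR (n / m).
Proof.
  intros Hm; induction n as [|n IH].
  - rewrite Nat.Div0.div_0_l; reflexivity.
  - rewrite lsum_seq1_S, IH; unfold dvd_ind.
    assert (E := Nat.div_mod_eq n m); assert (Hr := Nat.mod_upper_bound n m ltac:(lia)).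
    destruct (Nat.eq_dec (S (n mod m)) m) as [Hs|Hs].
    + rewrite <- (Nat.mod_unique (S n) m (S (n / m)) 0) by nia.
      rewrite <- (Nat.div_unique (S n) m (S (n / m)) 0) by nia.
      rewrite S_INR; reflexivity.
    + rewrite <- (Nat.mod_unique (S n) m (n / m) (S (n mod m))) by nia.
      rewrite <- (Nat.div_unique (S n) m (n / m) (S (n mod m))) by nia.
      simpl; ring.
Qed.

Lemma count_multiples_block m Q : (0 < m)%nat -> (0 < Q)%nat ->
  Rabs (INR m * lsum (seq Q Q) (dvd_ind m) - INR Q) <= INR m.
Proof.
  intros Hm HQ.
  assert (H1 := count_multiples m (2 * Q - 1) Hm).
  replace (2 * Q - 1)%nat with ((Q - 1) + Q)%nat in H1 at 1 by lia.
  rewrite seq_app, lsum_app, (count_multiples m (Q - 1) Hm) in H1.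
  replace (1 + (Q - 1))%nat with Q in H1 by lia.
  assert (B : forall n, INR m * INR (n / m) <= INR n <= INR m * INR (n / m) + INR m - 1).
  { intros n. rewrite <- mult_INR; split.
    - apply le_INR, Nat.Div0.mul_div_le.
    - assert (E := Nat.div_mod_eq n m); assert (Hr := Nat.mod_upper_bound n m ltac:(lia)).
      assert (INR (n + 1) <= INR (m * (n / m) + m)) by (apply le_INR; lia).
      rewrite !plus_INR in H; simpl (INR 1) in H; lra. }
  assert (B1 := B (Q - 1)%nat); assert (B2 := B (2 * Q - 1)%nat).
  rewrite minus_INR in B1, B2 by lia. rewrite mult_INR in B2; simpl (INR 1) in *; simpl (INR 2) in *.
  apply Rabs_le. assert (Hm1 : 1 <= INR m) by (apply (le_INR 1); exact Hm).
  replace (lsum (seq Q Q) (dvd_ind m)) with (INR ((2 * Q - 1) / m) - INR ((Q - 1) / m)) by lra.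
  lra.
Qed.

Lemma decay_cancel delta n m : (0 < n)%nat -> (0 < m)%nat ->
  decay delta n * Rpower (INR (n * m)) (1 + delta) = Rpower (INR m) (1 + delta).
Proof.
  intros Hn Hm.
  assert (0 < INR n) by (apply lt_0_INR; exact Hn). assert (0 < INR m) by (apply lt_0_INR; exact Hm).
  unfold decay; rewrite mult_INR, <- Rpower_mult_distr by assumption.
  rewrite <- Rmult_assoc, <- Rpower_plus, Rplus_opp_l, Rpower_O by assumption; ring.
Qed.

(** Exchanging the sums: [m] runs over the divisors of [q], and the weights
    [n^(-1-delta)] and [q^(1+delta)] combine into [m^(1+delta)]. *)
Lemma resonance_sum delta d M K Q (f : nat -> R) :
  square_free d -> (0 < d)%nat -> (0 < Q)%nat -> (2 * Q <= M)%nat -> (4 * (Q * Q) * d <= K)%nat ->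
  lsum (seq Q Q) (fun q => lsum (seq 1 M) (fun n => lsum (seq 1 K) (fun k =>
    kron (Z.of_nat k * sqZ n) (Z.of_nat (d * (q * q))) *
      (decay delta n * Rpower (INR q) (1 + delta) * f k)))) =
  lsum (seq 1 (2 * Q)) (fun m =>
    Rpower (INR m) (1 + delta) * f (m * m * d)%nat * lsum (seq Q Q) (dvd_ind m)).
Proof.
  intros Hsf Hd HQ HM HK.
  rewrite (lsum_ext (seq 1 (2 * Q)) _ (fun m => lsum (seq Q Q) (fun q =>
    Rpower (INR m) (1 + delta) * f (m * m * d)%nat * dvd_ind m q)))
    by (intros; rewrite lsum_scal; reflexivity).
  rewrite (lsum_swap (seq 1 (2 * Q))); apply lsum_ext; intros q Hq; apply in_seq in Hq.
  rewrite (lsum_ext (seq 1 M) _ (fun n => lsum (seq 1 (2 * Q)) (fun m =>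
    kron (Z.of_nat (n * m)) (Z.of_nat q) *
      (decay delta n * Rpower (INR q) (1 + delta) * f (m * m * d)%nat)))).
  2:{ intros n Hn; apply in_seq in Hn.
      apply (resonance d n q K (2 * Q) (fun k => decay delta n * Rpower (INR q) (1 + delta) * f k));
        try assumption; try lia.
      eapply Nat.le_trans; [|exact HK]. apply Nat.mul_le_mono_r; nia. }
  rewrite lsum_swap; apply lsum_ext; intros m Hm; apply in_seq in Hm.
  unfold dvd_ind; destruct (Nat.eqb_spec (q mod m) 0) as [E|NE].
  - assert (Eq : (q = (q / m) * m)%nat) by (generalize (Nat.div_mod_eq q m); lia).
    set (n := (q / m)%nat) in *.
    assert (Hn0 : (0 < n)%nat) by nia.
    rewrite (lsum_single _ n).
    + rewrite <- Eq, kron_diag, Rmult_1_l, Rmult_1_r. f_equal.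
      rewrite Eq; apply decay_cancel; lia.
    + apply seq_NoDup.
    + apply in_seq; nia.
    + intros n' _ Hne; rewrite kron_neq; [ring|]. intros E2; apply Hne.
      apply (Nat.mul_cancel_r _ _ m); lia.
  - rewrite lsum_0; [ring|].
    intros n _; rewrite kron_neq; [ring|]. intros E; apply NE.
    apply Nat2Z.inj in E; rewrite <- E; apply Nat.Div0.mod_mul.
Qed.

(** Among [Q] consecutive integers, [Q/m + O(1)] are multiples of [m]. The
    error is weighted by [m^(1+delta) <= m^2], and [k = m^2 d], so that it is
    controlled by the absolute sum with weight [k]; this uses [delta <= 1]. *)
Lemma resonance_main delta d W Q (f : nat -> R) :
  0 < delta <= 1 -> (0 < d)%nat -> (0 < Q)%nat ->
  (forall K, lsum (seq 1 K) (fun k => INR k * Rabs (f k)) <= W) ->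
  Rabs (lsum (seq 1 (2 * Q)) (fun m =>
          Rpower (INR m) (1 + delta) * f (m * m * d)%nat * lsum (seq Q Q) (dvd_ind m))
        - INR Q * lsum (seq 1 (2 * Q)) (fun m => Rpower (INR m) delta * f (m * m * d)%nat)) <= W.
Proof.
  intros Hdel Hd HQ HW.
  rewrite <- lsum_scal, <- lsum_minus.
  eapply Rle_trans; [apply lsum_Rabs|].
  apply Rle_trans with (lsum (seq 1 (2 * Q)) (fun m => INR (m * m * d) * Rabs (f (m * m * d)%nat))).
  - apply lsum_le; intros m Hm; apply in_seq in Hm.
    assert (Hm1 : 1 <= INR m) by (apply (le_INR 1); lia).
    replace (_ - _) with (Rpower (INR m) delta * (INR m * lsum (seq Q Q) (dvd_ind m) - INR Q) * f (m * m * d)%nat)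
      by (rewrite Rpower_plus, Rpower_1 by lra; ring).
    rewrite !Rabs_mult; apply Rmult_le_compat_r; [apply Rabs_pos|].
    rewrite (Rabs_pos_eq (Rpower _ _)) by apply Rpower_nonneg.
    apply Rle_trans with (INR m * INR m).
    + apply Rmult_le_compat; [apply Rpower_nonneg|apply Rabs_pos| |apply count_multiples_block; lia].
      rewrite <- (Rpower_1 (INR m)) at 2 by lra. apply Rle_Rpower; lra.
    + rewrite <- mult_INR; apply le_INR; nia.
  - rewrite <- (lsum_map (fun m => (m * m * d)%nat) _ (fun k => INR k * Rabs (f k))).
    eapply Rle_trans; [|apply (HW (4 * (Q * Q) * d)%nat)].
    apply lsum_incl.
    + apply FinFun.Injective_map_NoDup; [|apply seq_NoDup].
      intros a b E; apply Nat.mul_cancel_r in E; [nia|lia].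
    + intros k Hk; apply in_map_iff in Hk; destruct Hk as [m [<- Hm]]; apply in_seq in Hm.
      apply in_seq; split; [nia|]. apply Nat.lt_succ_r, Nat.mul_le_mono_r; nia.
    + intros k _; apply Rmult_le_pos; [apply pos_INR | apply Rabs_pos].
Qed.

Lemma cont_truncated delta al be J K : cont (truncated delta al be J K).
Proof.
  unfold truncated, psum; apply cont_lsum; intros n _; apply cont_mult; [auto with cont|].
  apply (cont_comp (trig (seq 1 K) Z.of_nat al be)); auto with cont.
Qed.

Lemma periodic_truncated delta al be J K : periodic1 (truncated delta al be J K).
Proof.
  intros x; unfold truncated; apply lsum_ext; intros n _; f_equal.
  unfold psum, trig; apply lsum_ext; intros k _.
  replace (INR n ^ 2 * (x + 1)) with (INR n ^ 2 * x + IZR (sqZ n))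
    by (unfold sqZ; rewrite mult_IZR, <- INR_IZR_INZ; ring).
  assert (Hc := periodic1_IZR _ (periodic_cs (Z.of_nat k) 0)).
  assert (Hs := periodic1_IZR _ (periodic_sn (Z.of_nat k) 0)).
  simpl in Hc, Hs; specialize (Hc (sqZ n) (INR n ^ 2 * x)); specialize (Hs (sqZ n) (INR n ^ 2 * x)).
  rewrite !Rplus_0_r in Hc, Hs; rewrite Hc, Hs; reflexivity.
Qed.

(** The centred increment multiplies the mode of frequency [z] by
    [2 sin (PI z h)] and exchanges sines and cosines. *)
Lemma truncated_increment delta al be J K h y :
  truncated delta al be J K (y + h / 2) - truncated delta al be J K (y - h / 2) =
  trig (list_prod (seq 1 (2 ^ J - 1)) (seq 1 K)) (fun t => Z.of_nat (snd t) * sqZ (fst t))%Z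
    (fun t => 2 * decay delta (fst t) * sn (Z.of_nat (snd t) * sqZ (fst t)) (h / 2) * be (snd t))
    (fun t => - (2 * decay delta (fst t) * sn (Z.of_nat (snd t) * sqZ (fst t)) (h / 2) * al (snd t))) y.
Proof.
  unfold truncated, trig; rewrite <- lsum_minus, lsum_list_prod; apply lsum_ext; intros n _.
  cbn [fst snd].
  unfold psum, trig; rewrite <- Rmult_minus_distr_l, <- lsum_minus, <- lsum_scal.
  apply lsum_ext; intros k _.
  replace (INR n ^ 2) with (IZR (sqZ n)) by (unfold sqZ; rewrite mult_IZR, <- INR_IZR_INZ; ring).
  rewrite !cs_scale, !sn_scale; set (z := (Z.of_nat k * sqZ n)%Z).
  unfold Rminus at 2 3; rewrite !cs_plus, !sn_plus.
  rewrite cs_opp, sn_opp.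
  ring.
Qed.

(** The Cauchy--Schwarz inequality, linearised by a free parameter. *)
Lemma cauchy_schwarz_dual (f g : R -> R) r : cont f -> cont g ->
  2 * r * RInt (fun x => f x * g x) 0 1 - r ^ 2 * RInt (fun x => g x * g x) 0 1
  <= RInt (fun x => f x ^ 2) 0 1.
Proof.
  intros Hf Hg.
  assert (H : 0 <= RInt (fun x => (f x - r * g x) ^ 2) 0 1).
  { apply int_nonneg; [lra|auto with cont|intros; apply pow2_ge_0]. }
  assert (E : RInt (fun x => (f x - r * g x) ^ 2) 0 1 =
    RInt (fun x => f x ^ 2) 0 1 - 2 * r * RInt (fun x => f x * g x) 0 1
      + r ^ 2 * RInt (fun x => g x * g x) 0 1).
  { rewrite <- !int_scal, <- int_minus, <- int_plus by auto with cont.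
    apply int_ext; intros; ring. }
  simpl in H, E |- *. lra.
Qed.

(** The largest scale [Q] for which [4 Q^2 d], which bounds the frequencies
    [d q^2] with [Q <= q < 2Q], is at most half the grid size; these frequencies
    are then also at least a fixed fraction of it. *)
Lemma scale_choice d N : (0 < d)%nat -> (8 * d <= N)%nat ->
  exists Q, (0 < Q /\ 8 * d * (Q * Q) <= N /\ N < 32 * d * (Q * Q))%nat.
Proof.
  intros Hd HN; exists (Nat.sqrt (N / (8 * d))).
  set (y := (N / (8 * d))%nat). set (Q := Nat.sqrt y).
  destruct (Nat.sqrt_spec y) as [H1 H2]; [lia|]; fold Q in H1, H2.
  assert (Hy : (1 <= y)%nat) by (apply Nat.div_le_lower_bound; lia).
  assert (HQ : (0 < Q)%nat) by nia.
  assert (H3 : (8 * d * y <= N)%nat) by apply Nat.Div0.mul_div_le.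
  assert (H4 : (N < 8 * d * S y)%nat) by (apply Nat.mul_succ_div_gt; lia).
  repeat split; [exact HQ| |].
  - eapply Nat.le_trans; [|exact H3]. apply Nat.mul_le_mono_l; exact H1.
  - eapply Nat.lt_le_trans; [exact H4|].
    replace (32 * d * (Q * Q))%nat with (8 * d * (4 * (Q * Q)))%nat by ring.
    apply Nat.mul_le_mono_l. nia.
Qed.

(** Testing against the modes of frequency [d q^2], normalised so that each
    contributes with the same weight, makes the mean over [q] of the divisor
    sums appear. Cosine and sine coefficients are combined with the weights
    [s1] and [s2]: when these are the limits of the respective means, the
    combined mean tends to [s1^2 + s2^2]. The fraction [3/4] leaves room for
    the error terms. *)
Lemma increment_mean_square delta al be W d Q J K N s1 s2 :
  0 < delta <= 1 -> square_free d -> (0 < d)%nat -> (0 < Q)%nat ->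
  (8 * d * (Q * Q) <= N)%nat -> (N < 32 * d * (Q * Q))%nat ->
  (2 * N <= 2 ^ J)%nat -> (N <= K)%nat ->
  modes_bounded al be W ->
  let f k := s1 * al k + s2 * be k in
  let sig := s1 ^ 2 + s2 ^ 2 in
  3 / 4 * sig <= lsum (seq 1 (2 * Q)) (fun m => Rpower (INR m) delta * f (m * m * d)%nat) ->
  (Rabs s1 + Rabs s2) * W <= INR Q * sig / 4 ->
  sig / 32768 * (INR Q * Rpower (INR Q) (- (2 * (1 + delta)))) <=
  RInt (fun x => (truncated delta al be J K (x + / INR N) - truncated delta al be J K x) ^ 2) 0 1.
Proof.
  intros Hdel Hsf Hd HQ HQ1 HQ2 HJ HK HW f sig Hmean Herr.
  assert (HN : (0 < N)%nat) by nia.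
  assert (HN' : 0 < INR N) by (apply lt_0_INR; exact HN).
  set (h := / INR N).
  assert (Hsig : 0 <= sig) by (unfold sig; generalize (pow2_ge_0 s1) (pow2_ge_0 s2); lra).
  set (L := list_prod (seq 1 (2 ^ J - 1)) (seq 1 K)).
  set (fr := fun t : nat * nat => (Z.of_nat (snd t) * sqZ (fst t))%Z).
  set (A := fun t => 2 * decay delta (fst t) * sn (fr t) (h / 2) * be (snd t)).
  set (B := fun t => - (2 * decay delta (fst t) * sn (fr t) (h / 2) * al (snd t))).
  set (fq := fun q : nat => Z.of_nat (d * (q * q))).
  set (v := fun q => Rpower (INR q) (1 + delta) / (2 * sn (fq q) (h / 2))).
  set (V := 64 * Rpower (INR Q) (1 + delta)).
  assert (HV : 0 < V) by (apply Rmult_lt_0_compat; [lra | apply exp_pos]).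
  assert (HQ' : 0 < INR Q) by (apply lt_0_INR; exact HQ).
  assert (Hsn : forall q, In q (seq Q Q) -> / 32 <= sn (fq q) (h / 2)).
  { intros q Hq; apply in_seq in Hq.
    set (y := INR (d * (q * q)) * h).
    assert (Hy1 : / 32 <= y).
    { apply (Rmult_le_reg_l (32 * INR N)); [lra|].
      unfold y, h. replace (32 * INR N * / 32) with (INR N) by field.
      replace (32 * INR N * (INR (d * (q * q)) * / INR N)) with (32 * INR (d * (q * q))) by (field; lra).
      replace 32 with (INR 32) by (simpl; ring). rewrite <- mult_INR; apply le_INR.
      assert (Q * Q <= q * q)%nat by (apply Nat.mul_le_mono; lia). nia. }
    assert (Hy2 : y <= / 2).
    { apply (Rmult_le_reg_l (2 * INR N)); [lra|].
      unfold y, h. replace (2 * INR N * / 2) with (INR N) by field.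
      replace (2 * INR N * (INR (d * (q * q)) * / INR N)) with (2 * INR (d * (q * q))) by (field; lra).
      replace 2 with (INR 2) by (simpl; ring). rewrite <- mult_INR; apply le_INR.
      assert (q * q <= (2 * Q) * (2 * Q))%nat by (apply Nat.mul_le_mono; lia). nia. }
    unfold sn, fq; rewrite <- INR_IZR_INZ.
    replace (2 * PI * (INR (d * (q * q)) * (h / 2))) with (PI * y) by (unfold y; field).
    assert (HP := PI_bounds).
    apply Rle_trans with (PI * y / 2); [nra|]. apply sin_ge_half; nra. }
  assert (Hv : forall q, In q (seq Q Q) -> v q ^ 2 <= V ^ 2).
  { intros q Hq; assert (Hs := Hsn q Hq); apply in_seq in Hq.
    assert (Hv0 : 0 < Rpower (INR q) (1 + delta)) by apply exp_pos.
    apply pow_incr; split.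
    - unfold v; apply Rmult_le_pos; [lra | left; apply Rinv_0_lt_compat; lra].
    - assert (H2 : Rpower (INR q) (1 + delta) <= 4 * Rpower (INR Q) (1 + delta)).
      { apply Rle_trans with (Rpower (2 * INR Q) (1 + delta)).
        - apply Rle_Rpower_l; [lra|]. split; [apply lt_0_INR; lia|].
          rewrite <- (mult_INR 2); apply le_INR; lia.
        - rewrite <- Rpower_mult_distr by lra.
          apply Rmult_le_compat_r; [apply Rpower_nonneg|].
          replace 4 with (Rpower 2 2); [apply Rle_Rpower; lra|].
          replace 2 with (INR 2) at 2 by (simpl; ring). rewrite Rpower_pow by lra; ring. }
      unfold v, V. apply Rle_trans with (Rpower (INR q) (1 + delta) * 16).
      + apply Rmult_le_compat_l; [lra|].
        rewrite <- (Rinv_inv 16); apply Rinv_le_contravar; lra.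
      + lra. }
  set (H := truncated delta al be J K).
  set (D := fun x => trig L fr A B (x + h / 2)).
  set (Th := fun x => trig (seq Q Q) fq (fun q => v q * s2) (fun q => - (v q * s1)) (x + h / 2)).
  assert (HD : cont D) by (unfold D; auto with cont).
  assert (HTh : cont Th) by (unfold Th; auto with cont).
  rewrite (int_ext _ (fun x => D x ^ 2)).
  2:{ intros x; f_equal. unfold D, L, fr, A, B.
      rewrite <- truncated_increment.
      replace (x + h / 2 + h / 2) with (x + h) by field.
      replace (x + h / 2 - h / 2) with x by ring; reflexivity. }
  assert (Hfr : forall t, In t L -> (0 < fr t)%Z).
  { intros [n k] Ht; unfold L in Ht; rewrite in_prod_iff, !in_seq in Ht.
    unfold fr, sqZ; cbn [fst snd]; nia. }
  assert (Hfq : forall q, In q (seq Q Q) -> (0 < fq q)%Z).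
  { intros q Hq; apply in_seq in Hq; unfold fq; nia. }
  set (I := RInt (fun x => D x * Th x) 0 1).
  set (Z := RInt (fun x => Th x * Th x) 0 1).
  assert (HI : INR Q * sig / 4 <= I).
  { unfold I, D, Th; rewrite int_trig_trig by assumption.
    rewrite (lsum_ext L _ (fun t => lsum (seq Q Q) (fun q =>
      kron (fr t) (fq q) * (decay delta (fst t) * Rpower (INR q) (1 + delta) * f (snd t))))).
    2:{ intros t _; apply lsum_ext; intros q Hq.
        assert (Hs := Hsn q Hq).
        unfold A, B.
        transitivity (kron (fr t) (fq q) * sn (fr t) (h / 2) *
          (2 * decay delta (fst t) * v q * f (snd t))); [unfold f; ring|].
        rewrite (kron_subst (fr t) (fq q) (fun z => sn z (h / 2))).
        unfold v; field; lra. }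
    rewrite lsum_swap.
    rewrite (lsum_ext (seq Q Q) _ (fun q => lsum (seq 1 (2 ^ J - 1)) (fun n => lsum (seq 1 K) (fun k =>
      kron (Z.of_nat k * sqZ n) (Z.of_nat (d * (q * q))) *
      (decay delta n * Rpower (INR q) (1 + delta) * f k)))))
      by (intros q _; unfold L; rewrite lsum_list_prod; reflexivity).
    rewrite resonance_sum; [|assumption|assumption|assumption|nia|nia].
    assert (Hmn := resonance_main delta d ((Rabs s1 + Rabs s2) * W) Q f Hdel Hd HQ).
    assert (HWf : forall K, lsum (seq 1 K) (fun k => INR k * Rabs (f k)) <= (Rabs s1 + Rabs s2) * W).
    { intros K0; apply Rle_trans with ((Rabs s1 + Rabs s2) *
        lsum (seq 1 K0) (fun k => INR k * (Rabs (al k) + Rabs (be k)))).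
      - rewrite <- lsum_scal; apply lsum_le; intros k _.
        assert (Rabs (f k) <= (Rabs s1 + Rabs s2) * (Rabs (al k) + Rabs (be k))).
        { unfold f; eapply Rle_trans; [apply Rabs_triang|]; rewrite !Rabs_mult.
          generalize (Rabs_pos s1) (Rabs_pos s2) (Rabs_pos (al k)) (Rabs_pos (be k)); nra. }
        assert (0 <= INR k) by apply pos_INR.
        replace ((Rabs s1 + Rabs s2) * (INR k * (Rabs (al k) + Rabs (be k))))
          with (INR k * ((Rabs s1 + Rabs s2) * (Rabs (al k) + Rabs (be k)))) by ring.
        apply Rmult_le_compat_l; assumption.
      - apply Rmult_le_compat_l; [generalize (Rabs_pos s1) (Rabs_pos s2); lra | apply HW]. }
    specialize (Hmn HWf). apply Rabs_le_between in Hmn; destruct Hmn as [Hmn _].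
    assert (INR Q * (3 / 4 * sig) <=
      INR Q * lsum (seq 1 (2 * Q)) (fun m => Rpower (INR m) delta * f (m * m * d)%nat))
      by (apply Rmult_le_compat_l; lra).
    lra. }
  assert (HZ : Z <= INR Q * V ^ 2 * sig / 2).
  { unfold Z, Th; rewrite int_trig_trig by assumption.
    apply Rle_trans with (/ 2 * lsum (seq Q Q) (fun q => V ^ 2 * sig)).
    - apply Rmult_le_compat_l; [lra|].
      apply lsum_le; intros q Hq.
      rewrite (lsum_single (seq Q Q) q).
      + rewrite kron_diag. specialize (Hv q Hq).
        replace (1 * _) with (v q ^ 2 * sig) by (unfold sig; ring).
        apply Rmult_le_compat_r; assumption.
      + apply seq_NoDup.
      + exact Hq.
      + intros q' _ Hne; rewrite kron_neq; [ring|].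
        unfold fq; intros E; apply Hne. apply Nat2Z.inj in E.
        apply Nat.mul_cancel_l in E; nia.
    - rewrite lsum_const, length_seq; right; field. }
  (* This value of [r] maximises the difference of the two bounds. *)
  set (r := / (2 * V ^ 2)).
  assert (HV2 : 0 < V ^ 2) by (apply pow_lt; exact HV).
  assert (Hr : 0 < r) by (apply Rinv_0_lt_compat; lra).
  assert (HF := cauchy_schwarz_dual D Th r HD HTh). fold I Z in HF.
  eapply Rle_trans; [|exact HF].
  apply Rle_trans with (2 * r * (INR Q * sig / 4) - r ^ 2 * (INR Q * V ^ 2 * sig / 2)).
  - assert (EV : V ^ 2 * Rpower (INR Q) (- (2 * (1 + delta))) = 4096).
    { transitivity (4096 * (Rpower (INR Q) (1 + delta) * Rpower (INR Q) (1 + delta) *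
        Rpower (INR Q) (- (2 * (1 + delta))))); [unfold V; ring|].
      rewrite <- !Rpower_plus.
      replace (1 + delta + (1 + delta) + - (2 * (1 + delta))) with 0 by ring.
      rewrite Rpower_O by exact HQ'; ring. }
    replace (Rpower (INR Q) (- (2 * (1 + delta)))) with (4096 / V ^ 2)
      by (rewrite <- EV; field; lra).
    right; unfold r; field; lra.
  - assert (r * (INR Q * sig / 4) <= r * I) by (apply Rmult_le_compat_l; lra).
    assert (r ^ 2 * Z <= r ^ 2 * (INR Q * V ^ 2 * sig / 2))
      by (apply Rmult_le_compat_l; [apply pow2_ge_0 | exact HZ]).
    simpl in *; lra.
Qed.

(** Averaging over a translated grid: some translate does at least half as
    well as the integral. *)
Lemma good_translate (F : R -> R) N kap :
  cont F -> (0 < N)%nat -> 0 < kap -> 2 * kap <= INR N * RInt F 0 1 ->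
  exists t, 0 <= t <= 1 /\ kap <= lsum (seq 0 N) (fun i => F ((INR i + t) / INR N)).
Proof.
  intros HF HN Hk HI.
  assert (HN' : 0 < INR N) by (apply lt_0_INR; exact HN).
  apply NNPP; intros Hno.
  assert (Hall : forall t, 0 <= t <= 1 ->
    lsum (seq 0 N) (fun i => F ((INR i + t) / INR N)) <= kap).
  { intros t Ht; destruct (Rle_or_lt kap (lsum (seq 0 N) (fun i => F ((INR i + t) / INR N)))) as [H|H];
      [exfalso; apply Hno; exists t; auto | lra]. }
  assert (HFc : forall i : nat, cont (fun t => F ((INR i + t) / INR N)))
    by (intros i; apply (cont_comp F (fun t => (INR i + t) / INR N)); unfold Rdiv; auto with cont).
  assert (H1 : RInt (fun t => lsum (seq 0 N) (fun i => F ((INR i + t) / INR N))) 0 1 <= kap).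
  { apply Rle_trans with (RInt (fun _ : R => kap) 0 1).
    - apply int_le; [lra|apply cont_lsum; auto|auto with cont|exact Hall].
    - rewrite int_const; right; Rring. }
  rewrite int_lsum in H1 by auto.
  assert (E : lsum (seq 0 N) (fun i => RInt (fun t => F ((INR i + t) / INR N)) 0 1) = INR N * RInt F 0 1).
  { rewrite <- (int_cells F N HF HN), <- lsum_scal; apply lsum_ext; intros i _.
    assert (H := int_comp_lin F (/ INR N) (INR i / INR N) 0 1 HF).
    replace (/ INR N * 0 + INR i / INR N) with (INR i / INR N) in H by (field; lra).
    replace (/ INR N * 1 + INR i / INR N) with ((INR i + 1) / INR N) in H by (field; lra).
    rewrite <- H, <- Rmult_assoc, Rinv_r, Rmult_1_l by lra.
    apply int_ext; intros t; f_equal; field; lra. }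
  rewrite E in H1; lra.
Qed.

(** The scale [Q] is at most [sqrt N], and so [Q^(-1-2 delta)] is at least
    [N^(-1/2-delta)]; it tends to infinity with [N], which makes the error
    terms of the mean negligible. *)
Lemma truncated_lower delta al be W d (s1 s2 : R) :
  0 < delta <= 1 -> square_free d -> (0 < d)%nat ->
  modes_bounded al be W ->
  is_lim_seq (fun n => lsum (seq 1 n) (fun m => Rpower (INR m) delta * al (m * m * d)%nat)) s1 ->
  is_lim_seq (fun n => lsum (seq 1 n) (fun m => Rpower (INR m) delta * be (m * m * d)%nat)) s2 ->
  0 < s1 ^ 2 + s2 ^ 2 ->
  exists c N0, 0 < c /\ forall N J K, (N0 <= N)%nat -> (2 * N <= 2 ^ J)%nat -> (N <= K)%nat ->
    exists t, 0 <= t <= 1 /\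
      c * Rpower (INR N) (/ 2 - delta) <=
      lsum (seq 0 N) (fun i => (truncated delta al be J K ((INR i + 1 + t) / INR N) -
                                truncated delta al be J K ((INR i + t) / INR N)) ^ 2).
Proof.
  intros Hdel Hsf Hd HW L1 L2 Hsig.
  set (sig := s1 ^ 2 + s2 ^ 2) in *.
  assert (L : is_lim_seq (fun n => lsum (seq 1 n) (fun m =>
    Rpower (INR m) delta * (s1 * al (m * m * d)%nat + s2 * be (m * m * d)%nat))) sig).
  { apply (is_lim_seq_ext (fun n =>
      s1 * lsum (seq 1 n) (fun m => Rpower (INR m) delta * al (m * m * d)%nat) +
      s2 * lsum (seq 1 n) (fun m => Rpower (INR m) delta * be (m * m * d)%nat))).
    - intros n; rewrite <- !lsum_scal, <- lsum_plus; apply lsum_ext; intros; ring.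
    - replace sig with (s1 * s1 + s2 * s2) by (unfold sig; ring).
      apply is_lim_seq_plus'; [exact (is_lim_seq_scal_l _ s1 (Finite s1) L1) | exact (is_lim_seq_scal_l _ s2 (Finite s2) L2)]. }
  apply is_lim_seq_spec in L.
  destruct (L (mkposreal (sig / 4) ltac:(lra))) as [n0 Hn0]; simpl in Hn0.
  destruct (INR_unbounded ((Rabs s1 + Rabs s2) * W * 4 / sig)) as [q0 Hq0].
  set (Q0 := (n0 + q0)%nat).
  exists (sig / 65536), (32 * d * (Q0 * Q0) + 8 * d)%nat; split; [lra|].
  intros N J K HN HJ HK.
  destruct (scale_choice d N) as (Q & HQ & HQ1 & HQ2); [exact Hd|lia|].
  assert (HQ0 : (Q0 <= Q)%nat).
  { destruct (Nat.le_gt_cases Q0 Q) as [|Hlt]; [assumption|exfalso].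
    assert (Q * Q <= Q0 * Q0)%nat by (apply Nat.mul_le_mono; lia).
    assert (32 * d * (Q * Q) <= 32 * d * (Q0 * Q0))%nat by (apply Nat.mul_le_mono_l; assumption). lia. }
  assert (HN0 : (0 < N)%nat) by lia.
  assert (HN' : 0 < INR N) by (apply lt_0_INR; exact HN0).
  assert (HQ' : 0 < INR Q) by (apply lt_0_INR; exact HQ).
  set (H := truncated delta al be J K).
  set (F := fun x => (H (x + / INR N) - H x) ^ 2).
  assert (HF : cont F).
  { unfold F; apply cont_pow, cont_minus; [|apply cont_truncated].
    apply (cont_comp H (fun x => x + / INR N)); [apply cont_truncated | auto with cont]. }
  assert (HI := increment_mean_square delta al be W d Q J K N s1 s2 Hdel Hsf Hd HQ HQ1 HQ2 HJ HK HW).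
  cbv zeta in HI; fold sig in HI. fold H in HI. fold F in HI.
  assert (HI2 : sig / 32768 * (INR Q * Rpower (INR Q) (- (2 * (1 + delta)))) <= RInt F 0 1).
  { apply HI.
    - assert (Hb := Hn0 (2 * Q)%nat ltac:(unfold Q0 in HQ0; lia)).
      apply Rabs_def2 in Hb; lra.
    - apply Rmult_gt_compat_r with (r := sig) in Hq0; [|exact Hsig].
      unfold Rdiv in Hq0; rewrite (Rmult_assoc _ (/ sig)), Rinv_l, Rmult_1_r in Hq0 by lra.
      assert (INR q0 <= INR Q) by (apply le_INR; unfold Q0 in HQ0; lia).
      assert (INR q0 * sig <= INR Q * sig) by (apply Rmult_le_compat_r; lra). lra. }
  assert (HP : Rpower (INR N) (- (/ 2 + delta)) <= INR Q * Rpower (INR Q) (- (2 * (1 + delta)))).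
  { rewrite <- (Rpower_1 (INR Q)) at 1 by exact HQ'. rewrite <- Rpower_plus.
    replace (1 + - (2 * (1 + delta))) with (INR 2 * - (/ 2 + delta)) by (simpl; field).
    rewrite <- Rpower_mult, Rpower_pow by exact HQ'.
    apply Rpower_neg_anti; [apply pow_lt; exact HQ'| |lra].
    replace (INR Q ^ 2) with (INR (Q * Q)) by (rewrite mult_INR; ring).
    apply le_INR. nia. }
  destruct (good_translate F N (sig / 65536 * Rpower (INR N) (/ 2 - delta))) as [t [Ht Hsum]].
  - exact HF.
  - exact HN0.
  - apply Rmult_lt_0_compat; [lra | apply exp_pos].
  - replace (/ 2 - delta) with (1 + - (/ 2 + delta)) by field.
    rewrite Rpower_plus, Rpower_1 by exact HN'.
    assert (sig / 32768 * Rpower (INR N) (- (/ 2 + delta)) <= RInt F 0 1).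
    { eapply Rle_trans; [|exact HI2]. apply Rmult_le_compat_l; lra. }
    apply Rle_trans with (INR N * (sig / 32768 * Rpower (INR N) (- (/ 2 + delta)))); [right; field|].
    apply Rmult_le_compat_l; lra.
  - exists t; split; [exact Ht|].
    eapply Rle_trans; [exact Hsum|]; right; apply lsum_ext; intros i _; unfold F.
    do 3 f_equal; field; lra.
Qed.

(** * Approximation of the full series *)

Definition partial (delta : R) (g : R -> R) (n : nat) (x : R) : R :=
  lsum (seq 1 n) (fun k => decay delta k * g (INR k ^ 2 * x)).

(** Comparison with an integral, by the mean value theorem. *)
Lemma decay_telescope delta k : 0 < delta -> (0 < k)%nat ->
  decay delta (S k) <= / delta * (Rpower (INR k) (- delta) - Rpower (INR (S k)) (- delta)).
Proof.
  intros Hd Hk.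
  assert (Hk' : 0 < INR k) by (apply lt_0_INR; exact Hk).
  rewrite S_INR. set (b := INR k).
  destruct (MVT_gen (fun x => Rpower x (- delta)) b (b + 1) (fun x => - delta * Rpower x (- delta - 1)))
    as [c [Hc E]].
  - intros x Hx; rewrite Rmin_left, Rmax_right in Hx by lra.
    unfold Rpower; auto_derive; [unfold b in *; lra|].
    replace ((- delta - 1) * ln x) with (- delta * ln x + - ln x) by ring.
    rewrite exp_plus, exp_Ropp, exp_ln by (unfold b in *; lra). field. unfold b in *; lra.
  - intros x Hx; rewrite Rmin_left, Rmax_right in Hx by lra.
    apply continuity_pt_filterlim, (ex_derive_continuous (fun x => Rpower x (- delta))).
    unfold Rpower; auto_derive; unfold b in *; lra.
  - rewrite Rmin_left, Rmax_right in Hc by lra.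
    assert (H : Rpower (b + 1) (- (1 + delta)) <= Rpower c (- (1 + delta)))
      by (apply Rpower_neg_anti; unfold b in *; lra).
    unfold decay; rewrite S_INR; fold b. eapply Rle_trans; [exact H|].
    replace (- delta - 1) with (- (1 + delta)) in E by ring.
    apply (Rmult_le_reg_l delta); [exact Hd|].
    rewrite <- Rmult_assoc, Rinv_r, Rmult_1_l by lra. lra.
Qed.

Lemma decay_tail delta n m : 0 < delta -> (0 < n)%nat ->
  lsum (seq (S n) m) (decay delta) <= / delta * Rpower (INR n) (- delta).
Proof.
  intros Hd Hn.
  enough (lsum (seq (S n) m) (decay delta) <=
    / delta * (Rpower (INR n) (- delta) - Rpower (INR (n + m)) (- delta))).
  { assert (0 < / delta) by (apply Rinv_0_lt_compat; exact Hd).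
    assert (0 <= Rpower (INR (n + m)) (- delta)) by apply Rpower_nonneg.
    assert (0 <= / delta * Rpower (INR (n + m)) (- delta)) by (apply Rmult_le_pos; lra). lra. }
  induction m as [|m IH].
  - rewrite Nat.add_0_r; simpl; lra.
  - rewrite lsum_seq_S. replace (S n + m)%nat with (S (n + m)) by lia.
    assert (H := decay_telescope delta (n + m) Hd ltac:(lia)).
    replace (n + S m)%nat with (S (n + m)) by lia. lra.
Qed.

Lemma partial_tail delta g Mg n m x : 0 < delta -> (0 < n)%nat -> (n <= m)%nat ->
  (forall x, Rabs (g x) <= Mg) ->
  Rabs (partial delta g m x - partial delta g n x) <= Mg / delta * Rpower (INR n) (- delta).
Proof.
  intros Hd Hn Hm Hg. unfold partial.
  replace m with (n + (m - n))%nat by lia. rewrite seq_app, lsum_app.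
  set (T := lsum (seq (1 + n) (m - n)) _).
  replace (_ - _) with T by ring. unfold T.
  eapply Rle_trans; [apply lsum_Rabs|].
  apply Rle_trans with (lsum (seq (1 + n) (m - n)) (fun k => Mg * decay delta k)).
  - apply lsum_le; intros k _; rewrite Rabs_mult, (Rabs_pos_eq (decay _ _)), Rmult_comm
      by apply Rpower_nonneg.
    apply Rmult_le_compat_r; [apply Rpower_nonneg | apply Hg].
  - rewrite lsum_scal. unfold Rdiv; rewrite Rmult_assoc.
    apply Rmult_le_compat_l; [|apply decay_tail; assumption].
    eapply Rle_trans; [apply (Rabs_pos (g 0)) | apply Hg].
Qed.

Lemma Rpower_small delta eps : 0 < delta -> 0 < eps ->
  exists n, (0 < n)%nat /\ Rpower (INR n) (- delta) <= eps.
Proof.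
  intros Hd He.
  destruct (INR_unbounded (Rpower eps (- / delta))) as [n Hn].
  assert (H0 : 0 < Rpower eps (- / delta)) by apply exp_pos.
  exists n; split.
  - apply INR_lt; simpl; lra.
  - apply Rle_trans with (Rpower (Rpower eps (- / delta)) (- delta)).
    + apply Rpower_neg_anti; lra.
    + rewrite Rpower_mult. replace (- / delta * - delta) with 1 by (field; lra).
      rewrite Rpower_1 by exact He; lra.
Qed.

Lemma tail_small delta Mg eps : 0 < delta -> 0 <= Mg -> 0 < eps ->
  exists n, (0 < n)%nat /\ Mg / delta * Rpower (INR n) (- delta) <= eps.
Proof.
  intros Hd HM He.
  destruct (Rpower_small delta (eps * delta / (Mg + 1))) as [n [Hn Hs]]; [exact Hd| |].
  { apply Rdiv_lt_0_compat; nra. }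
  exists n; split; [exact Hn|].
  apply Rle_trans with (Mg / delta * (eps * delta / (Mg + 1))).
  - apply Rmult_le_compat_l; [|exact Hs].
    apply Rmult_le_pos; [exact HM | left; apply Rinv_0_lt_compat; exact Hd].
  - apply (Rmult_le_reg_r (Mg + 1)); [lra|].
    replace (Mg / delta * (eps * delta / (Mg + 1)) * (Mg + 1)) with (eps * Mg) by (field; lra). nra.
Qed.

Definition Gterm (delta : R) (g : R -> R) (x : R) (n : nat) : R :=
  g (INR (S n) ^ 2 * x) / Rpower (INR (S n)) (1 + delta).

Lemma sum_Gterm delta g x n : sum_n (Gterm delta g x) n = partial delta g (S n) x.
Proof.
  induction n as [|n IH].
  - rewrite sum_O; unfold partial, Gterm, decay; simpl seq; cbn [lsum fold_right].
    rewrite Rpower_Ropp; inR; unfold Rdiv; ring.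
  - rewrite sum_Sn, IH; unfold partial; rewrite (lsum_seq1_S (S n)).
    unfold Gterm at 1, decay at 3; rewrite Rpower_Ropp; unfold plus; simpl AbelianMonoid.plus.
    unfold Rdiv; inR; rewrite (Rmult_comm (g _)); reflexivity.
Qed.

Lemma G_tail delta g Mg n x : 0 < delta -> (0 < n)%nat ->
  (forall x, Rabs (g x) <= Mg) ->
  Rabs (G delta g x - partial delta g n x) <= Mg / delta * Rpower (INR n) (- delta).
Proof.
  intros Hd Hn Hg.
  assert (HMg : 0 <= Mg) by (eapply Rle_trans; [apply (Rabs_pos (g 0)) | apply Hg]).
  assert (Hex : ex_series (Gterm delta g x)).
  { enough (Hc : ex_finite_lim_seq (sum_n (Gterm delta g x))) by exact Hc.
    apply ex_lim_seq_cauchy_corr; intros [eps He].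
    destruct (tail_small delta Mg (eps / 4)) as [k [Hk Hb]]; [exact Hd|exact HMg|lra|].
    exists k; intros n1 n2 H1 H2; rewrite !sum_Gterm.
    assert (B1 := partial_tail delta g Mg k (S n1) x Hd Hk ltac:(lia) Hg).
    assert (B2 := partial_tail delta g Mg k (S n2) x Hd Hk ltac:(lia) Hg).
    apply Rabs_le_between in B1; apply Rabs_le_between in B2.
    simpl; apply Rabs_def1; lra. }
  apply Series_correct in Hex.
  change (Series (Gterm delta g x)) with (G delta g x) in Hex.
  assert (HL : is_lim_seq (sum_n (Gterm delta g x)) (G delta g x)) by exact Hex.
  apply is_lim_seq_spec in HL.
  apply le_epsilon; intros eps He.
  destruct (HL (mkposreal eps He)) as [m Hm]; simpl in Hm.
  specialize (Hm (m + n)%nat ltac:(lia)); rewrite sum_Gterm in Hm.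
  assert (B := partial_tail delta g Mg n (S (m + n)) x Hd Hn ltac:(lia) Hg).
  apply Rabs_def2 in Hm; apply Rabs_le_between in B. apply Rabs_le; lra.
Qed.

Lemma cont_G delta g Mg : 0 < delta -> cont g -> (forall x, Rabs (g x) <= Mg) -> cont (G delta g).
Proof.
  intros Hd Hc Hg x.
  assert (HMg : 0 <= Mg) by (eapply Rle_trans; [apply (Rabs_pos (g 0)) | apply Hg]).
  apply filterlim_locally; intros eps.
  assert (He := cond_pos eps).
  destruct (tail_small delta Mg (eps / 4)) as [n [Hn Hb]]; [exact Hd|exact HMg|lra|].
  assert (Hp : continuous (partial delta g n) x).
  { revert x; apply (cont_lsum _ (fun k x => decay delta k * g (INR k ^ 2 * x))); intros k _.
    apply cont_mult; [auto with cont|].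
    apply (cont_comp g (fun x => INR k ^ 2 * x)); auto with cont. }
  assert (He4 : 0 < eps / 4) by lra.
  assert (Hl := proj1 (filterlim_locally _ _) Hp (mkposreal _ He4)).
  revert Hl; apply filter_imp; intros y Hy.
  change (Rabs (partial delta g n y - partial delta g n x) < eps / 4) in Hy.
  change (Rabs (G delta g y - G delta g x) < eps).
  assert (B1 := G_tail delta g Mg n x Hd Hn Hg). assert (B2 := G_tail delta g Mg n y Hd Hn Hg).
  apply Rabs_le_between in B1; apply Rabs_le_between in B2; apply Rabs_def2 in Hy.
  apply Rabs_def1; lra.
Qed.

(** What the estimates require of the cosine and sine coefficients [al] and
    [be] of [g], whose mean is [a0]. *)
Definition profile (g : R -> R) (a0 W : R) (al be : nat -> R) : Prop :=
  0 < W /\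
  modes_bounded al be W /\
  (forall K x, Rabs (g x - (a0 + psum al be K x)) <= W / INR (S K)).

Lemma profile_bounded g a0 W al be : profile g a0 W al be -> forall x, Rabs (g x) <= Rabs a0 + W.
Proof.
  intros (_ & _ & Happ) x; specialize (Happ 0%nat x); unfold psum, trig in Happ; simpl in Happ.
  rewrite Rplus_0_r, Rdiv_1_r in Happ.
  replace (g x) with (a0 + (g x - a0)) by ring.
  eapply Rle_trans; [apply Rabs_triang|]; lra.
Qed.

(** Logarithmically many blocks approximate [G] to the accuracy [1/N] of the
    grid, since the tail of the series decays like a power. *)
Lemma G_approx delta g (a0 W : R) al be :
  0 < delta <= 1 -> profile g a0 W al be ->
  exists C, 0 < C /\ forall N, (0 < N)%nat ->
    exists J cst, INR J + 3 <= C * (1 + ln (INR N)) /\ (2 * N <= 2 ^ J)%nat /\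
      exists K0, forall K, (K0 <= K)%nat -> forall x,
        Rabs (G delta g x - (cst + truncated delta al be J K x)) <= / INR N.
Proof.
  intros Hdel Hprof; destruct (Hprof) as (HW & _ & Happ).
  set (Mg := Rabs a0 + W + 1).
  assert (HMg : 1 <= Mg) by (unfold Mg; generalize (Rabs_pos a0); lra).
  assert (Hg : forall x, Rabs (g x) <= Mg).
  { intros x; generalize (profile_bounded g a0 W al be Hprof x); unfold Mg; lra. }
  assert (Hln2 : 0 < ln 2) by (rewrite <- ln_1; apply ln_increasing; lra).
  set (D := / (delta * ln 2)).
  assert (HD : 0 < D) by (apply Rinv_0_lt_compat, Rmult_lt_0_compat; lra).
  assert (HE2 : 1 <= 2 * Mg / delta).
  { apply (Rmult_le_reg_r delta); [lra|]. unfold Rdiv; rewrite Rmult_assoc, Rinv_l by lra. lra. }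
  set (E := ln (2 * Mg / delta)).
  assert (HE : 0 <= E) by (unfold E; rewrite <- ln_1; apply ln_le; lra).
  exists (E * D + D + 5); split; [nra|].
  intros N HN.
  assert (HN1 : 1 <= INR N) by (apply (le_INR 1); exact HN).
  assert (HlnN : 0 <= ln (INR N)) by (rewrite <- ln_1; apply ln_le; lra).
  set (X := 2 * Mg / delta * INR N).
  assert (HX : 2 * INR N <= X).
  { unfold X; apply Rmult_le_compat_r; [lra|].
    apply (Rmult_le_reg_r delta); [lra|]. unfold Rdiv; rewrite Rmult_assoc, Rinv_l by lra. nra. }
  assert (HlnX : ln X = E + ln (INR N)) by (unfold X, E; apply ln_mult; lra).
  destruct (nfloor_ex (ln X * D)) as [j0 [Hj1 Hj2]]; [rewrite HlnX; apply Rmult_le_pos; lra|].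
  set (J' := S j0).
  assert (HJ1 : ln X * D <= INR J') by (unfold J'; rewrite S_INR; lra).
  assert (HJ2 : INR J' <= ln X * D + 1) by (unfold J'; rewrite S_INR; lra).
  assert (HJln : ln X <= delta * (INR J' * ln 2)).
  { apply (Rmult_le_reg_r D); [exact HD|]. eapply Rle_trans; [exact HJ1|].
    right; unfold D; field; split; lra. }
  assert (Hpow : Rpower (INR (2 ^ J')) delta = exp (delta * (INR J' * ln 2))).
  { unfold Rpower; rewrite pow_INR, ln_pow by (simpl; lra). simpl (INR 2).
    replace (1 + 1) with 2 by ring. reflexivity. }
  assert (HXexp : X = exp (ln X)) by (symmetry; apply exp_ln; lra).
  assert (HXP : X <= Rpower (INR (2 ^ J')) delta).
  { rewrite Hpow, HXexp at 1. destruct HJln as [Hl|Hl]; [left; apply exp_increasing; exact Hl | rewrite Hl; right; reflexivity]. }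
  assert (H2J : 2 * INR N <= INR (2 ^ J')).
  { apply Rle_trans with X; [exact HX|]. eapply Rle_trans; [exact HXP|].
    rewrite <- (Rpower_1 (INR (2 ^ J'))) at 2 by (apply lt_0_INR, pow2_pos).
    apply Rle_Rpower; [|lra]. apply (le_INR 1), pow2_pos. }
  set (n := (2 ^ S J' - 1)%nat).
  assert (Hn : (2 ^ J' <= n)%nat) by (unfold n; generalize (pow2_pos J'); simpl; lia).
  exists (S J'), (lsum (seq 1 n) (fun k => decay delta k * a0)).
  split; [|split].
  - rewrite HlnX in HJ2; rewrite S_INR.
    assert (0 <= E * D * ln (INR N)) by (repeat apply Rmult_le_pos; lra).
    assert (0 <= D * ln (INR N)) by (apply Rmult_le_pos; lra). lra.
  - apply INR_le; rewrite mult_INR; simpl (INR 2). replace (1 + 1) with 2 by ring.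
    eapply Rle_trans; [exact H2J|]. apply le_INR; simpl; lia.
  - destruct (INR_unbounded (2 * INR N * INR n * W)) as [K0 HK0].
    exists K0; intros K HK x.
    assert (HK' : 0 < INR (S K)) by (apply lt_0_INR; lia).
    assert (Hn0 : (0 < n)%nat) by (generalize (pow2_pos J'); lia).
    assert (T1 : Rabs (G delta g x - partial delta g n x) <= / (2 * INR N)).
    { eapply Rle_trans; [apply (G_tail delta g Mg); [lra|exact Hn0|exact Hg]|].
      apply Rle_trans with (Mg / delta * / X).
      - apply Rmult_le_compat_l.
        + apply Rmult_le_pos; [lra | left; apply Rinv_0_lt_compat; lra].
        + rewrite Rpower_Ropp; apply Rinv_le_contravar; [lra|].
          eapply Rle_trans; [exact HXP|]. apply Rle_Rpower_l; [lra|].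
          split; [apply lt_0_INR, pow2_pos | apply le_INR; exact Hn].
      - right; unfold X; field; repeat split; lra. }
    assert (T2 : Rabs (partial delta g n x -
        (lsum (seq 1 n) (fun k => decay delta k * a0) + truncated delta al be (S J') K x)) <= / (2 * INR N)).
    { unfold partial, truncated; fold n; rewrite <- lsum_plus, <- lsum_minus.
      eapply Rle_trans; [apply lsum_Rabs|].
      apply Rle_trans with (lsum (seq 1 n) (fun _ => W / INR (S K))).
      - apply lsum_le; intros k Hk; apply in_seq in Hk.
        rewrite <- Rmult_plus_distr_l, <- Rmult_minus_distr_l, Rabs_mult,
          (Rabs_pos_eq (decay _ _)) by apply Rpower_nonneg.
        rewrite <- (Rmult_1_l (W / _)).
        apply Rmult_le_compat; [apply Rpower_nonneg|apply Rabs_pos| |apply Happ].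
        apply Rle_trans with (Rpower (INR k) 0); [|rewrite Rpower_O; [lra|apply lt_0_INR; lia]].
        apply Rle_Rpower; [apply (le_INR 1); lia | lra].
      - rewrite lsum_const, length_seq.
        assert (HKK : 2 * INR N * INR n * W <= INR (S K)).
        { apply Rle_trans with (INR K0); [lra|]. apply le_INR; lia. }
        apply (Rmult_le_reg_l (2 * INR N * INR (S K))); [nra|].
        replace (2 * INR N * INR (S K) * (INR n * (W / INR (S K)))) with (2 * INR N * INR n * W) by (field; lra).
        replace (2 * INR N * INR (S K) * / (2 * INR N)) with (INR (S K)) by (field; lra).
        exact HKK. }
    set (Y := lsum (seq 1 n) (fun k => decay delta k * a0) + truncated delta al be (S J') K x) in *.
    replace (G delta g x - Y) with ((G delta g x - partial delta g n x) + (partial delta g n x - Y)) by ring.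
    eapply Rle_trans; [apply Rabs_triang|].
    replace (/ INR N) with (/ (2 * INR N) + / (2 * INR N)) by (field; lra). lra.
Qed.

(** * Oscillation of the full series *)

Definition logf (N : nat) : R := 1 + ln (INR N).

Lemma logf_ge_1 N : (0 < N)%nat -> 1 <= logf N.
Proof.
  intros HN; unfold logf. assert (1 <= INR N) by (apply (le_INR 1); exact HN).
  assert (ln 1 <= ln (INR N)) by (apply ln_le; lra). rewrite ln_1 in *; lra.
Qed.

(** Any power of the logarithm is absorbed by a small power of [N]. *)
Lemma logf_le_root k N : (0 < k)%nat -> (0 < N)%nat ->
  logf N <= INR k * Rpower (INR N) (/ INR k).
Proof.
  intros Hk HN; unfold logf.
  assert (Hk' : 0 < INR k) by (apply lt_0_INR; exact Hk).
  assert (HN' : 0 < INR N) by (apply lt_0_INR; exact HN).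
  assert (Hk1 : 1 <= INR k) by (apply (le_INR 1); exact Hk).
  assert (H := exp_ineq1_le (/ INR k * ln (INR N))).
  fold (Rpower (INR N) (/ INR k)) in H.
  apply (Rmult_le_compat_l (INR k)) in H; [|lra].
  replace (INR k * (1 + / INR k * ln (INR N))) with (INR k + ln (INR N)) in H by (field; lra).
  lra.
Qed.

Lemma truncated_osc4_log al be delta W C :
  0 < delta <= 1 -> 0 < W ->
  modes_bounded al be W -> 0 < C ->
  exists C5, 0 < C5 /\ forall J K N (x y : nat -> R), (0 < N)%nat -> INR J + 3 <= C * logf N ->
    cell_points N x -> cell_points N y ->
    lsum (seq 0 N) (fun i => (truncated delta al be J K (x i) - truncated delta al be J K (y i)) ^ 4)
    <= C5 * logf N ^ 5 * Rpower (INR N) (- (2 * delta)).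
Proof.
  intros Hdel HW0 HW HC; exists (cell_const * W ^ 4 * C ^ 5); split.
  { unfold cell_const; repeat apply Rmult_lt_0_compat; lra. }
  intros J K N x y HN HJ Hx Hy.
  eapply Rle_trans; [apply (truncated_osc4 al be delta W); assumption|].
  apply Rmult_le_compat_r; [apply Rpower_nonneg|].
  replace (cell_const * W ^ 4 * C ^ 5 * logf N ^ 5) with (cell_const * W ^ 4 * (C * logf N) ^ 5) by ring.
  apply Rmult_le_compat_l.
  - unfold cell_const; repeat apply Rmult_le_pos; lra.
  - apply pow_incr; split; [generalize (pos_INR J); lra | exact HJ].
Qed.

Lemma osc_transfer (f h : R -> R) cst eta N (x y : nat -> R) :
  (forall z, Rabs (f z - (cst + h z)) <= eta) ->
  forall i, (i < N)%nat -> Rabs ((f (x i) - f (y i)) - (h (x i) - h (y i))) <= 2 * eta.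
Proof.
  intros H i _. assert (H1 := H (x i)); assert (H2 := H (y i)).
  apply Rabs_le_between in H1; apply Rabs_le_between in H2; apply Rabs_le; lra.
Qed.

Lemma osc_upper delta g a0 W al be :
  0 < delta <= 1 -> profile g a0 W al be ->
  exists C, 0 < C /\ forall N (x y : nat -> R), (0 < N)%nat ->
    cell_points N x -> cell_points N y ->
    lsum (seq 0 N) (fun i => (G delta g (x i) - G delta g (y i)) ^ 4)
    <= C * logf N ^ 5 * Rpower (INR N) (- (2 * delta)).
Proof.
  intros Hdel Hprof; assert (HW0 := proj1 Hprof); assert (HW := proj1 (proj2 Hprof)).
  destruct (G_approx delta g a0 W al be Hdel Hprof) as (C & HC & HA).
  destruct (truncated_osc4_log al be delta W C Hdel HW0 HW HC) as (C5 & HC5 & HO).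
  exists (8 * C5 + 128); split; [lra|].
  intros N x y HN Hx Hy.
  destruct (HA N HN) as (J & cst & HJ & _ & K0 & HK).
  specialize (HK K0 (Nat.le_refl _)). set (h := truncated delta al be J K0) in *.
  assert (HN1 : 1 <= INR N) by (apply (le_INR 1); exact HN).
  assert (HL := logf_ge_1 N HN). fold (logf N) in HJ.
  set (P := Rpower (INR N) (- (2 * delta))).
  assert (HP : 0 < P) by apply exp_pos.
  assert (HT : lsum (seq 0 N) (fun i => (h (x i) - h (y i)) ^ 4) <= C5 * logf N ^ 5 * P)
    by (apply HO; assumption).
  apply Rle_trans with (lsum (seq 0 N) (fun i => 8 * (h (x i) - h (y i)) ^ 4 + 128 * (/ INR N) ^ 4)).
  - apply lsum_le; intros i Hi; apply in_seq in Hi.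
    assert (Ht := osc_transfer (G delta g) h cst (/ INR N) N x y HK i ltac:(lia)).
    set (u := h (x i) - h (y i)) in *. set (w := G delta g (x i) - G delta g (y i)) in *.
    assert (H4 : (w - u) ^ 4 <= (2 * / INR N) ^ 4).
    { rewrite <- pow4_abs.
      apply pow_incr; split; [apply Rabs_pos | exact Ht]. }
    replace w with (u + (w - u)) by ring.
    eapply Rle_trans; [apply pow4_add|].
    replace (128 * (/ INR N) ^ 4) with (8 * (2 * / INR N) ^ 4) by ring. lra.
  - rewrite lsum_plus, lsum_scal, lsum_const, length_seq.
    assert (Hsmall : INR N * (128 * (/ INR N) ^ 4) <= 128 * P).
    { replace (INR N * (128 * (/ INR N) ^ 4)) with (128 * / INR N ^ 3) by (field; lra).
      apply Rmult_le_compat_l; [lra|].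
      unfold P; rewrite Rpower_Ropp, <- Rpower_pow by lra.
      apply Rinv_le_contravar; [apply exp_pos|]. apply Rle_Rpower; simpl; lra. }
    assert (1 <= logf N ^ 5) by (apply pow_R1_Rle; exact HL).
    assert (P <= logf N ^ 5 * P) by nra.
    lra.
Qed.

Lemma periodic_grid (h : R -> R) N t : periodic1 h -> (0 < N)%nat ->
  h ((INR N + t) / INR N) = h (t / INR N).
Proof.
  intros Hp HN. assert (0 < INR N) by (apply lt_0_INR; exact HN).
  rewrite <- (Hp (t / INR N)); f_equal; field; lra.
Qed.

(** The points of a translated grid straddle the cell boundaries; passing
    through those boundaries yields increments inside the cells, which are at
    least a quarter as large in mean square. *)
Lemma increments_in_cells (h : R -> R) N t P :
  periodic1 h -> (0 < N)%nat -> 0 <= t <= 1 ->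
  P <= lsum (seq 0 N) (fun i => (h ((INR i + 1 + t) / INR N) - h ((INR i + t) / INR N)) ^ 2) ->
  exists x y : nat -> R,
    cell_points N x /\ cell_points N y /\
    P / 4 <= lsum (seq 0 N) (fun i => (h (x i) - h (y i)) ^ 2).
Proof.
  intros Hp HN Ht HP.
  assert (HN' : 0 < INR N) by (apply lt_0_INR; exact HN).
  set (u := fun i => (h ((INR i + t) / INR N) - h (INR i / INR N)) ^ 2).
  set (v := fun i => (h ((INR i + t) / INR N) - h ((INR i + 1) / INR N)) ^ 2).
  assert (Hsum : P <= 2 * (lsum (seq 0 N) u + lsum (seq 0 N) v)).
  { assert (Hshift : lsum (seq 0 N) (fun i => u (S i)) = lsum (seq 0 N) u).
    { rewrite <- (lsum_map S), seq_shift.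
      assert (E : lsum (seq 0 (S N)) u = u 0%nat + lsum (seq 1 N) u) by reflexivity.
      rewrite lsum_seq_S in E. simpl (0 + N)%nat in E.
      assert (Eu : u N = u 0%nat).
      { unfold u. rewrite periodic_grid by assumption.
        replace (INR N / INR N) with ((INR N + 0) / INR N) by (field; lra).
        rewrite periodic_grid by assumption. simpl (INR 0); rewrite Rplus_0_l; reflexivity. }
      rewrite Eu in E. lra. }
    rewrite <- Hshift, <- lsum_plus, <- lsum_scal.
    eapply Rle_trans; [exact HP|]; apply lsum_le; intros i _.
    unfold u, v; rewrite S_INR.
    set (a := h ((INR i + 1 + t) / INR N)); set (b := h ((INR i + t) / INR N));
      set (c := h ((INR i + 1) / INR N)).
    generalize (pow2_ge_0 ((a - c) + (b - c))). nra. }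
  assert (Hc : forall i s, 0 <= s <= 1 -> in_cell N i ((INR i + s) / INR N)).
  { intros i s Hs; unfold in_cell, Rdiv; assert (0 < / INR N) by (apply Rinv_0_lt_compat; exact HN').
    split; apply Rmult_le_compat_r; lra. }
  destruct (Rle_or_lt (P / 4) (lsum (seq 0 N) u)) as [Hu|Hu].
  - exists (fun i => (INR i + t) / INR N), (fun i => INR i / INR N); repeat split; try (apply Hc; exact Ht).
    + lra.
    + unfold Rdiv; apply Rmult_le_compat_r; [left; apply Rinv_0_lt_compat; exact HN' | lra].
    + exact Hu.
  - exists (fun i => (INR i + t) / INR N), (fun i => (INR i + 1) / INR N); split; [|split].
    + intros i _; apply Hc; exact Ht.
    + intros i _; apply (Hc i 1); lra.
    + fold v. lra.
Qed.

(** Interpolation: increments below the threshold [s] contribute to the second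
    moment at most [s] times the first moment, and those above it at most
    [s^(-2)] times the fourth moment, which is too small to account for the
    second moment. *)
Lemma osc_lower delta g a0 W al be d (s1 s2 : R) :
  0 < delta <= 1 -> profile g a0 W al be -> square_free d -> (0 < d)%nat ->
  is_lim_seq (fun n => lsum (seq 1 n) (fun m => Rpower (INR m) delta * al (m * m * d)%nat)) s1 ->
  is_lim_seq (fun n => lsum (seq 1 n) (fun m => Rpower (INR m) delta * be (m * m * d)%nat)) s2 ->
  0 < s1 ^ 2 + s2 ^ 2 ->
  exists c N0, 0 < c /\ forall N, (N0 <= N)%nat -> exists x y : nat -> R,
    cell_points N x /\ cell_points N y /\
    c / logf N ^ 3 * Rpower (INR N) (3 / 4 - delta / 2)
    <= lsum (seq 0 N) (fun i => Rabs (G delta g (x i) - G delta g (y i))).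
Proof.
  intros Hdel Hprof Hsf Hd L1 L2 Hsig.
  assert (HW0 := proj1 Hprof); assert (HW := proj1 (proj2 Hprof)).
  destruct (G_approx delta g a0 W al be Hdel Hprof) as (C & HC & HA).
  destruct (truncated_osc4_log al be delta W C Hdel HW0 HW HC) as (C5 & HC5 & HO).
  destruct (truncated_lower delta al be W d s1 s2 Hdel Hsf Hd HW L1 L2 Hsig) as (c & N0 & Hc & HLow).
  set (B := 8 * C5 / c + 1).
  assert (HB : 1 < B) by (unfold B; assert (0 < 8 * C5 / c) by (apply Rdiv_lt_0_compat; lra); lra).
  set (c1 := c / (8 * B)).
  assert (Hc1 : 0 < c1) by (apply Rdiv_lt_0_compat; lra).
  destruct (INR_unbounded (Rpower (4 * 16 ^ 3 / c1) 16)) as [N1 HN1].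
  exists (c1 / 2), (S (N0 + N1)); split; [lra|].
  intros N HN.
  assert (HNpos : (0 < N)%nat) by lia.
  assert (HN' : 0 < INR N) by (apply lt_0_INR; exact HNpos).
  destruct (HA N HNpos) as (J & cst & HJ & HJ2 & K0 & HK).
  set (K := (K0 + N)%nat). specialize (HK K ltac:(lia)).
  destruct (HLow N J K ltac:(lia) HJ2 ltac:(lia)) as (t & Ht & Hsum).
  set (h := truncated delta al be J K) in *.
  assert (Hh : periodic1 h) by apply periodic_truncated.
  destruct (increments_in_cells h N t _ Hh HNpos Ht Hsum) as (x & y & Hx & Hy & Hxy).
  exists x, y; split; [exact Hx|split; [exact Hy|]].
  assert (HL := logf_ge_1 N HNpos). fold (logf N) in HJ.
  set (L := logf N) in *.
  set (P := Rpower (INR N) (- (/ 4 + delta / 2))).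
  assert (HP : 0 < P) by apply exp_pos.
  set (R2 := Rpower (INR N) (/ 2 - delta)) in *.
  assert (HR2 : 0 < R2) by apply exp_pos.
  assert (E1 : Rpower (INR N) (- (2 * delta)) = R2 * P ^ 2).
  { unfold R2, P; replace (Rpower (INR N) (- (/ 4 + delta / 2)) ^ 2)
      with (Rpower (INR N) (- (/ 4 + delta / 2)) * Rpower (INR N) (- (/ 4 + delta / 2))) by ring.
    rewrite <- !Rpower_plus; f_equal; field. }
  assert (E2 : Rpower (INR N) (3 / 4 - delta / 2) * P = R2).
  { unfold R2, P; rewrite <- Rpower_plus; f_equal; field. }
  set (Q := Rpower (INR N) (3 / 4 - delta / 2)) in *.
  assert (HQ : 0 < Q) by apply exp_pos.
  assert (HT : lsum (seq 0 N) (fun i => (h (x i) - h (y i)) ^ 4) <= C5 * L ^ 5 * (R2 * P ^ 2))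
    by (rewrite <- E1; apply HO; assumption).
  (* The typical increment, up to the logarithms lost in the fourth moment. *)
  set (s := B * L ^ 3 * P).
  assert (HL3 : 1 <= L ^ 3) by (apply pow_R1_Rle; exact HL).
  assert (Hs : 0 < s) by (unfold s; repeat apply Rmult_lt_0_compat; lra).
  assert (Hinterp : lsum (seq 0 N) (fun i => (h (x i) - h (y i)) ^ 2) <=
    s * lsum (seq 0 N) (fun i => Rabs (h (x i) - h (y i))) +
    / s ^ 2 * lsum (seq 0 N) (fun i => (h (x i) - h (y i)) ^ 4)).
  { rewrite <- !lsum_scal, <- lsum_plus; apply lsum_le; intros i _.
    set (z := h (x i) - h (y i)).
    rewrite <- (pow2_abs z), <- (pow4_abs z).
    assert (Hz := Rabs_pos z). set (a := Rabs z) in *.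
    assert (Hs2 : 0 < / s ^ 2) by (apply Rinv_0_lt_compat, pow_lt; exact Hs).
    assert (0 <= a ^ 4) by (apply pow_le; exact Hz).
    destruct (Rle_or_lt a s) as [Has|Has].
    - assert (0 <= / s ^ 2 * a ^ 4) by (apply Rmult_le_pos; lra). nra.
    - assert (a ^ 2 <= / s ^ 2 * a ^ 4); [|nra].
      apply (Rmult_le_reg_l (s ^ 2)); [apply pow_lt; exact Hs|].
      rewrite <- Rmult_assoc, Rinv_r, Rmult_1_l by (apply pow_nonzero; lra).
      replace (a ^ 4) with (a ^ 2 * a ^ 2) by ring. apply Rmult_le_compat_r; [apply pow2_ge_0|].
      apply pow_incr; lra. }
  assert (Hexc : / s ^ 2 * lsum (seq 0 N) (fun i => (h (x i) - h (y i)) ^ 4) <= c / 8 * R2).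
  { apply (Rmult_le_reg_l (s ^ 2)); [apply pow_lt; exact Hs|].
    rewrite <- Rmult_assoc, Rinv_r, Rmult_1_l by (apply pow_nonzero; lra).
    eapply Rle_trans; [exact HT|].
    replace (s ^ 2 * (c / 8 * R2)) with (c * B / 8 * B * L ^ 6 * (R2 * P ^ 2)) by (unfold s; field).
    apply Rmult_le_compat_r; [apply Rmult_le_pos; [lra | apply pow2_ge_0]|].
    assert (H1 : C5 <= c * B / 8).
    { replace (c * B / 8) with (C5 + c / 8) by (unfold B; field; lra). lra. }
    assert (H5 : 0 <= L ^ 5) by (apply pow_le; lra).
    assert (H6 : L ^ 5 <= L ^ 6) by (replace (L ^ 6) with (L * L ^ 5) by ring; nra).
    apply Rmult_le_compat; [lra|exact H5| |exact H6].
    apply Rle_trans with (c * B / 8 * 1); [lra|]. apply Rmult_le_compat_l; lra. }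
  assert (Hh1 : 2 * (c1 / 2 / L ^ 3 * Q) <= lsum (seq 0 N) (fun i => Rabs (h (x i) - h (y i)))).
  { apply (Rmult_le_reg_l s); [exact Hs|].
    replace (s * (2 * (c1 / 2 / L ^ 3 * Q))) with (c / 8 * R2)
      by (rewrite <- E2; unfold s, c1; field; split; lra).
    lra. }
  assert (Hdiff : lsum (seq 0 N) (fun i => Rabs (h (x i) - h (y i))) - 2 <=
    lsum (seq 0 N) (fun i => Rabs (G delta g (x i) - G delta g (y i)))).
  { replace 2 with (lsum (seq 0 N) (fun _ => 2 * / INR N))
      by (rewrite lsum_const, length_seq; field; lra).
    rewrite <- lsum_minus; apply lsum_le; intros i Hi; apply in_seq in Hi.
    assert (Htr := osc_transfer (G delta g) h cst (/ INR N) N x y HK i ltac:(lia)).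
    set (a := h (x i) - h (y i)) in *. set (b := G delta g (x i) - G delta g (y i)) in *.
    assert (Rabs a <= Rabs b + Rabs (b - a)).
    { replace a with (b + - (b - a)) at 1 by ring. rewrite <- (Rabs_Ropp (b - a)). apply Rabs_triang. }
    lra. }
  (* The error of approximation, of total size 2, is negligible because
     [3/4 - delta/2] is at least [1/4], and [L^3] is at most [N^(3/16)] up to a
     constant. *)
  assert (Hbig : 2 <= c1 / 2 / L ^ 3 * Q).
  { assert (HLr := logf_le_root 16 N ltac:(lia) HNpos). fold L in HLr.
    replace (INR 16) with 16 in HLr by (simpl; ring).
    set (r := Rpower (INR N) (/ 16)) in *.
    assert (Hr0 : 0 < r) by apply exp_pos.
    assert (Hr4 : r ^ 4 <= Q).
    { unfold r; rewrite <- Rpower_pow, Rpower_mult by apply exp_pos.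
      apply Rle_Rpower; [apply (le_INR 1); exact HNpos | simpl; lra]. }
    assert (Hr : 4 * 16 ^ 3 / c1 <= r).
    { assert (Hq : 0 < 4 * 16 ^ 3 / c1) by (apply Rdiv_lt_0_compat; lra).
      rewrite <- (Rpower_1 (4 * 16 ^ 3 / c1)) by exact Hq.
      replace 1 with (16 * / 16) at 1 by field. rewrite <- Rpower_mult.
      apply Rle_Rpower_l; [lra|]. split; [apply exp_pos|].
      apply Rle_trans with (INR N1); [lra | apply le_INR; lia]. }
    apply (Rmult_le_reg_l (2 * L ^ 3 / c1)); [apply Rdiv_lt_0_compat; lra|].
    replace (2 * L ^ 3 / c1 * (c1 / 2 / L ^ 3 * Q)) with Q by (field; split; lra).
    apply Rle_trans with (r * r ^ 3); [|replace (r * r ^ 3) with (r ^ 4) by ring; exact Hr4].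
    assert (H3 : L ^ 3 <= (16 * r) ^ 3) by (apply pow_incr; lra).
    assert (Hr3 : 0 < r ^ 3) by (apply pow_lt; exact Hr0).
    apply Rle_trans with (4 * 16 ^ 3 / c1 * r ^ 3); [|apply Rmult_le_compat_r; lra].
    replace (2 * L ^ 3 / c1 * 2) with (4 / c1 * L ^ 3) by (field; lra).
    replace (4 * 16 ^ 3 / c1 * r ^ 3) with (4 / c1 * (16 * r) ^ 3) by (field; lra).
    apply Rmult_le_compat_l; [left; apply Rdiv_lt_0_compat; lra | exact H3]. }
  lra.
Qed.

(** * Counting grid squares *)

Definition zrange (a b : Z) : list Z :=
  map (fun k => (a + Z.of_nat k)%Z) (seq 0 (Z.to_nat (b - a + 1))).

Lemma in_zrange a b j : In j (zrange a b) <-> (a <= j <= b)%Z.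
Proof.
  unfold zrange; rewrite in_map_iff; split.
  - intros [k [<- Hk]]; apply in_seq in Hk; lia.
  - intros H; exists (Z.to_nat (j - a)); split; [lia | apply in_seq; lia].
Qed.

Lemma NoDup_zrange a b : NoDup (zrange a b).
Proof. apply FinFun.Injective_map_NoDup; [intros x y E; lia | apply seq_NoDup]. Qed.

Lemma length_zrange a b : (a <= b + 1)%Z -> INR (length (zrange a b)) = IZR b - IZR a + 1.
Proof.
  intros H; unfold zrange; rewrite length_map, length_seq, INR_IZR_INZ, Z2Nat.id by lia.
  rewrite plus_IZR, minus_IZR; reflexivity.
Qed.

Definition columns (l : list Z) (lo hi : Z -> Z) : list (Z * Z) :=
  flat_map (fun i => map (pair i) (zrange (lo i) (hi i))) l.

Lemma in_columns l lo hi i j : In (i, j) (columns l lo hi) <-> In i l /\ (lo i <= j <= hi i)%Z.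
Proof.
  unfold columns; rewrite in_flat_map; split.
  - intros [k [Hk Hj]]; apply in_map_iff in Hj; destruct Hj as [j' [E Hj]].
    inversion E; subst; rewrite in_zrange in Hj; auto.
  - intros [Hi Hj]; exists i; split; [exact Hi|]. apply in_map, in_zrange, Hj.
Qed.

Lemma NoDup_columns l lo hi : NoDup l -> NoDup (columns l lo hi).
Proof.
  induction 1 as [|i l Hi Hl IH]; simpl; [constructor|].
  apply NoDup_app.
  - apply FinFun.Injective_map_NoDup; [intros x y E; congruence | apply NoDup_zrange].
  - exact IH.
  - intros [a b] Ha Hb; apply in_map_iff in Ha; destruct Ha as [j [E _]].
    apply in_columns in Hb; inversion E; subst; tauto.
Qed.

Lemma length_columns l lo hi :
  INR (length (columns l lo hi)) = lsum l (fun i => INR (length (zrange (lo i) (hi i)))).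
Proof.
  unfold columns; rewrite length_flat_map_lsum; apply lsum_ext; intros; rewrite length_map; reflexivity.
Qed.

Lemma Int_part_bounds r : IZR (Int_part r) <= r < IZR (Int_part r) + 1.
Proof. destruct (base_Int_part r); lra. Qed.

Lemma Int_part_le r z : IZR z <= r -> (z <= Int_part r)%Z.
Proof.
  intros H; assert (Hb := Int_part_bounds r).
  apply Z.lt_succ_r, lt_IZR; rewrite succ_IZR; lra.
Qed.

Lemma Int_part_mono r s : r <= s -> (Int_part r <= Int_part s)%Z.
Proof. intros H; apply Int_part_le; generalize (Int_part_bounds r); lra. Qed.

Lemma square_ordinate N j y : (0 < N)%nat ->
  IZR j / INR N <= y <= (IZR j + 1) / INR N <-> IZR j <= INR N * y <= IZR j + 1.
Proof.
  intros HN; assert (HN' : 0 < INR N) by (apply lt_0_INR; exact HN).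
  assert (E : forall z, z = INR N * (z / INR N)) by (intros; field; lra).
  split; intros [H1 H2]; split.
  - rewrite (E (IZR j)); apply Rmult_le_compat_l; lra.
  - rewrite (E (IZR j + 1)); apply Rmult_le_compat_l; lra.
  - apply (Rmult_le_reg_l (INR N)); [exact HN'|]; rewrite <- E; exact H1.
  - apply (Rmult_le_reg_l (INR N)); [exact HN'|]; rewrite <- E; exact H2.
Qed.

Lemma in_cell_unit N i x : (i < N)%nat -> in_cell N i x -> 0 <= x <= 1.
Proof.
  intros Hi [H1 H2]. assert (HN' : 0 < INR N) by (apply lt_0_INR; lia).
  assert (Hi0 := pos_INR i).
  assert (INR i + 1 <= INR N) by (rewrite <- S_INR; apply le_INR; lia).
  split.
  - eapply Rle_trans; [|exact H1]. apply Rmult_le_pos; [exact Hi0 | left; apply Rinv_0_lt_compat; exact HN'].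
  - eapply Rle_trans; [exact H2|]. apply (Rmult_le_reg_r (INR N)); [exact HN'|].
    unfold Rdiv; rewrite Rmult_assoc, Rinv_l by lra; lra.
Qed.

(** By the intermediate value theorem, all squares of a column lying between
    two values of the function meet its graph. *)
Lemma column_met (f : R -> R) N i x y j :
  cont f -> (i < N)%nat -> in_cell N i x -> in_cell N i y ->
  (Int_part (INR N * Rmin (f x) (f y)) <= j <= Int_part (INR N * Rmax (f x) (f y)))%Z ->
  meets_graph f N (Z.of_nat i, j).
Proof.
  intros Hf Hi Hx Hy [Hj1 Hj2].
  assert (HN : (0 < N)%nat) by lia. assert (HN' : 0 < INR N) by (apply lt_0_INR; exact HN).
  assert (Hpt : exists z, in_cell N i z /\ IZR j <= INR N * f z <= IZR j + 1).
  { assert (B1 := Int_part_bounds (INR N * Rmin (f x) (f y))).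
    assert (B2 := Int_part_bounds (INR N * Rmax (f x) (f y))).
    destruct (Z.eq_dec j (Int_part (INR N * Rmin (f x) (f y)))) as [->|Hne].
    - destruct (Rmin_case_strong (f x) (f y) (fun m => exists z, in_cell N i z /\ f z = m)) as [z [Hz Ez]].
      + intros _; exists x; auto.
      + intros _; exists y; auto.
      + exists z; rewrite Ez; split; [exact Hz | lra].
    - assert (Hlow : IZR (Int_part (INR N * Rmin (f x) (f y))) + 1 <= IZR j)
        by (rewrite <- plus_IZR; apply IZR_le; lia).
      apply IZR_le in Hj2.
      destruct (IVT_gen f x y (IZR j / INR N)) as [z [Hz Ez]].
      + intros z; apply continuity_pt_filterlim, Hf.
      + split; (apply (Rmult_le_reg_l (INR N)); [exact HN'|];
          replace (INR N * (IZR j / INR N)) with (IZR j) by (field; lra)); lra.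
      + exists z; split.
        * destruct Hx, Hy; split.
          -- eapply Rle_trans; [|apply Hz]; apply Rmin_case; assumption.
          -- eapply Rle_trans; [apply Hz|]; apply Rmax_case; assumption.
        * rewrite Ez; replace (INR N * (IZR j / INR N)) with (IZR j) by (field; lra); lra. }
  destruct Hpt as [z [Hz Hfz]].
  exists (z, f z); split; [split|split]; cbn [fst snd].
  - rewrite <- INR_IZR_INZ; exact Hz.
  - apply square_ordinate; assumption.
  - apply (in_cell_unit N i); assumption.
  - reflexivity.
Qed.

Lemma count_lower (f : R -> R) N n (x y : nat -> R) :
  cont f -> (0 < N)%nat -> is_grid_count f N n ->
  cell_points N x -> cell_points N y ->
  INR N * lsum (seq 0 N) (fun i => Rabs (f (x i) - f (y i))) <= INR n.
Proof.
  intros Hf HN (l & Hnd & Hl & Hlen) Hx Hy.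
  assert (HN' : 0 < INR N) by (apply lt_0_INR; exact HN).
  set (lo := fun i => Int_part (INR N * Rmin (f (x (Z.to_nat i))) (f (y (Z.to_nat i))))).
  set (hi := fun i => Int_part (INR N * Rmax (f (x (Z.to_nat i))) (f (y (Z.to_nat i))))).
  set (c := columns (map Z.of_nat (seq 0 N)) lo hi).
  assert (Hc : (length c <= length l)%nat).
  { apply NoDup_incl_length.
    - apply NoDup_columns, FinFun.Injective_map_NoDup; [intros a b E; lia | apply seq_NoDup].
    - intros [i j] Hij; apply in_columns in Hij; destruct Hij as [Hi Hj].
      apply in_map_iff in Hi; destruct Hi as [k [<- Hk]]; apply in_seq in Hk.
      unfold lo, hi in Hj; rewrite Nat2Z.id in Hj.
      apply Hl, (column_met f N k (x k) (y k)); auto; [lia|apply Hx; lia|apply Hy; lia]. }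
  apply le_INR in Hc; rewrite Hlen in Hc.
  eapply Rle_trans; [|exact Hc].
  unfold c; rewrite length_columns, lsum_map, <- lsum_scal; apply lsum_le; intros i _.
  unfold lo, hi; rewrite Nat2Z.id.
  set (a := f (x i)); set (b := f (y i)).
  assert (Hm : INR N * Rmin a b <= INR N * Rmax a b).
  { apply Rmult_le_compat_l; [lra|]. eapply Rle_trans; [apply Rmin_l | apply Rmax_l]. }
  assert (Hmono := Int_part_mono _ _ Hm).
  rewrite length_zrange by lia.
  assert (B1 := Int_part_bounds (INR N * Rmin a b)). assert (B2 := Int_part_bounds (INR N * Rmax a b)).
  assert (E : Rabs (a - b) = Rmax a b - Rmin a b).
  { destruct (Rle_or_lt a b).
    - rewrite Rmax_right, Rmin_left, Rabs_left1 by lra; ring.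
    - rewrite Rmax_left, Rmin_right, Rabs_pos_eq by lra; ring. }
  rewrite E; lra.
Qed.

(** The squares meeting the graph form a finite set, of size at most [N]
    times the sum of the oscillations over the cells, up to a bounded error for
    each column; the two columns outside the unit interval meet the graph at
    its endpoints. *)
Lemma count_upper (f : R -> R) N :
  cont f -> (0 < N)%nat ->
  exists n (x y : nat -> R), is_grid_count f N n /\
    cell_points N x /\ cell_points N y /\
    INR n <= INR N * lsum (seq 0 N) (fun i => Rabs (f (x i) - f (y i))) + 3 * INR N + 4.
Proof.
  intros Hf HN.
  assert (HN' : 0 < INR N) by (apply lt_0_INR; exact HN).
  assert (Hext : forall i, exists p : R * R, in_cell N i (fst p) /\ in_cell N i (snd p) /\
    forall z, in_cell N i z -> f (snd p) <= f z <= f (fst p)).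
  { intros i.
    assert (Hle : INR i / INR N <= (INR i + 1) / INR N).
    { unfold Rdiv; apply Rmult_le_compat_r; [left; apply Rinv_0_lt_compat; exact HN' | lra]. }
    assert (Hc : forall z, INR i / INR N <= z <= (INR i + 1) / INR N -> continuity_pt f z)
      by (intros; apply continuity_pt_filterlim, Hf).
    destruct (continuity_ab_maj f _ _ Hle Hc) as [M [HM1 HM2]].
    destruct (continuity_ab_min f _ _ Hle Hc) as [m [Hm1 Hm2]].
    exists (M, m); unfold in_cell; cbn [fst snd]; repeat split; try apply HM2; try apply Hm2;
      [apply Hm1 | apply HM1]; assumption. }
  apply choice in Hext; destruct Hext as [p Hp].
  set (x := fun i => fst (p i)). set (y := fun i => snd (p i)).
  set (lo := fun i => Int_part (INR N * f (y (Z.to_nat i)))).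
  set (hi := fun i => Int_part (INR N * f (x (Z.to_nat i)))).
  set (e0 := Int_part (INR N * f 0)). set (e1 := Int_part (INR N * f 1)).
  set (cand := columns (map Z.of_nat (seq 0 N)) (fun i => (lo i - 1)%Z) hi ++
    columns ((-1)%Z :: nil) (fun _ => (e0 - 1)%Z) (fun _ => e0) ++
    columns (Z.of_nat N :: nil) (fun _ => (e1 - 1)%Z) (fun _ => e1)).
  assert (Hnear : forall j a b v, a <= INR N * v <= b -> IZR j <= INR N * v <= IZR j + 1 ->
    (Int_part a - 1 <= j <= Int_part b)%Z).
  { intros j a b v Hab Hj. split.
    - assert (Int_part a <= j + 1)%Z; [|lia].
      apply le_IZR; rewrite plus_IZR. generalize (Int_part_bounds a); lra.
    - apply Int_part_le; lra. }
  assert (Hcand : forall s, meets_graph f N s -> In s cand).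
  { intros [i j] [[z w] [[Hz Hw] [Hz01 Ew]]]; cbn [fst snd] in *; subst w.
    apply square_ordinate in Hw; [|exact HN].
    apply square_ordinate in Hz; [|exact HN].
    assert (Hi : (-1 <= i <= Z.of_nat N)%Z).
    { split.
      - assert (0 <= i + 1)%Z; [|lia]. apply le_IZR; rewrite plus_IZR.
        assert (0 <= INR N * z) by (apply Rmult_le_pos; lra). lra.
      - apply le_IZR; rewrite <- INR_IZR_INZ.
        assert (INR N * z <= INR N * 1) by (apply Rmult_le_compat_l; lra). lra. }
    unfold cand; rewrite !in_app_iff, !in_columns.
    destruct (Z.eq_dec i (-1)) as [->|H1].
    - right; left; split; [left; reflexivity|].
      assert (z = 0) by nra. subst z. apply (Hnear j (INR N * f 0) (INR N * f 0) (f 0)); [lra|exact Hw].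
    - destruct (Z.eq_dec i (Z.of_nat N)) as [->|H2].
      + right; right; split; [left; reflexivity|].
        rewrite <- INR_IZR_INZ in Hz. assert (z = 1) by nra. subst z.
        apply (Hnear j (INR N * f 1) (INR N * f 1) (f 1)); [lra|exact Hw].
      + left; split.
        * apply in_map_iff; exists (Z.to_nat i); split; [lia | apply in_seq; lia].
        * unfold lo, hi. apply (Hnear j _ _ (f z)); [|exact Hw].
          destruct (Hp (Z.to_nat i)) as (_ & _ & Hq). destruct (Hq z) as [Hq1 Hq2].
          { apply square_ordinate in Hz; [|exact HN].
            unfold in_cell; rewrite INR_IZR_INZ, Z2Nat.id by lia; exact Hz. }
          split; apply Rmult_le_compat_l; lra || assumption. }
  set (dec := fun s t : Z * Z => excluded_middle_informative (s = t)).
  set (P := fun s => if excluded_middle_informative (meets_graph f N s) then true else false).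
  set (l := filter P (nodup dec cand)).
  exists (length l), x, y; split; [|split; [|split]].
  - exists l; split; [apply NoDup_filter, NoDup_nodup|split; [|reflexivity]].
    intros s; unfold l; rewrite filter_In, nodup_In; unfold P.
    destruct (excluded_middle_informative (meets_graph f N s)) as [H|H];
      split; try tauto; [intros _; auto | intros [_ E]; discriminate].
  - intros i _; apply (Hp i).
  - intros i _; apply (Hp i).
  - assert (Hlen : (length l <= length cand)%nat).
    { apply NoDup_incl_length; [apply NoDup_filter, NoDup_nodup|].
      intros s Hs; apply filter_In in Hs; apply (nodup_In dec), Hs. }
    apply le_INR in Hlen; eapply Rle_trans; [exact Hlen|].
    unfold cand; rewrite !length_app, !plus_INR, !length_columns, lsum_map.
    cbn [lsum fold_right]; rewrite !length_zrange by lia; rewrite !minus_IZR.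
    assert (Hmain : lsum (seq 0 N) (fun i => INR (length (zrange (lo (Z.of_nat i) - 1) (hi (Z.of_nat i))))) <=
      INR N * lsum (seq 0 N) (fun i => Rabs (f (x i) - f (y i))) + 3 * INR N).
    { replace (3 * INR N) with (lsum (seq 0 N) (fun _ => 3)) by (rewrite lsum_const, length_seq; ring).
      rewrite <- lsum_scal, <- lsum_plus; apply lsum_le; intros i _.
      unfold lo, hi; rewrite Nat2Z.id.
      destruct (Hp i) as (Hx & _ & Hq). destruct (Hq _ Hx) as [Hyx _].
      fold (x i) (y i) in Hyx.
      assert (Hm : INR N * f (y i) <= INR N * f (x i)) by (apply Rmult_le_compat_l; lra).
      assert (Hmono := Int_part_mono _ _ Hm).
      rewrite length_zrange, minus_IZR, Rabs_pos_eq by (lia || lra).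
      generalize (Int_part_bounds (INR N * f (x i))) (Int_part_bounds (INR N * f (y i))); lra. }
    lra.
Qed.

(** * The box dimension *)

(** Powers of [logf] do not affect the exponent, since [ln (logf N)] is
    [o(ln N)] by [logf_le_root]. *)
Lemma log_ratio_limit (A : nat -> R) D c C N0 :
  0 < c -> 0 < C ->
  (forall N, (N0 <= N)%nat -> (0 < N)%nat ->
    c / logf N ^ 3 * Rpower (INR N) D <= A N <= C * logf N ^ 5 * Rpower (INR N) D) ->
  is_lim_seq (fun N => ln (A N) / ln (INR N)) D.
Proof.
  intros Hc HC H; apply is_lim_seq_spec; intros [eps He]; simpl.
  destruct (INR_unbounded (20 / eps)) as [k Hk].
  assert (Hk0 : 0 < 20 / eps) by (apply Rdiv_lt_0_compat; lra).
  assert (Hkpos : (0 < k)%nat) by (apply INR_lt; simpl; lra).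
  set (B := Rabs (ln c) + Rabs (ln C) + 5 * Rabs (ln (INR k)) + 1).
  assert (HB : 0 < B) by (unfold B; generalize (Rabs_pos (ln c)) (Rabs_pos (ln C)) (Rabs_pos (ln (INR k))); lra).
  destruct (INR_unbounded (exp (4 * B / eps))) as [N1 HN1].
  exists (S (N0 + N1)); intros N HN.
  assert (HNpos : (0 < N)%nat) by lia.
  assert (HN' : 0 < INR N) by (apply lt_0_INR; exact HNpos).
  destruct (H N ltac:(lia) HNpos) as [Hlo Hhi].
  assert (HL := logf_ge_1 N HNpos). assert (HLk := logf_le_root k N Hkpos HNpos).
  set (L := logf N) in *. set (n := ln (INR N)).
  assert (Hn : 4 * B / eps < n).
  { unfold n; rewrite <- (ln_exp (4 * B / eps)). apply ln_increasing; [apply exp_pos|].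
    apply Rlt_le_trans with (INR N1); [lra | apply le_INR; lia]. }
  assert (HB4 : 0 < 4 * B / eps) by (apply Rdiv_lt_0_compat; lra).
  assert (HnB : 4 * B < eps * n).
  { apply (Rmult_lt_compat_l eps) in Hn; [|exact He].
    replace (eps * (4 * B / eps)) with (4 * B) in Hn by (field; lra). exact Hn. }
  assert (Hkk : 0 < INR k) by (apply lt_0_INR; exact Hkpos).
  assert (HlnL : ln L <= ln (INR k) + / INR k * n).
  { eapply Rle_trans; [apply ln_le; [lra|exact HLk]|].
    rewrite ln_mult by (try apply exp_pos; exact Hkk). unfold Rpower; rewrite ln_exp; right; reflexivity. }
  assert (HlnL0 : 0 <= ln L) by (rewrite <- ln_1; apply ln_le; lra).
  assert (Hik : / INR k * n <= eps / 20 * n).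
  { apply Rmult_le_compat_r; [lra|]. replace (eps / 20) with (/ (20 / eps)) by (field; lra).
    apply Rinv_le_contravar; lra. }
  assert (HL3 : 0 < L ^ 3) by (apply pow_lt; lra). assert (HL5 : 0 < L ^ 5) by (apply pow_lt; lra).
  assert (HP : 0 < Rpower (INR N) D) by apply exp_pos.
  assert (HcL : 0 < c / L ^ 3) by (apply Rdiv_lt_0_compat; assumption).
  assert (HA : 0 < A N) by (eapply Rlt_le_trans; [|exact Hlo]; apply Rmult_lt_0_compat; assumption).
  apply ln_le in Hlo; [|apply Rmult_lt_0_compat; assumption].
  apply ln_le in Hhi; [|exact HA].
  rewrite ln_mult in Hlo by assumption.
  rewrite ln_div in Hlo by assumption.
  assert (HCL : 0 < C * L ^ 5) by (apply Rmult_lt_0_compat; assumption).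
  rewrite ln_mult, ln_mult in Hhi by assumption.
  rewrite !ln_pow in * by lra. unfold Rpower in Hlo, Hhi; rewrite ln_exp in Hlo, Hhi.
  fold n in Hlo, Hhi. simpl (INR 3) in Hlo; simpl (INR 5) in Hhi.
  fold n.
  assert (Habs : Rabs (ln (A N) - D * n) < eps * n).
  { assert (X1 := Rle_abs (ln C)). assert (X2 := Rle_abs (- ln c)). rewrite Rabs_Ropp in X2.
    assert (X3 := Rle_abs (ln (INR k))).
    assert (Y1 := Rabs_pos (ln c)). assert (Y2 := Rabs_pos (ln C)). assert (Y3 := Rabs_pos (ln (INR k))).
    unfold B in HnB. apply Rabs_def1; lra. }
  replace (ln (A N) / n - D) with ((ln (A N) - D * n) / n) by (field; lra).
  unfold Rdiv; rewrite Rabs_mult, Rabs_inv, (Rabs_pos_eq n) by lra.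
  apply (Rmult_lt_reg_r n); [lra|]. rewrite Rmult_assoc, Rinv_l by lra. lra.
Qed.

Lemma box_dim_of_profile delta g a0 W al be d (s1 s2 : R) :
  0 < delta <= 1 -> cont g -> profile g a0 W al be -> square_free d -> (0 < d)%nat ->
  is_lim_seq (fun n => lsum (seq 1 n) (fun m => Rpower (INR m) delta * al (m * m * d)%nat)) s1 ->
  is_lim_seq (fun n => lsum (seq 1 n) (fun m => Rpower (INR m) delta * be (m * m * d)%nat)) s2 ->
  0 < s1 ^ 2 + s2 ^ 2 ->
  is_box_dim (G delta g) (7 / 4 - delta / 2).
Proof.
  intros Hdel Hg Hprof Hsf Hd L1 L2 Hsig.
  assert (HG : cont (G delta g)).
  { apply (cont_G delta g (Rabs a0 + W)); [lra|exact Hg|].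
    apply (profile_bounded g a0 W al be Hprof). }
  destruct (osc_upper delta g a0 W al be Hdel Hprof) as (C & HC & HU).
  destruct (osc_lower delta g a0 W al be d s1 s2 Hdel Hprof Hsf Hd L1 L2 Hsig) as (c & N0 & Hc & HLo).
  assert (Hcount : forall N, exists n, (0 < N)%nat -> exists x y : nat -> R, is_grid_count (G delta g) N n /\
    cell_points N x /\ cell_points N y /\
    INR n <= INR N * lsum (seq 0 N) (fun i => Rabs (G delta g (x i) - G delta g (y i))) + 3 * INR N + 4).
  { intros [|N]; [exists 0%nat; lia|].
    destruct (count_upper (G delta g) (S N) HG ltac:(lia)) as (n & x & y & Hn).
    exists n; intros _; exists x, y; exact Hn. }
  apply choice in Hcount; destruct Hcount as [A HA].
  exists A; split.
  { intros N HN; destruct (HA N HN) as (x & y & Hn & _); exact Hn. }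
  apply (log_ratio_limit (fun N => INR (A N)) (7 / 4 - delta / 2) c (C + 10) N0); [exact Hc|lra|].
  intros N HN HNpos.
  assert (HN1 : 1 <= INR N) by (apply (le_INR 1); exact HNpos).
  destruct (HA N HNpos) as (x & y & Hcnt & Hx & Hy & Hup).
  assert (HL := logf_ge_1 N HNpos). set (L := logf N) in *.
  set (Q := Rpower (INR N) (3 / 4 - delta / 2)).
  assert (HQ : Rpower (INR N) (7 / 4 - delta / 2) = INR N * Q).
  { unfold Q; replace (7 / 4 - delta / 2) with (1 + (3 / 4 - delta / 2)) by field.
    rewrite Rpower_plus, Rpower_1 by lra; reflexivity. }
  rewrite HQ; split.
  - destruct (HLo N HN) as (x' & y' & Hx' & Hy' & Hs).
    assert (Hl := count_lower (G delta g) N (A N) x' y' HG HNpos Hcnt Hx' Hy').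
    eapply Rle_trans; [|exact Hl].
    replace (c / L ^ 3 * (INR N * Q)) with (INR N * (c / L ^ 3 * Q)) by ring.
    apply Rmult_le_compat_l; [lra | exact Hs].
  - specialize (HU N x y HNpos Hx Hy); fold L in HU.
    set (o := fun i => Rabs (G delta g (x i) - G delta g (y i))) in *.
    (* At the typical oscillation [t] the tangent inequality loses only a
       constant factor. *)
    set (t := Rpower (INR N) (- (/ 4 + delta / 2))).
    assert (Ht : 0 < t) by apply exp_pos.
    assert (Et4 : INR N * t ^ 4 = Q * t ^ 3).
    { replace (t ^ 4) with (t * t ^ 3) by ring. rewrite <- Rmult_assoc; f_equal.
      unfold t, Q. rewrite <- (Rpower_1 (INR N)) at 1 by lra. rewrite <- Rpower_plus; f_equal; field. }
    assert (Ed : Rpower (INR N) (- (2 * delta)) = Q * t ^ 3).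
    { unfold t, Q. rewrite <- Rpower_pow, Rpower_mult, <- Rpower_plus by apply exp_pos.
      f_equal; simpl; field. }
    rewrite Ed in HU.
    assert (Ht3 : 0 < t ^ 3) by (apply pow_lt; exact Ht).
    assert (HQ1 : 1 <= Q).
    { unfold Q; rewrite <- (Rpower_O (INR N)) by lra. apply Rle_Rpower; lra. }
    assert (Hsum : 4 * t ^ 3 * lsum (seq 0 N) o <= (C * L ^ 5 + 3) * (Q * t ^ 3)).
    { rewrite <- lsum_scal.
      apply Rle_trans with (lsum (seq 0 N) (fun i => (G delta g (x i) - G delta g (y i)) ^ 4 + 3 * t ^ 4)).
      - apply lsum_le; intros i _. unfold o. set (z := G delta g (x i) - G delta g (y i)).
        rewrite <- (pow4_abs z).
        apply pow4_tangent.
      - rewrite lsum_plus, lsum_const, length_seq. lra. }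
    assert (Hs : lsum (seq 0 N) o <= (C * L ^ 5 + 3) * Q).
    { assert (Ho : 0 <= lsum (seq 0 N) o) by (apply lsum_nonneg; intros; apply Rabs_pos).
      apply (Rmult_le_reg_l (t ^ 3)); [exact Ht3|]. 
      assert (0 <= t ^ 3 * lsum (seq 0 N) o) by (apply Rmult_le_pos; lra). lra. }
    assert (HL5 : 1 <= L ^ 5) by (apply pow_R1_Rle; exact HL).
    eapply Rle_trans; [exact Hup|].
    assert (H1 : INR N * lsum (seq 0 N) o <= INR N * ((C * L ^ 5 + 3) * Q))
      by (apply Rmult_le_compat_l; lra).
    assert (H2 : INR N <= INR N * Q) by (rewrite <- (Rmult_1_r (INR N)) at 1; apply Rmult_le_compat_l; lra).
    assert (H3 : INR N * Q <= L ^ 5 * (INR N * Q)).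
    { rewrite <- (Rmult_1_l (INR N * Q)) at 1. apply Rmult_le_compat_r; lra. }
    replace (INR N * ((C * L ^ 5 + 3) * Q)) with (C * L ^ 5 * (INR N * Q) + 3 * (INR N * Q)) in H1 by ring.
    replace ((C + 10) * L ^ 5 * (INR N * Q)) with (C * L ^ 5 * (INR N * Q) + 10 * (L ^ 5 * (INR N * Q))) by ring.
    lra.
Qed.

Lemma fourier_coef_pair g z : cont g ->
  fourier_coef g z = (RInt (fun t => g t * cs z t) 0 1, - RInt (fun t => g t * sn z t) 0 1).
Proof.
  intros Hg; unfold fourier_coef.
  apply (is_RInt_unique (V := C_R_CompleteNormedModule)).
  apply (is_RInt_fct_extend_pair (U := R_NormedModule) (V := R_NormedModule)).
  - apply (is_RInt_ext (fun t => g t * cs z t)).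
    + intros t _; simpl; unfold cs.
      replace (2 * PI * (IZR z * t)) with (- (2 * PI * (- IZR z * t))) by ring.
      rewrite cos_neg; Rring.
    + apply (RInt_correct (V := R_CompleteNormedModule)), ex_RInt_cont; auto with cont.
  - apply (is_RInt_ext (fun t => (-1) * (g t * sn z t))).
    + intros t _; simpl; unfold sn.
      replace (2 * PI * (IZR z * t)) with (- (2 * PI * (- IZR z * t))) by ring.
      rewrite sin_neg; Rring.
    + replace (- RInt (fun t => g t * sn z t) 0 1) with (RInt (fun t => (-1) * (g t * sn z t)) 0 1)
        by (rewrite int_scal by auto with cont; Rring).
      apply (RInt_correct (V := R_CompleteNormedModule)), ex_RInt_cont; auto with cont.
Qed.

Lemma fourier_coef_real g k : cont g ->
  fourier_coef g (Z.of_nat k) = (coef_cos g k / 2, - (coef_sin g k / 2)).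
Proof.
  intros Hg; rewrite fourier_coef_pair by exact Hg; unfold coef_cos, coef_sin.
  assert (E : forall u : R, u = 2 * u / 2) by (intros; field).
  rewrite <- !E; reflexivity.
Qed.

Lemma sum_n_components (a : nat -> C) n :
  sum_n (G := C_AbelianMonoid) a n =
  (lsum (seq 0 (S n)) (fun k => fst (a k)), lsum (seq 0 (S n)) (fun k => snd (a k))).
Proof.
  induction n as [|n IH].
  - rewrite sum_O; cbn [seq lsum fold_right]; rewrite !Rplus_0_r; destruct (a 0%nat); reflexivity.
  - rewrite sum_Sn, IH, !(lsum_seq_S 0 (S n)).
    destruct (a (0 + S n)%nat) eqn:Ea; simpl in Ea; rewrite Ea; reflexivity.
Qed.

Lemma is_series_components (a : nat -> C) (s : C) :
  is_series (V := C_NormedModule) a s ->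
  is_lim_seq (fun n => lsum (seq 0 (S n)) (fun k => fst (a k))) (fst s) /\
  is_lim_seq (fun n => lsum (seq 0 (S n)) (fun k => snd (a k))) (snd s).
Proof.
  intros Hs.
  assert (Hf := proj1 (filterlim_locally _ _) Hs).
  split; apply is_lim_seq_spec; intros eps; specialize (Hf eps);
    revert Hf; apply filter_imp; intros n Hn;
    change (sum_n (G := NormedModule.AbelianMonoid _ C_NormedModule) a n)
      with (sum_n (G := C_AbelianMonoid) a n) in Hn; rewrite sum_n_components in Hn.
  - apply (proj1 Hn).
  - apply (proj2 Hn).
Qed.

Lemma Rpower_square_weight delta m d : (0 < m)%nat -> (0 < d)%nat ->
  Rpower (INR (m * m * d)) (delta / 2) = Rpower (INR m) delta * Rpower (INR d) (delta / 2).
Proof.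
  intros Hm Hd.
  assert (0 < INR m) by (apply lt_0_INR; exact Hm). assert (0 < INR d) by (apply lt_0_INR; exact Hd).
  rewrite !mult_INR, <- !Rpower_mult_distr by (try apply Rmult_lt_0_compat; assumption).
  rewrite <- Rpower_plus; do 2 f_equal; field.
Qed.

(** For [k = m^2 d] the weight [k^(delta/2)] is [m^delta] up to the constant
    [d^(delta/2)]; the real and imaginary parts of the series in the hypothesis
    are therefore multiples of the limits in [box_dim_of_profile]. *)
Lemma box_dim_smooth delta (g : R -> R) :
  0 < delta <= 1 -> periodic1 g -> (forall x, ex_derive g x) -> lipschitz (Derive g) ->
  (exists d0 : nat, (0 < d0)%nat /\ square_free d0 /\
     exists s : C,
       is_series (V := C_NormedModule)
         (fun m : nat => weighted (fourier_coef g) delta (S m * S m * d0)) s /\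
       s <> RtoC 0) ->
  is_box_dim (G delta g) (7 / 4 - delta / 2).
Proof.
  intros Hdel Hp Hd Hlip (d & Hd0 & Hsf & s & Hs & Hne).
  assert (Hg : cont g) by (intros y; apply (ex_derive_continuous g), Hd).
  destruct (fourier_expansion g Hd Hp Hlip) as (W & HW0 & HW & Happ).
  set (P := Rpower (INR d) (delta / 2)).
  assert (HP : 0 < P) by apply exp_pos.
  destruct (is_series_components _ _ Hs) as [H1 H2].
  assert (Hw : forall m, weighted (fourier_coef g) delta (S m * S m * d) =
    (P / 2 * (Rpower (INR (S m)) delta * coef_cos g (S m * S m * d)),
     - (P / 2) * (Rpower (INR (S m)) delta * coef_sin g (S m * S m * d)))).
  { intros m; unfold weighted; rewrite fourier_coef_real, Rpower_square_weight by (exact Hg || lia).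
    fold P. unfold Cmult, RtoC; cbn [fst snd]; f_equal; field. }
  assert (Hlim : forall (u : nat -> R) (v : R) (a : R), a <> 0 ->
    is_lim_seq (fun n => lsum (seq 0 (S n)) (fun m => a * u (S m))) v ->
    is_lim_seq (fun n => lsum (seq 1 n) u) (/ a * v)).
  { intros u v a Ha Hl. apply is_lim_seq_incr_1.
    apply (is_lim_seq_ext (fun n => / a * lsum (seq 0 (S n)) (fun m => a * u (S m)))).
    - intros n; rewrite lsum_scal, <- Rmult_assoc, Rinv_l, Rmult_1_l by exact Ha.
      rewrite <- (lsum_map S), seq_shift; reflexivity.
    - exact (is_lim_seq_scal_l _ (/ a) (Finite v) Hl). }
  apply (box_dim_of_profile delta g (RInt g 0 1) W (coef_cos g) (coef_sin g) d
           (/ (P / 2) * fst s) (/ (- (P / 2)) * snd s)).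
  - exact Hdel.
  - exact Hg.
  - split; [exact HW0 | split; [exact HW | exact Happ]].
  - exact Hsf.
  - exact Hd0.
  - apply (Hlim (fun m => Rpower (INR m) delta * coef_cos g (m * m * d))); [lra|].
    eapply is_lim_seq_ext; [|exact H1]. intros n; apply lsum_ext; intros m _; rewrite Hw; reflexivity.
  - apply (Hlim (fun m => Rpower (INR m) delta * coef_sin g (m * m * d))); [lra|].
    eapply is_lim_seq_ext; [|exact H2]. intros n; apply lsum_ext; intros m _; rewrite Hw; reflexivity.
  - assert (Hi : / (P / 2) <> 0) by (apply Rinv_neq_0_compat; lra).
    assert (Hi2 : / (- (P / 2)) <> 0) by (apply Rinv_neq_0_compat; lra).
    destruct s as [a b]; cbn [fst snd].
    assert (Hab : a <> 0 \/ b <> 0).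
    { destruct (Req_dec a 0) as [->|]; [|left; assumption].
      destruct (Req_dec b 0) as [->|]; [|right; assumption]. exfalso; apply Hne; reflexivity. }
    destruct Hab as [Ha|Hb].
    + assert (0 < (/ (P / 2) * a) ^ 2) by (apply pow2_gt_0, Rmult_integral_contrapositive; auto).
      generalize (pow2_ge_0 (/ - (P / 2) * b)); lra.
    + assert (0 < (/ - (P / 2) * b) ^ 2) by (apply pow2_gt_0, Rmult_integral_contrapositive; auto).
      generalize (pow2_ge_0 (/ (P / 2) * a)); lra.
Qed.

(** * Trigonometric polynomials *)

Lemma is_derive_trig {A} (l : list A) fr p q x :
  is_derive (trig l fr p q) x
    (trig l fr (fun i => 2 * PI * IZR (fr i) * q i) (fun i => - (2 * PI * IZR (fr i) * p i)) x).
Proof.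
  unfold trig.
  apply is_derive_lsum with (df := fun i x => 2 * PI * IZR (fr i) * q i * cs (fr i) x +
    - (2 * PI * IZR (fr i) * p i) * sn (fr i) x).
  intros i _; unfold cs, sn; auto_derive; [trivial | ring].
Qed.

Lemma lipschitz_trig {A} (l : list A) fr p q : lipschitz (trig l fr p q).
Proof.
  set (p' := fun i => 2 * PI * IZR (fr i) * q i). set (q' := fun i => - (2 * PI * IZR (fr i) * p i)).
  exists (lsum l (fun i => Rabs (p' i) + Rabs (q' i))); intros x y.
  destruct (MVT_gen (trig l fr p q) y x (trig l fr p' q')) as [z [_ E]].
  - intros; apply is_derive_trig.
  - intros z _; apply continuity_pt_filterlim, cont_trig0.
  - rewrite E, Rabs_mult; apply Rmult_le_compat_r; [apply Rabs_pos|].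
    unfold trig; eapply Rle_trans; [apply lsum_Rabs|].
    apply lsum_le; intros; apply trig_term_bound.
Qed.

Definition index_of (N j : nat) : Z := (Z.of_nat j - Z.of_nat N)%Z.

Lemma trig_poly_components N c (g : R -> R) :
  (forall x, RtoC (g x) = trig_poly N c x) ->
  (forall x, g x = trig (seq 0 (S (2 * N))) (index_of N)
     (fun j => fst (c (index_of N j))) (fun j => - snd (c (index_of N j))) x) /\
  (forall x, 0 = trig (seq 0 (S (2 * N))) (index_of N)
     (fun j => snd (c (index_of N j))) (fun j => fst (c (index_of N j))) x).
Proof.
  intros H.
  assert (E : forall x, (g x, 0) = (
    trig (seq 0 (S (2 * N))) (index_of N)
      (fun j => fst (c (index_of N j))) (fun j => - snd (c (index_of N j))) x,
    trig (seq 0 (S (2 * N))) (index_of N)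
      (fun j => snd (c (index_of N j))) (fun j => fst (c (index_of N j))) x)).
  { intros x; change (g x, 0) with (RtoC (g x)); rewrite H; unfold trig_poly.
    rewrite sum_n_components; unfold trig; f_equal; apply lsum_ext; intros j _;
      unfold Cmult, e2pi, cs, sn, index_of; cbn [fst snd]; ring. }
  split; intros x; generalize (E x); intros Ex; injection Ex; auto.
Qed.

(** The vanishing of the imaginary part lets the product with [e(-z x)] be
    expanded with complex exponentials. *)
Lemma trig_poly_fourier_coef N c (g : R -> R) (z : Z) :
  (forall x, RtoC (g x) = trig_poly N c x) ->
  fourier_coef g z = if ((- Z.of_nat N <=? z) && (z <=? Z.of_nat N))%Z%bool then c z else RtoC 0.
Proof.
  intros H; destruct (trig_poly_components N c g H) as [Hre Him].
  set (l := seq 0 (S (2 * N))) in *.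
  assert (Hg : cont g).
  { intros x; apply (continuous_ext _ _ x (fun y => eq_sym (Hre y))), cont_trig0. }
  rewrite fourier_coef_pair by exact Hg.
  (* The real parts of [w sum_j c_j e((k_j - z) x)] for [w = 1] and [w = -i]. *)
  assert (Hint : forall p q : nat -> R,
    RInt (fun t => lsum l (fun j => p j * cs (index_of N j - z) (t + 0) +
                                    q j * sn (index_of N j - z) (t + 0))) 0 1 =
    lsum l (fun j => kron (index_of N j) z * p j)).
  { intros p q; rewrite int_lsum by auto 10 with cont. apply lsum_ext; intros j _.
    rewrite int_plus, !int_scal, int_cs, int_sn, kron_minus by auto with cont; Rring. }
  assert (I1 : RInt (fun t => g t * cs z t) 0 1 =
    lsum l (fun j => kron (index_of N j) z * fst (c (index_of N j)))).
  { rewrite <- (Hint _ (fun j => - snd (c (index_of N j)))).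
    apply int_ext; intros t; rewrite Rplus_0_r.
    transitivity (g t * cs z t + 0 * sn z t); [ring|].
    rewrite (Him t), (Hre t); unfold trig.
    rewrite Rmult_comm, <- lsum_scal, (Rmult_comm (lsum _ _) (sn z t)), <- lsum_scal, <- lsum_plus.
    apply lsum_ext; intros j _; rewrite cs_freq_sub, sn_freq_sub; ring. }
  assert (I2 : - RInt (fun t => g t * sn z t) 0 1 =
    lsum l (fun j => kron (index_of N j) z * snd (c (index_of N j)))).
  { transitivity (RInt (fun t => (-1) * (g t * sn z t)) 0 1);
      [rewrite int_scal by auto with cont; Rring|].
    rewrite <- (Hint _ (fun j => fst (c (index_of N j)))).
    apply int_ext; intros t; rewrite Rplus_0_r.
    transitivity (g t * (- sn z t) + 0 * cs z t); [ring|].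
    rewrite (Him t), (Hre t); unfold trig.
    rewrite Rmult_comm, <- lsum_scal, (Rmult_comm (lsum _ _) (cs z t)), <- lsum_scal, <- lsum_plus.
    apply lsum_ext; intros j _; rewrite cs_freq_sub, sn_freq_sub; ring. }
  rewrite I1, I2.
  destruct (Z.leb_spec (- Z.of_nat N) z) as [H1|H1], (Z.leb_spec z (Z.of_nat N)) as [H2|H2]; simpl andb; cbv iota.
  2,3,4: unfold RtoC; f_equal; apply lsum_0; intros j Hj; unfold l in Hj; apply in_seq in Hj;
    rewrite kron_neq by (unfold index_of; lia); ring.
  set (j0 := Z.to_nat (z + Z.of_nat N)).
  assert (E : index_of N j0 = z) by (unfold index_of, j0; lia).
  assert (Hs : forall f : Z -> R, lsum l (fun j => kron (index_of N j) z * f (index_of N j)) = f z).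
  { intros f; rewrite (lsum_single l j0).
    - rewrite E, kron_diag; ring.
    - apply seq_NoDup.
    - apply in_seq; unfold j0; lia.
    - intros j _ Hj; rewrite kron_neq; [ring|].
      intros Ej; apply Hj; unfold index_of in Ej; unfold j0; lia. }
  rewrite (Hs (fun k => fst (c k))), (Hs (fun k => snd (c k))). destruct (c z); reflexivity.
Qed.

Lemma box_dim_trig_poly delta (N : nat) (c : Z -> C) (g : R -> R) :
  0 < delta <= 1 ->
  (forall x : R, RtoC (g x) = trig_poly N c x) ->
  (exists d0 : nat, (0 < d0)%nat /\ square_free d0 /\
     sum_n_m (G := C_AbelianMonoid)
       (fun m : nat =>
          if (m * m * d0 <=? N)%nat
          then weighted c delta (m * m * d0) else RtoC 0) 1 N
     <> RtoC 0) ->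
  is_box_dim (G delta g) (7 / 4 - delta / 2).
Proof.
  intros Hdel H (d & Hd & Hsf & Hne).
  destruct (trig_poly_components N c g H) as [Hre _].
  assert (Hdg : forall x, ex_derive g x).
  { intros x; apply (ex_derive_ext _ _ x (fun y => eq_sym (Hre y))); eexists; apply is_derive_trig. }
  apply box_dim_smooth.
  - exact Hdel.
  - intros x; rewrite !Hre; unfold trig; apply lsum_ext; intros j _.
    assert (Hc := periodic_cs (index_of N j) 0 x). assert (Hs := periodic_sn (index_of N j) 0 x).
    simpl in Hc, Hs; rewrite !Rplus_0_r in Hc, Hs; rewrite Hc, Hs; reflexivity.
  - exact Hdg.
  - destruct (lipschitz_trig (seq 0 (S (2 * N))) (index_of N)
      (fun j => 2 * PI * IZR (index_of N j) * - snd (c (index_of N j)))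
      (fun j => - (2 * PI * IZR (index_of N j) * fst (c (index_of N j))))) as [L HL].
    exists L; intros x y.
    rewrite !(Derive_ext _ _ _ Hre), !(is_derive_unique _ _ _ (is_derive_trig _ _ _ _ _)). apply HL.
  - exists d; split; [exact Hd|split; [exact Hsf|]].
    eexists; split; [|exact Hne].
    set (b := fun m : nat => if (m * m * d <=? N)%nat then weighted c delta (m * m * d) else RtoC 0).
    assert (Hb : forall n, (N <= n)%nat ->
      sum_n_m (G := C_AbelianMonoid) b 1 n = sum_n_m (G := C_AbelianMonoid) b 1 N).
    { intros n Hn; induction Hn as [|n Hn IH]; [reflexivity|].
      rewrite sum_n_Sm, IH by lia.
      replace (b (S n)) with (zero : C_AbelianMonoid); [apply plus_zero_r|].
      unfold b; replace (S n * S n * d <=? N)%nat with false by (symmetry; apply Nat.leb_gt; nia).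
      reflexivity. }
    apply (filterlim_ext_loc (fun _ => sum_n_m (G := C_AbelianMonoid) b 1 N)); [|apply filterlim_const].
    exists N; intros n Hn; rewrite <- (Hb (S n)) by lia.
    unfold sum_n; rewrite <- sum_n_m_S. apply sum_n_m_ext; intros m.
    unfold b, weighted; rewrite (trig_poly_fourier_coef N c g _ H).
    destruct (Nat.leb_spec (S m * S m * d) N) as [Hle|Hgt].
    + replace (_ && _)%bool with true; [reflexivity|].
      symmetry; apply andb_true_intro; split; apply Z.leb_le; lia.
    + replace (_ && _)%bool with false; [symmetry; apply Cmult_0_l|].
      symmetry; rewrite (proj2 (Z.leb_gt (Z.of_nat (S m * S m * d)) (Z.of_nat N))) by lia; destruct (_ <=? _)%Z; reflexivity.
Qed.

Theorem corollary1p5 :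
  forall delta : R, 0 < delta <= 1 ->
  (forall g : R -> R,
     periodic1 g ->
     (forall x : R, ex_derive g x) ->
     lipschitz (Derive g) ->
     (exists d0 : nat, (0 < d0)%nat /\ square_free d0 /\
        exists s : C,
          is_series (V := C_NormedModule)
            (fun m : nat =>
               weighted (fourier_coef g) delta (S m * S m * d0)) s /\
          s <> RtoC 0) ->
     is_box_dim (G delta g) (7 / 4 - delta / 2)) /\
  (forall (N : nat) (c : Z -> C) (g : R -> R),
     (forall x : R, RtoC (g x) = trig_poly N c x) ->
     (exists d0 : nat, (0 < d0)%nat /\ square_free d0 /\
        sum_n_m (G := C_AbelianMonoid)
          (fun m : nat =>
             if (m * m * d0 <=? N)%nat
             then weighted c delta (m * m * d0) else RtoC 0) 1 N
        <> RtoC 0) ->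
     is_box_dim (G delta g) (7 / 4 - delta / 2)).
Proof.
  intros delta Hdel; split.
  - intros g Hp Hd Hlip Hs; apply box_dim_smooth; assumption.
  - intros N c g Hg Hs; apply (box_dim_trig_poly delta N c); assumption.
Qed.
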